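(* Let $0<q<1$, $K>0$, $A>0$ be fixed with respect to $N$, and let $$\lambda=\min\left\{\frac{1}{2}q,\ \frac{2}{d}(1-q)\right\}.$$ Suppose $(f,\eta)$ satisfies conditions (a), (b), (c), (d) and the additional condition (T) of the context. Then the excess risk of the adaptive $k$NN classifier (defined in the context) satisfies, as $N\to\infty$, $$R-R^*=\begin{cases}\mathcal{O}\left(N^{-\min\left\{\frac{\lambda\beta(\alpha+1)}{\lambda\alpha+\beta},\ \beta\right\}}\right) & \text{if } \beta\neq\lambda,\\[1mm] \mathcal{O}(N^{-\beta}\ln N) & \text{if } \beta=\lambda.\end{cases}$$ As a result, the optimal $q$ (giving the best rate in this bound) is $q^*=4/(d+4)$, and the corresponding optimal convergence rate is $$R-R^*=\begin{cases}\mathcal{O}\left(N^{-\min\left\{\frac{2\beta(\alpha+1)}{\beta d+2(\alpha+2\beta)},\ \beta\right\}}\right) & \text{if } \beta\neq\frac{2}{d+4},\\[1mm] \mathcal{O}(N^{-\beta}\ln N) & \text{if } \beta=\frac{2}{d+4}.\end{cases}$$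
   Context: Classification setting. $(\mathbf{X},Y)$ takes values in $\mathbb{R}^d\times\{-1,1\}$; $\mathbf{X}$ has probability density $f$, and $\eta(\mathbf{x}):=\mathbb{E}[Y|\mathbf{X}=\mathbf{x}]$. A classifier $g$ is built from $N$ i.i.d. training samples $(\mathbf{X}_i,Y_i)$, $i=1,\dots,N$, with the law of $(\mathbf{X},Y)$, independent of the test pair $(\mathbf{X},Y)$. Its risk is $R=\mathrm{P}(g(\mathbf{X})\neq Y)$ (probability over the training samples and the test pair). The Bayes classifier is $g^*(\mathbf{x})=\operatorname{sign}(\eta(\mathbf{x}))$, with Bayes risk $R^*=\mathrm{P}(g^*(\mathbf{X})\ne Y)$; the excess risk is $R-R^*=\mathbb{E}[\mathbf{1}(g(\mathbf{X})\neq g^*(\mathbf{X}))|\eta(\mathbf{X})|]$. Let $\|\cdot\|$ be any fixed norm on $\mathbb{R}^d$. $B(\mathbf{x},r)$ is the ball with center $\mathbf{x}$ and radius $r$ in this norm, $V(\cdot)$ denotes volume, and $\mathrm{P}(B(\mathbf{x},r))$ is the probability mass of $B(\mathbf{x},r)$ under the law of $\mathbf{X}$ ($\mathrm{P}^q$ is its $q$-th power). Adaptive $k$NN classifier with parameters $K,A,q$: for a test point $\mathbf{x}$ put $n=\sum_{i=1}^N\mathbf{1}(\mathbf{X}_i\in B(\mathbf{x},A))$ and $k=\lfloor Kn^q\rfloor+1$; then $g(\mathbf{x})=\operatorname{sign}(\hat\eta(\mathbf{x}))$ with $\hat\eta(\mathbf{x})=\frac1k\sum_{i=1}^kY^{(i)}$,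 where $Y^{(i)}$ is the label of the $i$-th nearest neighbor of $\mathbf{x}$ among $\mathbf{X}_1,\dots,\mathbf{X}_N$ with respect to $\|\cdot\|$. Conditions on $(f,\eta)$: there are finite constants $C_a,C_b,C_c,C_b'$, a constant $C_d>0$, and $\alpha>0$, $\beta>0$ such that (a) for all $t>0$, $\mathrm{P}(0<|\eta(\mathbf{X})|\le t)\le C_at^\alpha$; (b) for all $t>0$, $\mathrm{P}(f(\mathbf{X})\le t)\le C_bt^\beta$; (c) for every $r>0$ and every $\mathbf{x}$ in the support of $f$, $|\eta(B(\mathbf{x},r))-\eta(\mathbf{x})|\le C_cr^2$, where $\eta(B(\mathbf{x},r)):=\mathbb{E}[Y|\mathbf{X}\in B(\mathbf{x},r)]$; (d) there is $D>0$ such that $\mathrm{P}(B(\mathbf{x},r))\ge C_df(\mathbf{x})V(B(\mathbf{x},r))$ for all $\mathbf{x}$ and all $0<r<D$; (T) for any $t>0$, $\mathrm{P}\left(\dfrac{f(\mathbf{X})}{\mathrm{P}^q(B(\mathbf{X},A))}<t^{1-q}\right)\le C_b't^\beta$ (with the same $q$ and $A$ as in the adaptive classifier). $\mathcal{O}$ is with respect to $N\to\infty$, with constants not depending on $N$. *)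

(* Defs.v *)
From HB Require Import structures.
From mathcomp Require Import all_boot all_order all_algebra.
From mathcomp Require Import all_classical all_reals all_analysis.

Set Implicit Arguments.
Unset Strict Implicit.
Unset Printing Implicit Defensive.

Import Order.TTheory GRing.Theory Num.Theory.
Import numFieldNormedType.Exports.

Local Open Scope classical_set_scope.
Local Open Scope ring_scope.

Definition measure_rV_display : measure_display -> measure_display.
Proof. exact. Qed.

Section measurable_rV.
Context {d} {T : sigmaRingType d}.
Variable n : nat.

Let coors : 'I_n -> 'rV[T]_n -> T := fun i v => v ord0 i.

Let rV_set0 : g_sigma_preimage coors set0.
Proof. exact: sigma_algebra0. Qed.

Let rV_setC A : g_sigma_preimage coors A -> g_sigma_preimage coors (~` A).
Proof. exact: sigma_algebraC. Qed.

Let rV_bigcup (F : _^nat) : (forall i, g_sigma_preimage coors (F i)) ->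
  g_sigma_preimage coors (\bigcup_i (F i)).
Proof. exact: sigma_algebra_bigcup. Qed.

(** The sigma-algebra generated by the coordinates; for [T := R] it is the
    Borel sigma-algebra of [R^n]. *)
HB.instance Definition _ := @isMeasurable.Build (measure_rV_display d)
  'rV[T]_n (g_sigma_preimage coors) rV_set0 rV_setC rV_bigcup.

Lemma measurable_coord (i : 'I_n) :
  measurable_fun [set: 'rV[T]_n] (fun v => v ord0 i).
Proof.
move=> _ Y mY; rewrite setTI; apply: sub_sigma_algebra => /=.
rewrite -bigcup_seq/=; exists i => /=; first by rewrite mem_index_enum.
by exists Y => //; rewrite setTI.
Qed.

End measurable_rV.

Lemma measurable_fun_coordP d1 d2 (T1 : measurableType d1)
    (T2 : measurableType d2) n (f : T1 -> 'rV[T2]_n) :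
  (forall i, measurable_fun [set: T1] (fun x => f x ord0 i)) ->
  measurable_fun [set: T1] f.
Proof.
move=> mf.
pose c := fun (i : 'I_n) (v : 'rV[T2]_n) => v ord0 i.
apply: (measurability (\big[setU/set0]_(i < n)
  preimage_set_system setT (c i) measurable) erefl).
move=> _ [B + <-]; rewrite -bigcup_seq => -[i _ [C mC <-]].
by rewrite !setTI -comp_preimage -[X in measurable X]setTI; exact: mf.
Qed.

Section lebesgue_rV.
Context {R : realType}.

Definition cons_rV n (p : R * 'rV[R]_n) : 'rV[R]_n.+1 := row_mx p.1%:M p.2.

Definition behead_rV n (v : 'rV[R]_n.+1) : 'rV[R]_n := rsubmx (v : 'rV_(1 + n)).

Lemma cons_rV0 n p : @cons_rV n p ord0 ord0 = p.1.
Proof.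
by rewrite /cons_rV mxE; case: splitP => [j _|k]//; rewrite !ord1 mxE.
Qed.

Lemma cons_rVS n p (i : 'I_n) : cons_rV p ord0 (lift ord0 i) = p.2 ord0 i.
Proof.
rewrite /cons_rV mxE; case: splitP => [j|k] /=; first by rewrite ord1.
by rewrite /bump !add1n => -[/val_inj ->].
Qed.

Lemma behead_cons_rV n p : behead_rV (@cons_rV n p) = p.2.
Proof. exact: row_mxKr. Qed.

Lemma measurable_cons_rV n : measurable_fun setT (@cons_rV n).
Proof.
apply: measurable_fun_coordP => i; have [->|] := eqVneq i ord0.
  by under eq_fun do rewrite cons_rV0; exact: measurable_fst.
rewrite eq_sym => /unlift_some[j -> _]; under eq_fun do rewrite cons_rVS.
exact: measurableT_comp (measurable_coord j) measurable_snd.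
Qed.

Lemma measurable_behead_rV n : measurable_fun setT (@behead_rV n).
Proof.
apply: measurable_fun_coordP => i.
by under eq_fun do rewrite mxE; exact: measurable_coord.
Qed.

Section cons_measure.
Variables (n : nat) (m : {sigma_finite_measure set 'rV[R]_n -> \bar R}).

(** Transport of the product measure along [R * R^n ~ R^(n+1)]. *)
Definition cons_measure : set 'rV[R]_n.+1 -> \bar R :=
  pushforward (lebesgue_measure \x m)%E (@cons_rV n).

Let cons_measure0 : cons_measure set0 = 0%E.
Proof. by rewrite /cons_measure /pushforward preimage_set0 measure0. Qed.

Let mpre A : measurable A -> measurable (@cons_rV n @^-1` A).
Proof. by move=> mA; rewrite -[X in measurable X]setTI; exact: measurable_cons_rV. Qed.

Let cons_measure_ge0 A : (0 <= cons_measure A)%E.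
Proof. by rewrite /cons_measure /pushforward; exact: measure_ge0. Qed.

Let cons_measure_sigma_additive : semi_sigma_additive cons_measure.
Proof.
move=> F mF tF mUF; rewrite /cons_measure /pushforward preimage_bigcup.
apply: measure_semi_sigma_additive => [i||].
- exact: mpre.
- apply/trivIsetP => /= i j _ _ ij; rewrite -preimage_setI.
  by move/trivIsetP : tF => /(_ _ _ _ _ ij) ->//; rewrite preimage_set0.
- by rewrite -preimage_bigcup; exact: mpre.
Qed.

HB.instance Definition _ := isMeasure.Build _ _ _ cons_measure
  cons_measure0 cons_measure_ge0 cons_measure_sigma_additive.

Lemma cons_measureE (A : set R) (B : set 'rV[R]_n) :
  measurable A -> measurable B ->
  cons_measure [set v : 'rV[R]_n.+1 | A (v ord0 ord0) /\ B (behead_rV v)] =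
  (lebesgue_measure A * m B)%E.
Proof.
move=> mA mB; rewrite -product_measure1E//; congr (product_measure1 _ _ _).
by apply/seteqP; split=> p; rewrite /= cons_rV0 behead_cons_rV.
Qed.

Let cons_measure_sigma_finite : sigma_finite setT cons_measure.
Proof.
have /sigma_finiteP[F [TF ndF Foo]] := sigma_finiteT (@lebesgue_measure R).
have /sigma_finiteP[G [TG ndG Goo]] := sigma_finiteT m.
exists (fun k => [set v : 'rV[R]_n.+1 | F k (v ord0 ord0) /\ G k (behead_rV v)]).
  apply/esym; rewrite -subTset => v _.
  have [i _ Fi] : (\bigcup_i F i) (v ord0 ord0) by rewrite -TF.
  have [j _ Gj] : (\bigcup_i G i) (behead_rV v) by rewrite -TG.
  exists (maxn i j) => //; split.
    by move: Fi; exact/subsetPset/ndF/leq_maxl.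
  by move: Gj; exact/subsetPset/ndG/leq_maxr.
move=> k; have [mF Fk] := Foo k; have [mG Gk] := Goo k; split.
  apply: measurableI; rewrite -[X in measurable X]setTI.
    exact: measurable_coord.
  exact: measurable_behead_rV.
by rewrite cons_measureE// lte_mul_pinfty// ge0_fin_numE.
Qed.

HB.instance Definition _ := Measure_isSigmaFinite.Build _ _ _ cons_measure
  cons_measure_sigma_finite.

End cons_measure.

Fixpoint lebesgue_rV n : {sigma_finite_measure set 'rV[R]_n -> \bar R} :=
  if n is n'.+1 then cons_measure (lebesgue_rV n') else \d_(0 : 'rV[R]_0).

Lemma lebesgue_rV_box n (A : 'I_n -> set R) : (forall i, measurable (A i)) ->
  lebesgue_rV n [set v : 'rV[R]_n | forall i, A i (v ord0 i)] =
  (\prod_(i < n) lebesgue_measure (A i))%E.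
Proof.
elim: n A => [|n IHn] A mA; first by rewrite big_ord0 /= diracE mem_set// => -[].
pose B := [set v : 'rV[R]_n | forall i, A (lift ord0 i) (v ord0 i)].
have mB : measurable B.
  rewrite (_ : B = \bigcap_(i in [set: 'I_n])
    ((fun v : 'rV[R]_n => v ord0 i) @^-1` A (lift ord0 i))); last first.
    by apply/seteqP; split=> v /= h i; [move=> _|]; exact: h.
  apply: fin_bigcap_measurable => // i _; rewrite -[X in measurable X]setTI.
  exact: measurable_coord.
rewrite big_ord_recl -IHn//= -cons_measureE//; congr (cons_measure _ _).
apply/seteqP; split=> v /= => [h|[h0 h] i].
  by split=> // i; rewrite mxE (_ : rshift 1 i = lift ord0 i)//; exact/val_inj.
have [->//|] := eqVneq i ord0; rewrite eq_sym => /unlift_some[j -> _].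
by have := h j; rewrite mxE (_ : rshift 1 j = lift ord0 j)//; exact/val_inj.
Qed.

End lebesgue_rV.

(** Mutual independence of a family indexed by an arbitrary [I]: the product
    rule holds for every finite subfamily. *)
Definition mutually_independent d d' (Omega : measurableType d)
    (T : measurableType d') (R : realType) (P : probability Omega R)
    (I : eqType) (Z : I -> {RV P >-> T}) : Prop :=
  forall (s : seq I) (B : I -> set T), uniq s ->
    (forall i, i \in s -> measurable (B i)) ->
    P (\bigcap_(i in [set` s]) (Z i @^-1` B i)) =
    (\prod_(i <- s) P (Z i @^-1` B i))%E.

(** [Zs 0, Zs 1, ...] are copies of [Z], independent of each other and of [Z]
    (which sits at index [None]). *)
Definition iid_copies d d' (Omega : measurableType d)
    (T : measurableType d') (R : realType) (P : probability Omega R)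
    (Z : {RV P >-> T}) (Zs : nat -> {RV P >-> T}) : Prop :=
  mutually_independent (fun o : option nat => if o is Some i then Zs i else Z) /\
  forall i B, measurable B -> distribution P (Zs i) B = distribution P Z B.

Section classification.
Context {R : realType} {d : nat}.

Definition is_norm (nu : 'rV[R]_d -> R) : Prop :=
  [/\ forall x y, nu (x + y) <= nu x + nu y,
      forall a x, nu (a *: x) = `|a| * nu x &
      forall x, nu x = 0 -> x = 0].

(** Open balls; spheres are null sets for any law with a density. *)
Definition norm_ball (nu : 'rV[R]_d -> R) (x : 'rV[R]_d) (r : R) :
  set 'rV[R]_d := [set y | nu (y - x) < r].

(** Classifiers take values in [{-1, 1}], so a value has to be fixed at 0. *)
Definition sign_label (a : R) : R := if 0 <= a then 1 else -1.

Context {disp : measure_display} {Omega : measurableType disp}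
  {P : probability Omega R}.
Implicit Types (Z : {RV P >-> ('rV[R]_d * R)%type}).

Definition is_density Z (f : 'rV[R]_d -> R) : Prop :=
  [/\ measurable_fun setT f, forall x, 0 <= f x &
      forall B, measurable B ->
        P [set w | B (Z w).1] = (\int[lebesgue_rV d]_(x in B) (f x)%:E)%E].

(** [eta] is a version of [x |-> E[Y | X = x]]. *)
Definition is_regression Z (eta : 'rV[R]_d -> R) : Prop :=
  [/\ measurable_fun setT eta,
      P.-integrable setT (fun w => (eta (Z w).1)%:E) &
      forall B, measurable B ->
        (\int[P]_(w in [set w | B (Z w).1]) (Z w).2%:E =
         \int[P]_(w in [set w | B (Z w).1]) (eta (Z w).1)%:E)%E].

Definition mass Z (B : set 'rV[R]_d) : R := fine (P [set w | B (Z w).1]).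

(** E[Y | X in B] for an event of positive probability. *)
Definition mean_label Z (B : set 'rV[R]_d) : R :=
  fine (\int[P]_(w in [set w | B (Z w).1]) (Z w).2%:E)%E / mass Z B.

Definition density_support (f : 'rV[R]_d -> R) : set 'rV[R]_d :=
  closure [set x | f x != 0].

Definition margin_condition Z (eta : 'rV[R]_d -> R) (alpha : R) : Prop :=
  exists C : R, forall t : R, 0 < t ->
    (P [set w | (0 < `|eta (Z w).1| <= t)%R] <= (C * t `^ alpha)%:E)%E.

Definition tail_condition Z (f : 'rV[R]_d -> R) (beta : R) : Prop :=
  exists C : R, forall t : R, 0 < t ->
    (P [set w | (f (Z w).1 <= t)%R] <= (C * t `^ beta)%:E)%E.

Definition smooth_condition nu Z (f eta : 'rV[R]_d -> R) : Prop :=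
  exists C : R, forall (r : R) x, 0 < r -> density_support f x ->
    `|mean_label Z (norm_ball nu x r) - eta x| <= C * r ^+ 2.

Definition min_mass_condition nu Z (f : 'rV[R]_d -> R) : Prop :=
  exists C D : R, [/\ 0 < C, 0 < D & forall x (r : R), 0 < r < D ->
    ((C * f x)%:E * lebesgue_rV d (norm_ball nu x r) <=
     P [set w | norm_ball nu x r (Z w).1])%E].

Definition adaptive_tail_condition nu Z (f : 'rV[R]_d -> R) (A q beta : R) :
    Prop :=
  exists C : R, forall t : R, 0 < t ->
    (P [set w | (f (Z w).1 / mass Z (norm_ball nu (Z w).1 A) `^ q <
                 t `^ (1 - q))%R] <= (C * t `^ beta)%:E)%E.

Implicit Types (S : seq ('rV[R]_d * R)).

(** The sample by increasing distance to [x]; [sort] is stable, so ties (a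
    null event when the covariates have a density) go to the smaller index. *)
Definition neighbors (nu : 'rV[R]_d -> R) S x : seq ('rV[R]_d * R) :=
  sort (fun u v => nu (u.1 - x) <= nu (v.1 - x)) S.

Definition adaptive_k (nu : 'rV[R]_d -> R) (K A q : R) S x : nat :=
  let n := count (fun u => nu (u.1 - x) < A) S in
  (Num.truncn (K * n%:R `^ q)).+1.

(** When [k] exceeds the sample size, which is excluded for large samples since
    [q < 1], the missing labels count as 0. *)
Definition eta_hat nu K A q S x : R :=
  let k := adaptive_k nu K A q S x in
  k%:R^-1 * \sum_(u <- take k (neighbors nu S x)) u.2.

Definition adaptive_knn nu K A q S x : R := sign_label (eta_hat nu K A q S x).

(** [g S x] is the label predicted at [x] by the rule [g] trained on [S]. *)
Definition risk Z (Zs : nat -> {RV P >-> ('rV[R]_d * R)%type})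
    (g : seq ('rV[R]_d * R) -> 'rV[R]_d -> R) (N : nat) : R :=
  fine (P [set w | g (mkseq (fun i => Zs i w) N) (Z w).1 != (Z w).2]).

Definition bayes_risk Z (eta : 'rV[R]_d -> R) : R :=
  fine (P [set w | sign_label (eta (Z w).1) != (Z w).2]).

Definition excess_risk Z Zs (eta : 'rV[R]_d -> R) g (N : nat) : R :=
  risk Z Zs g N - bayes_risk Z eta.

End classification.

Definition knn_lambda {R : realType} (d : nat) (q : R) : R :=
  Num.min (2^-1 * q) (2 / d%:R * (1 - q)).

Definition knn_rate {R : realType} (alpha beta lambda : R) (N : nat) : R :=
  if beta == lambda then N%:R `^ (- beta) * ln N%:R
  else N%:R `^ (- Num.min (lambda * beta * (alpha + 1) /
                           (lambda * alpha + beta)) beta).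

(* Main.v *)
(** Fix a test point [x] and put [M = N P(B(x, A))]. When the [k + 1] nearest
    sample points lie in a ball [B(x, r)], the [k] votes behave like independent
    labels with mean close to [eta x], because (c) controls the mean label on every
    smaller ball. Instead of conditioning on the distance of the next neighbour,
    the exponential weight [exp(-t e Y)] of each voter is replaced by a constant
    [theta], one sample point at a time; each replacement can only increase the
    expected product of the weights of the voters. This bounds the error
    probability at [x] by [E[theta ^ k]] plus binomial tails, that is, by
    [exp(-c eta(x)^2 M^q) + exp(-c M^q)] as soon as [|eta x| >= C r^2], where
    [r^d] is of order [M^q / (N f(x))]. In terms of
    [U = N min(f(x), (f(x) / P(B(x, A))^q)^(1/(1-q)))] both conditions (b) and (T)
    say that [P(U <= t)] is at most a multiple of [(t / N)^beta], and the bound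
    becomes [exp(-c (eta(x) U^lambda)^2) + U^(-k)]. Integrating it against
    [|eta(x)|] over dyadic shells of [U], with (a) used where [U] is large, yields
    the rate. *)

Require Import Defs.
From HB Require Import structures.
From mathcomp Require Import all_boot all_order all_algebra.
From mathcomp Require Import all_classical all_reals all_analysis.
From mathcomp Require Import measurable_realfun measurable_fun_approximation.
From mathcomp Require Import zify ring lra.

Set Implicit Arguments.
Unset Strict Implicit.
Unset Printing Implicit Defensive.

Import Order.TTheory GRing.Theory Num.Theory.
Import numFieldNormedType.Exports.

(** Conditioning on a neighbour distance would call for regular conditional laws, with a [k] that is
    itself random. Replacing weights one at a time needs only Tonelli: with the other points frozen,
    the positions at which one point votes form a ball, open or closed according to how ties fall.
    Asking for [k + 1] points in [B(x, r)] keeps [k] and the other voters fixed while that point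
    moves inside this ball.

    The two arguments of the minimum in [knn_lambda] are two errors. About [M ^ q] labels vote and
    [M] is at least of order [U], so the random error is negligible once [|eta|] exceeds
    [U ^ (- q / 2)]. The bias is of order [r ^ 2], and [r ^ d] is at most of order
    [U ^ (- (1 - q))], whence [U ^ (- 2 (1 - q) / d)].

    The shells contribute a geometric sum of ratio [2 ^ (beta - lambda)]. Its ratio is 1 exactly
    when [beta = lambda], and the number of shells is then the logarithm in the rate. *)

Local Open Scope classical_set_scope.
Local Open Scope ring_scope.

(** * The law of an i.i.d. sample *)

Section iid_law.
Local Open Scope ereal_scope.
Context d (T : measurableType d) (R : realType).
Variable mu : probability T R.

Definition cons_pair n (p : T * n.-tuple T) : n.+1.-tuple T :=
  [tuple of p.1 :: p.2].

Lemma measurable_cons_pair n : measurable_fun setT (@cons_pair n).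
Proof. exact: measurable_cons measurable_fst measurable_snd. Qed.

HB.instance Definition _ n := isMeasurableFun.Build _ _ _ _ (@cons_pair n)
  (@measurable_cons_pair n).

(** Built from binary products, so that Tonelli integrates one coordinate at a time and statements
    about [n] points go by induction. The link with the abstract notion of independence is
    [iid_lawE]. *)
Fixpoint iid_law n : probability (n.-tuple T) R :=
  match n return probability (n.-tuple T) R with
  | 0 => \d_([tuple] : 0.-tuple T)
  | n'.+1 => distribution (mu \x iid_law n') (@cons_pair n')
  end.

Lemma integral_iid_law0 (F : 0.-tuple T -> \bar R) :
  \int[iid_law 0]_s F s = F [tuple].
Proof.
rewrite (eq_integral (cst (F [tuple]))); last by move=> s _; rewrite (tuple0 s).
rewrite integral_cst// -[RHS]mule1; congr (_ * _); exact: probability_setT.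
Qed.

Lemma integral_iid_lawS n (F : n.+1.-tuple T -> \bar R) :
  measurable_fun setT F -> (forall s, 0 <= F s) ->
  \int[iid_law n.+1]_s F s =
  \int[mu]_z \int[iid_law n]_s F (cons_pair (z, s)).
Proof.
move=> mF F0; rewrite ge0_integral_distribution//.
rewrite fubini_tonelli1//; last by move=> p; exact: F0.
exact: measurableT_comp mF (@measurable_cons_pair n).
Qed.

Definition set_tnth n (s : n.-tuple T) (j : 'I_n) (z : T) : n.-tuple T :=
  [tuple if i == j then z else tnth s i | i < n].

Lemma measurable_set_tnth n (j : 'I_n) :
  measurable_fun setT (fun p : n.-tuple T * T => set_tnth p.1 j p.2).
Proof.
apply/measurable_fun_tnthP => i.
rewrite (_ : _ \o _ = fun p : n.-tuple T * T =>
  if i == j then p.2 else tnth p.1 i); last first.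
  by apply/funext => p /=; rewrite tnth_mktuple.
case: (i == j); first exact: measurable_snd.
apply: (@measurableT_comp _ _ _ _ _ _ (fun x : n.-tuple T => tnth x i)) => //.
exact: measurable_tnth.
Qed.

Lemma set_tnth_cons0 n z0 (s : n.-tuple T) z :
  set_tnth (cons_pair (z0, s)) ord0 z = cons_pair (z, s).
Proof.
apply: eq_from_tnth => i; rewrite tnth_mktuple.
have [->//|] := eqVneq i ord0; rewrite eq_sym => /unlift_some[k -> _].
by rewrite !tnthS.
Qed.

Lemma set_tnth_consS n z0 (s : n.-tuple T) (j : 'I_n) z :
  set_tnth (cons_pair (z0, s)) (lift ord0 j) z = cons_pair (z0, set_tnth s j z).
Proof.
apply: eq_from_tnth => i; rewrite tnth_mktuple.
have [->//|] := eqVneq i ord0; rewrite eq_sym => /unlift_some[k -> _].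
by rewrite !tnthS tnth_mktuple (inj_eq lift_inj).
Qed.

(** Each coordinate is independent of the others, so a fresh draw may take its place. The point of
    this form is the inner integral: it isolates a single sample point while all others are
    frozen. *)
Lemma iid_law_resample n (j : 'I_n) (F : n.-tuple T -> \bar R) :
  measurable_fun setT F -> (forall s, 0 <= F s) ->
  \int[iid_law n]_s F s = \int[iid_law n]_s \int[mu]_z F (set_tnth s j z).
Proof.
elim: n j F => [[]//|n IHn] j F mF F0.
have mFs : measurable_fun setT (fun p : n.+1.-tuple T * T => F (set_tnth p.1 j p.2)).
  exact: measurableT_comp mF (measurable_set_tnth j).
rewrite [RHS]integral_iid_lawS; last 2 first.
- exact: (measurable_fun_fubini_tonelli_F
    (fun p : n.+1.-tuple T * T => F (set_tnth p.1 j p.2))).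
- by move=> s; exact: integral_ge0.
rewrite integral_iid_lawS//.
have [->|] := eqVneq j ord0.
  under [RHS]eq_integral do under eq_integral do
    under eq_integral do rewrite set_tnth_cons0.
  rewrite [RHS]integral_cst// [X in _ * X](_ : _ = 1) ?mule1; last first.
    exact: probability_setT.
  apply: (fubini_tonelli (F \o @cons_pair n)); last by move=> p; exact: F0.
  exact: measurableT_comp mF (@measurable_cons_pair n).
rewrite eq_sym => /unlift_some[k -> _].
apply: eq_integral => z0 _; rewrite (IHn k)//.
  apply: eq_integral => s _; apply: eq_integral => z _.
  by rewrite set_tnth_consS.
apply: (measurableT_comp mF) => /=.
apply: (measurableT_comp (@measurable_cons_pair n)).
exact: measurable_fun_pair.
Qed.

Lemma integral_iid_law_prod n (phi : T -> R) :
  measurable_fun setT phi -> (forall z, (0 <= phi z)%R) ->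
  \int[iid_law n]_s (\prod_(i < n) phi (tnth s i))%:E =
  (\int[mu]_z (phi z)%:E) ^+ n.
Proof.
move=> mphi phi0.
have mprod m : measurable_fun setT
    (fun s : m.-tuple T => (\prod_(i < m) phi (tnth s i))%:E).
  apply/measurable_EFinP; apply: measurable_prod => i _.
  exact: measurableT_comp mphi (@measurable_tnth _ _ _ i).
have mphi' : measurable_fun setT (fun z => (phi z)%:E) by exact/measurable_EFinP.
elim: n => [|n IHn]; first by rewrite integral_iid_law0// big_ord0.
rewrite integral_iid_lawS//; last by move=> s; rewrite lee_fin prodr_ge0.
rewrite (eq_integral (fun z => (phi z)%:E * (\int[mu]_z (phi z)%:E) ^+ n)).
  rewrite ge0_integralZr//; last 2 first.
  - by move=> z _; rewrite lee_fin.
  - by apply: expe_ge0; apply: integral_ge0 => z _; rewrite lee_fin.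
  by rewrite expeS.
move=> z _; rewrite -IHn.
transitivity (\int[iid_law n]_s ((phi z)%:E * (\prod_(i < n) phi (tnth s i))%:E)).
  apply: eq_integral => s _; rewrite big_ord_recl -EFinM.
  by under eq_bigr do rewrite tnthS.
rewrite ge0_integralZl//; first exact: mprod.
- by move=> s _; rewrite lee_fin prodr_ge0.
- by rewrite lee_fin.
Qed.

End iid_law.

Section iid_law_of_independent.
Local Open Scope ereal_scope.
Context d (T : measurableType d) (R : realType) (mu : probability T R).
Context d' (Omega : measurableType d') (P : probability Omega R).
Variables (I : eqType) (Z : I -> {RV P >-> T}).
Hypothesis indepZ : mutually_independent Z.
Hypothesis lawZ : forall i B, measurable B -> P (Z i @^-1` B) = mu B.

Let box (s : seq I) (C : I -> set T) := \bigcap_(i in [set` s]) (Z i @^-1` C i).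
Let vec n (t : n.-tuple I) w := map_tuple (fun i => Z i w) t.

Let measurable_vec n (t : n.-tuple I) : measurable_fun setT (vec t).
Proof.
apply/measurable_fun_tnthP => i.
rewrite (_ : _ \o _ = Z (tnth t i))//.
by apply/funext => w /=; rewrite tnth_map.
Qed.

Let measurable_preim (X : {RV P >-> T}) B : measurable B -> measurable (X @^-1` B).
Proof. by move=> mB; rewrite -[X in measurable X]setTI; exact: measurable_funPT. Qed.

Let measurable_box s C : (forall i, measurable (C i)) -> measurable (box s C).
Proof.
move=> mC; apply: fin_bigcap_measurable => [|i _]; first exact: finite_seq.
exact: measurable_preim.
Qed.

(** The box over [s] is there for the induction: a measurable rectangle hands its first side over to
    the box and leaves one variable fewer, and uniqueness of the product measure extends the
    identity from rectangles to all [B]. *)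
Lemma iid_law_box n (t : n.-tuple I) (s : seq I) (C : I -> set T) B :
  uniq (s ++ t) -> (forall i, measurable (C i)) -> measurable B ->
  P (box s C `&` vec t @^-1` B) = P (box s C) * iid_law mu n B.
Proof.
elim: n t s C B => [|n IHn] t s C B Ust mC mB.
  rewrite (tuple0 t) /= diracE.
  have -> : vec [tuple] @^-1` B = if [tuple] \in B then setT else set0.
    apply/seteqP; split=> w; rewrite /preimage/= (tuple0 (vec _ _)) => h.
      by rewrite mem_set.
    by move: h; case: ifPn => // /set_mem.
  by case: ifPn => _; rewrite ?setIT ?mule1// setI0 measure0 mule0.
have mB' : measurable (@cons_pair _ T n @^-1` B).
  by rewrite -[X in measurable X]setTI; exact: measurable_cons_pair.
case/tupleP: t Ust => i t Ust.
pose V w := (Z i w, vec t w).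
have mV : measurable_fun setT V.
  by apply: measurable_fun_pair; [exact: measurable_funPT|exact: measurable_vec].
have mE := measurable_box s mC.
have [PE0|PE0] := eqVneq (P (box s C)) 0.
  rewrite PE0 mul0e; apply/eqP; rewrite eq_le measure_ge0 andbT -PE0.
  apply: le_measure; rewrite ?inE; [|exact: mE|exact: subIsetl].
  by apply: measurableI => //; rewrite -[X in measurable X]setTI; exact: measurable_vec.
have Pfin : P (box s C) \is a fin_num by exact: fin_num_measure.
have Ppos : (0 < fine (P (box s C)))%R by rewrite fine_gt0// lt0e PE0 measure_ge0/= ltey_eq Pfin.
have Pinv : (0 <= (fine (P (box s C)))^-1)%R by rewrite invr_ge0 ltW.
(* The law of the first variable and the remaining ones given the box event, which has positive
   probability here. It has to be compared with the product measure on rectangles only. *)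
pose m0 := mscale (NngNum Pinv) (pushforward (mrestr P mE) V).
pose m' := m0 mV.
have m'E X : m' X = ((fine (P (box s C)))^-1)%:E * P (V @^-1` X `&` box s C) by [].
have key : (mu \x iid_law mu n) (@cons_pair _ T n @^-1` B) =
    m' (@cons_pair _ T n @^-1` B).
  apply: product_measure_unique => // A X mA mX.
  rewrite [LHS](m'E (A `*` X)).
  have -> : V @^-1` (A `*` X) `&` box s C =
      box (i :: s) (fun k => if k == i then A else C k) `&` vec t @^-1` X.
    apply/seteqP; split=> w /=.
      move=> [[Aw Xw] bw]; split=> // k /=; rewrite inE => /orP[/eqP->|ks].
        by rewrite /= eqxx.
      by case: eqP => [->//|_]; exact: bw.
    move=> [bw Xw]; split; first split=> //.
      by have := bw i; rewrite /= mem_head eqxx; exact.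
    move=> k /= ks; have := bw k; rewrite /= in_cons ks orbT.
    case: eqP => [ki|_]; last exact.
    by move: Ust; rewrite cat_uniq/= negb_or -ki ks/= andbF.
  have mC' k : measurable (if k == i then A else C k) by case: ifP.
  have iNs : i \notin s.
    by move: Ust; rewrite cat_uniq/= negb_or -andbA => /and3P[].
  have Us : uniq s by move: Ust; rewrite cat_uniq => /andP[].
  have U1 : uniq ((i :: s) ++ t).
    by rewrite (perm_uniq (_ : perm_eq _ (s ++ i :: t)))// -cat1s -catA perm_catCA.
  rewrite IHn//.
  have Uis : uniq (i :: s) by rewrite /= iNs.
  have -> : P (box (i :: s) (fun k => if k == i then A else C k)) =
      mu A * P (box s C).
    rewrite [LHS]indepZ// big_cons eqxx lawZ//; congr (_ * _).
    rewrite [RHS]indepZ//; apply: eq_big_seq => k ks.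
    by case: eqP => // ki; rewrite -ki ks in iNs.
  rewrite -{2}(fineK Pfin) (muleC (mu A)) !muleA -EFinM mulVf ?gt_eqF//.
  by rewrite mul1e.
rewrite (_ : vec _ @^-1` B = V @^-1` (@cons_pair _ T n @^-1` B)); last first.
  apply/seteqP; split=> w; rewrite /preimage/=;
    by rewrite (_ : vec _ _ = cons_pair (V w))//; exact: val_inj.
transitivity (P (box s C) * m' (@cons_pair _ T n @^-1` B)).
  have e : P (box s C) * ((fine (P (box s C)))^-1)%:E = 1.
    by rewrite -{1}(fineK Pfin) -EFinM divff// gt_eqF.
  by rewrite [X in _ * X]m'E muleA e mul1e setIC.
by rewrite -key.
Qed.

Lemma iid_lawE n (t : n.-tuple I) B : uniq t -> measurable B ->
  P [set w | B (map_tuple (fun i => Z i w) t)] = iid_law mu n B.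
Proof.
move=> Ut mB; have := @iid_law_box n t [::] (fun=> setT) B Ut (fun=> measurableT) mB.
have -> : box [::] (fun=> setT) = setT by apply/seteqP; split=> // w _ k.
by rewrite setTI probability_setT mul1e.
Qed.

End iid_law_of_independent.


(** * Ranks and sorting *)

Section rank.
Context {R : realType} {N : nat}.
Implicit Types (v : 'I_N -> R) (i j l : 'I_N).

(** Ties are broken by index, as the stable [sort] of [neighbors] does. *)
Definition precedes v l i := (v l < v i) || ((v l == v i) && (l < i)%N).

Definition rank v i := #|[pred l | precedes v l i]|.

Definition rank_off v j i := #|[pred l | (l != j) && precedes v l i]|.

Definition ball_count v (r : R) := #|[pred l | v l < r]|.

Definition ball_count_off v j (r : R) := #|[pred l | (l != j) && (v l < r)]|.

Lemma precedes_irr v i : precedes v i i = false.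
Proof. by rewrite /precedes ltxx ltnn andbF. Qed.

Lemma precedes_trans v : transitive (precedes v).
Proof.
move=> j i l; rewrite /precedes => /orP[ij|/andP[/eqP-> ij]] /orP[jl|/andP[/eqP jl jl']].
- by rewrite (lt_trans ij jl).
- by rewrite -jl ij.
- by rewrite jl.
- by rewrite jl eqxx (ltn_trans ij jl') orbT.
Qed.

Lemma precedesE v i j :
  (v i <= v j) && ((v j <= v i) ==> (i < j)%N) = precedes v i j.
Proof. by rewrite /precedes; case: ltgtP. Qed.

Lemma precedes_total v i j : i != j -> ~~ precedes v i j -> precedes v j i.
Proof.
rewrite /precedes negb_or -leNgt negb_and le_eqVlt => nij /andP[/orP[/eqP->|->//]].
rewrite eqxx/= -leqNgt ltxx/= leq_eqVlt => /orP[/eqP/val_inj ji|->//].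
by rewrite ji eqxx in nij.
Qed.

Lemma rankD v j i : i != j -> (rank v i = precedes v j i + rank_off v j i)%N.
Proof.
by move=> ij; rewrite /rank (cardD1 j) inE; congr addn; apply: eq_card => l; rewrite !inE.
Qed.

Lemma ball_countD v j r :
  (ball_count v r = (v j < r)%R + ball_count_off v j r)%N.
Proof.
by rewrite /ball_count (cardD1 j) inE; congr addn; apply: eq_card => l; rewrite !inE.
Qed.

Lemma rank_lt_ball v i k r : (k < ball_count v r)%N -> (rank v i < k)%N -> v i < r.
Proof.
move=> kr rk; rewrite ltNge; apply/negP => ri.
have : (ball_count v r <= rank v i)%N.
  apply: subset_leq_card; apply/fintype.subsetP => l; rewrite !inE => lr.
  by rewrite /precedes (lt_le_trans lr ri).
by move=> /(leq_trans kr)/(ltn_trans rk); rewrite ltnn.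
Qed.

(** If [j] votes, the other voters are the [k - 1] nearest points of the sample without [j], a
    description independent of the position of [j]. For [i] before [j] both sides are true, since
    [i] then has smaller rank than the voter [j]. *)
Lemma rank_ltE v i j k : i != j -> (rank v j < k)%N ->
  (rank v i < k)%N = (rank_off v j i < k.-1)%N.
Proof.
move=> ij jk; rewrite (rankD v ij); have [ji|nji] := boolP (precedes v j i).
  by case: k jk.
have ij' : precedes v i j by apply: precedes_total nji; rewrite eq_sym.
have : (rank_off v j i < rank v j)%N.
  rewrite /rank (cardD1 i) inE ij' add1n ltnS.
  apply: subset_leq_card; apply/fintype.subsetP => l; rewrite !inE => /andP[_ li].
  rewrite (precedes_trans li ij') andbT; apply: contraTneq li => ->.
  by rewrite precedes_irr.
by move=> h; rewrite add0n; lia.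
Qed.

Lemma eq_rank_off v v' j i : i != j -> (forall l, l != j -> v' l = v l) ->
  rank_off v' j i = rank_off v j i.
Proof.
move=> ij vv'; apply: eq_card => l; rewrite !inE.
by case: eqVneq => //= lj; rewrite /precedes !vv'.
Qed.

Lemma eq_ball_count_off v v' j r : (forall l, l != j -> v' l = v l) ->
  ball_count_off v' j r = ball_count_off v j r.
Proof.
by move=> vv'; apply: eq_card => l; rewrite !inE; case: eqVneq => //= lj; rewrite vv'.
Qed.

(** This is why the distances at which a given sample point votes form an initial segment. *)
Lemma rank_mono v v' j : (forall l, l != j -> v' l = v l) -> v' j <= v j ->
  (rank v' j <= rank v j)%N.
Proof.
move=> vv' j'j; apply: subset_leq_card; apply/fintype.subsetP => l; rewrite !inE.
have [->|lj] := eqVneq l j; first by rewrite precedes_irr.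
rewrite /precedes vv'// => /orP[lj'|/andP[/eqP lj' ->]].
  by rewrite (lt_le_trans lj' j'j).
by rewrite lj' andbT; case: ltgtP j'j.
Qed.

End rank.

Section take_sort.
Context {R : realType}.

Lemma index_sorted_precedes N (v : 'I_N -> R) (r : seq 'I_N) i :
  sorted (precedes v) r -> i \in r -> index i r = count (precedes v ^~ i) r.
Proof.
rewrite (sorted_pairwise (@precedes_trans _ _ v)) => pr /splitPr ir.
case: ir pr => r1 r2; rewrite pairwise_cat/= => /and3P[/allrelP r12 pr1].
move=> /andP[/allP ir2 pr2].
have r1i l : l \in r1 -> precedes v l i by move=> lr1; apply: r12; rewrite ?mem_head.
have iNr1 : i \notin r1 by apply/negP => /r1i; rewrite precedes_irr.
rewrite index_cat (negPf iNr1)/= eqxx addn0 count_cat/= precedes_irr add0n.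
rewrite (eq_in_count (a2 := predT)); last by move=> l /r1i ->.
rewrite count_predT (eq_in_count (a2 := pred0)) ?count_pred0 ?addn0//.
move=> l /ir2 il; apply/negbTE/negP => /(precedes_trans il).
by rewrite precedes_irr.
Qed.

(** Indexing by rank keeps every sample point at its own coordinate, as the replacement argument
    requires. The indices start in increasing order, so the stable sort is sorted for [precedes],
    and the position of an index in it is its rank. *)
Lemma big_take_sort (A : Type) (idx : A) (op : Monoid.com_law idx) (T : Type)
    (rho : T -> R) N (s : N.-tuple T) k (F : T -> A) :
  \big[op/idx]_(u <- take k (sort (fun a b => rho a <= rho b) s)) F u =
  \big[op/idx]_(i < N | (rank (fun i => rho (tnth s i)) i < k)%N) F (tnth s i).
Proof.
set v := fun i => rho (tnth s i).
pose r := sort (fun i j => v i <= v j) (enum 'I_N).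
have -> : sort (fun a b => rho a <= rho b) s = map (tnth s) r.
  by rewrite -{1}[tval s]map_tnth_enum sort_map.
have sr : sorted (precedes v) r.
  have : sorted (fun i j : 'I_N => (i < j)%N) (enum 'I_N).
    rewrite -[sorted _ _]/(sorted (relpre val ltn) (enum 'I_N)) -sorted_map.
    by rewrite val_enum_ord iota_ltn_sorted.
  move=> /(sort_stable (leT := fun i j => v i <= v j)) H.
  have -> : precedes v =
      [rel i j | (v i <= v j) && ((v j <= v i) ==> (i < j)%N)].
    by apply/funext => i; apply/funext => j; rewrite /= precedesE.
  by apply: H => [i j|j i l]; [exact: le_total|exact: ltn_trans].
have pr : perm_eq r (enum 'I_N) by rewrite perm_sort.
have ur : uniq r by rewrite (perm_uniq pr) enum_uniq.
have mr i : i \in r by rewrite (perm_mem pr) mem_enum.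
rewrite -map_take big_map -[RHS]big_filter; apply: perm_big.
apply: uniq_perm; [exact: take_uniq|by rewrite filter_uniq// index_enum_uniq|].
move=> i; rewrite in_take// mem_filter mem_index_enum andbT.
rewrite (index_sorted_precedes sr)// (permP pr) /rank cardE size_filter.
by rewrite enumT.
Qed.

End take_sort.

Section measurable_rank.
Context {R : realType} {N : nat} d (T : measurableType d).
Variable V : T -> 'I_N -> R.
Hypothesis mV : forall i, measurable_fun setT (V ^~ i).

Lemma measurable_natfun (f : nat -> nat) : measurable_fun setT f.
Proof. by []. Qed.

Lemma measurable_sumn (I : Type) (r : seq I) (f : I -> T -> nat) :
  (forall i, measurable_fun setT (f i)) ->
  measurable_fun setT (fun w => \sum_(i <- r) f i w)%N.
Proof.
move=> mf; elim: r => [|i r IHr].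
  by under eq_fun do rewrite big_nil; exact: measurable_cst.
under eq_fun do rewrite big_cons; exact: measurable_fun_addn.
Qed.

Lemma measurable_card (I : finType) (b : I -> T -> bool) :
  (forall i, measurable_fun setT (b i)) ->
  measurable_fun setT (fun w => #|[pred i | b i w]|).
Proof.
move=> mb; under eq_fun do rewrite -sum1_card big_mkcond.
by apply: measurable_sumn => i; under eq_fun do rewrite inE;
  apply: measurable_fun_ifT.
Qed.

Lemma measurable_precedes l i : measurable_fun setT (fun w => precedes (V w) l i).
Proof.
apply: measurable_or; first exact: measurable_fun_ltr.
by apply: measurable_and => //; exact: measurable_fun_eqr.
Qed.

Lemma measurable_rank i : measurable_fun setT (fun w => rank (V w) i).
Proof. by apply: measurable_card => l; exact: measurable_precedes. Qed.

Lemma measurable_ball_count r : measurable_fun setT (fun w => ball_count (V w) r).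
Proof. by apply: measurable_card => l; exact: measurable_fun_ltr. Qed.

End measurable_rank.

(** * Weighted votes *)

(** The cases are decided by whether the supremum is attained. An attained supremum lies in [J],
    hence strictly below [r]; this is the source of [t < r] in the closed case against [t <= r] in
    the open one. *)
Lemma down_setP (R : realType) (J : set R) (r : R) :
  (forall t, J t -> t < r) -> (forall t u, J t -> u <= t -> J u) ->
  [\/ J = set0, exists2 t, t <= r & J = [set u | u < t] |
      exists2 t, t < r & J = [set u | u <= t]].
Proof.
move=> Jr Jdown; have [->|/set0P J0] := eqVneq J set0; first exact: Or31.
have supJ : has_sup J by split=> //; exists r => t /Jr/ltW.
have J_sup u : u < sup J -> J u.
  by move=> /(sup_gt J0)[t Jt /ltW]; exact: Jdown.
have [Js|nJs] := pselect (J (sup J)).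
  apply: Or33; exists (sup J); first exact: Jr.
  apply/seteqP; split=> u /=; first by move=> Ju; exact: sup_upper_bound.
  exact: Jdown.
apply: Or32; exists (sup J); first by apply: ge_sup => // t /Jr/ltW.
apply/seteqP; split=> u /= Ju; last exact: J_sup.
rewrite lt_neqAle sup_upper_bound// andbT.
by apply/eqP => us; rewrite us in Ju.
Qed.

Section weighted_vote.
Local Open Scope ereal_scope.
Context d (T : measurableType d) (R : realType) (mu : probability T R).
Variables (rho : T -> R) (kf : nat -> nat) (r A : R).
Hypothesis mrho : measurable_fun setT rho.
Hypothesis rA : (r <= A)%R.

Definition dist n (s : n.-tuple T) : 'I_n -> R := fun i => rho (tnth s i).

Definition num_voters n (s : n.-tuple T) := kf (ball_count (dist s) A).

(** One point more than the [k] voters is required in the ball of radius [r]: then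
    every voter lies in it, and moving a voter inside the ball changes neither [k]
    nor this property. *)
Definition enough n (s : n.-tuple T) := (num_voters s < ball_count (dist s) r)%N.

(** The value 0 confines the expectation to samples with [enough] points near the centre; the
    complementary event is bounded separately by tails of counts. *)
Definition vote_weight n (W : 'I_n -> T -> R) (s : n.-tuple T) : R :=
  (if enough s then \prod_(i < n | (rank (dist s) i < num_voters s)%N) W i (tnth s i)
  else 0)%R.

Lemma measurable_dist n (i : 'I_n) : measurable_fun setT (fun s : n.-tuple T => dist s i).
Proof. exact: measurableT_comp mrho (@measurable_tnth _ _ _ i). Qed.

Lemma measurable_num_voters n : measurable_fun setT (@num_voters n).
Proof.
apply: (measurableT_comp (f := kf)); first exact: measurable_natfun.
by apply: measurable_ball_count => i; exact: measurable_dist.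
Qed.

Lemma measurable_enough n : measurable_fun setT (@enough n).
Proof.
apply: measurable_fun_ltn; first exact: measurable_num_voters.
by apply: measurable_ball_count => i; exact: measurable_dist.
Qed.

Lemma measurable_vote_weight n (W : 'I_n -> T -> R) :
  (forall i, measurable_fun setT (W i)) -> measurable_fun setT (vote_weight W).
Proof.
move=> mW; apply: measurable_fun_ifT => //; first exact: measurable_enough.
under eq_fun do rewrite big_mkcond.
apply: measurable_prod => i _; apply: measurable_fun_ifT => //.
  apply: measurable_fun_ltn; last exact: measurable_num_voters.
  by apply: measurable_rank => j; exact: measurable_dist.
exact: measurableT_comp (mW i) (@measurable_tnth _ _ _ i).
Qed.

Lemma vote_weight_ge0 n (W : 'I_n -> T -> R) s :
  (forall i z, 0 <= W i z)%R -> (0 <= vote_weight W s)%R.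
Proof. by move=> W0; rewrite /vote_weight; case: ifP => // _; exact: prodr_ge0. Qed.

Variables (h : T -> R) (theta : R).
Hypothesis mh : measurable_fun setT h.
Hypothesis h0 : forall z, (0 <= h z)%R.
Hypothesis theta0 : (0 <= theta)%R.
(** Both kinds of ball occur: a point tied with the last competing neighbour votes or not according
    to the order of the indices, so its voting region may or may not contain its boundary. *)
Hypothesis h_open : forall t, (t <= r)%R ->
  \int[mu]_(z in [set z | (rho z < t)%R]) (h z)%:E <=
  theta%:E * mu [set z | (rho z < t)%R].
Hypothesis h_closed : forall t, (t < r)%R ->
  \int[mu]_(z in [set z | (rho z <= t)%R]) (h z)%:E <=
  theta%:E * mu [set z | (rho z <= t)%R].

(** With all sample points but the [j]-th fixed, the positions at which that point
    votes form an initial segment of distances, and given that it votes, the weight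
    of the other voters does not depend on it. *)
Lemma vote_weight_replace n (j : 'I_n) (W W' : 'I_n -> T -> R) :
  (forall i, measurable_fun setT (W i)) -> (forall i z, (0 <= W i z)%R) ->
  W j = h -> W' j = cst theta -> (forall i, i != j -> W' i = W i) ->
  \int[iid_law mu n]_s (vote_weight W s)%:E <=
  \int[iid_law mu n]_s (vote_weight W' s)%:E.
Proof.
move=> mW W0 Wj W'j W'E.
have mW' i : measurable_fun setT (W' i).
  by have [->|/W'E->//] := eqVneq i j; rewrite W'j; exact: measurable_cst.
have W'0 i z : (0 <= W' i z)%R.
  by have [->|/W'E->//] := eqVneq i j; rewrite W'j.
have mWE (V : 'I_n -> T -> R) : (forall i, measurable_fun setT (V i)) ->
    measurable_fun setT (fun s : n.-tuple T => (vote_weight V s)%:E).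
  by move=> mV; apply/measurable_EFinP; exact: measurable_vote_weight.
have mset (V : 'I_n -> T -> R) : (forall i, measurable_fun setT (V i)) -> forall s,
    measurable_fun setT (fun z => (vote_weight V (set_tnth s j z))%:E).
  move=> mV s; apply: (measurableT_comp (mWE _ mV)).
  have := measurableT_comp (measurable_set_tnth j) (pair1_measurable s).
  exact.
have mint (V : 'I_n -> T -> R) :
    (forall i, measurable_fun setT (V i)) -> (forall i z, (0 <= V i z)%R) ->
    measurable_fun setT (fun s : n.-tuple T =>
      \int[mu]_z (vote_weight V (set_tnth s j z))%:E).
  move=> mV V0.
  apply: (@measurable_fun_fubini_tonelli_F _ _ _ _ _ mu
    (fun p : n.-tuple T * T => (vote_weight V (set_tnth p.1 j p.2))%:E)).
    by apply: (measurableT_comp (mWE _ mV)); exact: measurable_set_tnth.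
  by move=> p; rewrite lee_fin vote_weight_ge0.
rewrite (@iid_law_resample _ _ _ mu _ j)//; last 2 first.
- exact: mWE.
- by move=> s; rewrite lee_fin vote_weight_ge0.
rewrite [leRHS](@iid_law_resample _ _ _ mu _ j)//; last 2 first.
- exact: mWE.
- by move=> s; rewrite lee_fin vote_weight_ge0.
apply: ge0_le_integral => //.
- by move=> s _; apply: integral_ge0 => z _; rewrite lee_fin vote_weight_ge0.
- exact: mint.
- exact: mint.
move=> s _.
(* The number of voters once the [j]-th point is in the ball of radius [r]. As [r <= A], that point
   adds one to both counts wherever it lies there, so [k] is constant, and [enough] turns into [b],
   with the extra one cancelled. *)
pose k := kf (ball_count_off (dist s) j A).+1.
pose b := (k <= ball_count_off (dist s) j r)%N.
pose v t := fun i => if i == j then t else dist s i.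
pose J := [set t | [&& b, (t < r)%R & (rank (v t) j < k)%N]].
pose D := rho @^-1` J.
have distE z : dist (set_tnth s j z) = v (rho z).
  by apply/funext => i; rewrite /dist tnth_mktuple /v; case: ifP.
have vE t l : l != j -> v t l = dist s l by rewrite /v => /negbTE ->.
have vj t : v t j = t by rewrite /v eqxx.
have J_down t u : J t -> (u <= t)%R -> J u.
  move=> /and3P[bt tr tk] ut; apply/and3P; split=> //.
    exact: le_lt_trans tr.
  apply: leq_ltn_trans tk; apply: rank_mono; last by rewrite !vj.
  by move=> l lj; rewrite !vE.
have JP : [\/ J = set0, exists2 t, (t <= r)%R & J = [set u | (u < t)%R] |
      exists2 t, (t < r)%R & J = [set u | (u <= t)%R]].
  by apply: down_setP J_down => t /and3P[].
have mlt t : measurable [set z | (rho z < t)%R].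
  by rewrite -[X in measurable X]setTI; exact: measurable_fun_ltr.
have mle t : measurable [set z | (rho z <= t)%R].
  by rewrite -[X in measurable X]setTI; exact: measurable_fun_ler.
have [mD hD] : measurable D /\ \int[mu]_(z in D) (h z)%:E <= theta%:E * mu D.
  case: JP => [J0|[t tr Jt]|[t tr Jt]].
  - by rewrite /D J0 preimage_set0 integral_set0 measure0 mule0.
  - by rewrite /D Jt; split; [exact: mlt|exact: h_open].
  - by rewrite /D Jt; split; [exact: mle|exact: h_closed].
pose c := (\prod_(i < n | (i != j) && (rank_off (dist s) j i < k.-1)%N)
            W i (tnth s i))%R.
have c0 : (0 <= c)%R by exact: prodr_ge0.
have onD (V : 'I_n -> T -> R) z : (forall i, i != j -> V i = W i) -> D z ->
    vote_weight V (set_tnth s j z) = (V j z * c)%R.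
  move=> VW /and3P[bk zr rk].
  have zA : (rho z < A)%R by exact: lt_le_trans rA.
  have ek : num_voters (set_tnth s j z) = k.
    rewrite /num_voters distE (ball_countD _ j) vj zA add1n /k.
    by rewrite (@eq_ball_count_off _ _ (dist s))// => l; exact: vE.
  have eb : ball_count (v (rho z)) r = (ball_count_off (dist s) j r).+1.
    rewrite (ball_countD _ j) vj zr add1n.
    by rewrite (@eq_ball_count_off _ _ (dist s))// => l; exact: vE.
  rewrite /vote_weight /enough ek distE eb ltnS -/b bk.
  rewrite (bigD1 j)//= tnth_mktuple eqxx; congr (_ * _)%R.
  apply: eq_big => [i|i /andP[_ ij]].
    rewrite andbC; have [//|ij/=] := eqVneq i j.
    by rewrite (rank_ltE ij)// (@eq_rank_off _ _ (dist s))// => l; exact: vE.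
  by rewrite VW// tnth_mktuple (negbTE ij).
(* If the weight does not vanish, every voter lies within [r], so a point outside [D] does not vote
   and the two products have the same factors. *)
have offD z : ~ D z -> vote_weight W (set_tnth s j z) = vote_weight W' (set_tnth s j z).
  move=> nDz; rewrite /vote_weight; case: ifPn => // en.
  apply: eq_bigr => i ik; have [ij|/W'E ->//] := eqVneq i j; exfalso; apply: nDz.
  move: en ik; rewrite /enough ij distE => en ik.
  have zr : (rho z < r)%R by have := rank_lt_ball en ik; rewrite vj.
  have zA : (rho z < A)%R by exact: lt_le_trans rA.
  have ek : num_voters (set_tnth s j z) = k.
    rewrite /num_voters distE (ball_countD _ j) vj zA add1n /k.
    by rewrite (@eq_ball_count_off _ _ (dist s))// => l; exact: vE.
  have eb : ball_count (v (rho z)) r = (ball_count_off (dist s) j r).+1.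
    rewrite (ball_countD _ j) vj zr add1n.
    by rewrite (@eq_ball_count_off _ _ (dist s))// => l; exact: vE.
  by move: en ik; rewrite ek eb ltnS => en ik; apply/and3P.
have split_int (V : 'I_n -> T -> R) :
    (forall i, measurable_fun setT (V i)) -> (forall i z, (0 <= V i z)%R) ->
    \int[mu]_z (vote_weight V (set_tnth s j z))%:E =
    \int[mu]_(z in D) (vote_weight V (set_tnth s j z))%:E +
    \int[mu]_(z in ~` D) (vote_weight V (set_tnth s j z))%:E.
  move=> mV V0; rewrite -ge0_integral_setU//.
  - by rewrite setUv.
  - exact: measurableC.
  - by rewrite setUv; exact: mset.
  - by move=> z _; rewrite lee_fin vote_weight_ge0.
  - by apply/disj_setPS => z [].
rewrite split_int// [leRHS]split_int//; apply: leeD; last first.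
  by rewrite (eq_integral (fun z => (vote_weight W' (set_tnth s j z))%:E))// => z;
    rewrite inE => /offD ->.
rewrite (eq_integral (fun z => c%:E * (h z)%:E)); last first.
  by move=> z; rewrite inE => Dz; rewrite onD// Wj -EFinM mulrC.
rewrite [leRHS](eq_integral (fun z => (c * theta)%:E)); last first.
  by move=> z; rewrite inE => Dz; rewrite onD// W'j mulrC.
rewrite integral_cst// ge0_integralZl//; last 2 first.
- by apply/measurable_EFinP; exact: measurable_funTS.
- by move=> z _; rewrite lee_fin.
by rewrite EFinM -muleA; apply: lee_wpmul2l => //; rewrite lee_fin.
Qed.

(** Hybrid argument: in [W m] the weights of the first [m] indices are already [theta], and each
    passage from [m] to [m + 1] is one replacement. *)
Lemma vote_weight_le n :
  \int[iid_law mu n]_s (vote_weight (fun=> h) s)%:E <=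
  \int[iid_law mu n]_s (if enough s then theta ^+ num_voters s else 0)%:E.
Proof.
pose W m (i : 'I_n) := if (i < m)%N then cst theta else h.
have mW m i : measurable_fun setT (W m i) by rewrite /W; case: ifP.
have W0 m i z : (0 <= W m i z)%R by rewrite /W; case: ifP.
suff H m : (m <= n)%N -> \int[iid_law mu n]_s (vote_weight (fun=> h) s)%:E <=
    \int[iid_law mu n]_s (vote_weight (W m) s)%:E.
  apply: (le_trans (H n (leqnn n))); rewrite le_eqVlt; apply/orP; left; apply/eqP.
  apply: eq_integral => s _; congr EFin; rewrite /vote_weight.
  case: ifPn => // en; under eq_bigr do rewrite /W ltn_ord.
  rewrite big_const iter_mulr_1; congr (_ ^+ _)%R.
  rewrite -sum1_card.
  transitivity (\sum_(i < n | (rank (dist s) i < num_voters s)%N) 1)%N.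
    exact: eq_bigl.
  rewrite -(big_take_sort addn rho s _ (fun=> 1%N)) sum1_size size_take.
  rewrite size_sort size_tuple.
  (* There are exactly [k] indices of rank below [k] because the sample has more than [k] points,
     which [enough] provides. *)
  have : (num_voters s < n)%N.
    apply: (leq_trans en); rewrite -[leqRHS](card_ord n); exact: max_card.
  by move=> ->.
elim: m => [_|m IHm mn].
  by rewrite (_ : W 0%N = fun=> h)//; apply/funext => i; rewrite /W ltn0.
apply: (le_trans (IHm (ltnW mn))).
apply: (@vote_weight_replace _ (Ordinal mn)) => //.
- by rewrite /W/= ltnn.
- by rewrite /W/= ltnSn.
move=> i ij; rewrite /W ltnS leq_eqVlt; case: eqP => //= im.
by case/eqP: ij; exact: val_inj.
Qed.

End weighted_vote.

(** * Tails of ball counts *)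

Lemma measure_le_integral d (T : measurableType d) (R : realType)
    (m : {measure set T -> \bar R}) (E : set T) (g : T -> R) :
  measurable E -> measurable_fun setT g -> (forall x, 0 <= g x) ->
  (forall x, E x -> 1 <= g x) -> (m E <= \int[m]_x (g x)%:E)%E.
Proof.
move=> mE mg g0 g1; rewrite -[X in (m X <= _)%E]setIT -integral_indic//.
apply: ge0_le_integral => //.
- exact/measurable_EFinP/measurable_indicP.
- exact/measurable_EFinP.
move=> x _; rewrite lee_fin indicE; case: (boolP (x \in E)) => [|_]; last exact: g0.
by rewrite inE => /g1.
Qed.

Section chernoff.
Local Open Scope ereal_scope.
Context d (T : measurableType d) (R : realType) (mu : probability T R).
Variable rho : T -> R.
Hypothesis mrho : measurable_fun setT rho.

Definition ball_mass (r : R) : R := fine (mu [set z | (rho z < r)%R]).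

Lemma measurable_ball r : measurable [set z | (rho z < r)%R].
Proof. by rewrite -[X in measurable X]setTI; exact: measurable_fun_ltr. Qed.

Lemma ball_massE r : (ball_mass r)%:E = mu [set z | (rho z < r)%R].
Proof. by rewrite fineK// fin_num_measure//; exact: measurable_ball. Qed.

Lemma ball_mass_ge0 r : (0 <= ball_mass r)%R.
Proof. by rewrite fine_ge0. Qed.

Lemma measurable_count n r :
  measurable_fun setT (fun s : n.-tuple T => (ball_count (dist rho s) r)%:R : R).
Proof.
apply: (measurableT_comp (f := fun m : nat => m%:R : R)); first by [].
by apply: measurable_ball_count => i; exact: measurable_dist.
Qed.

(** The exponential moment of the count factors over the sample, and
    [1 + p (e^c - 1) <= exp (p (e^c - 1))]. As [c] may be negative, one bound serves both tails. *)
Lemma chernoff_count n r (c t : R) :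
  iid_law mu n [set s | (t <= c * (ball_count (dist rho s) r)%:R)%R] <=
  (expR (n%:R * (ball_mass r * (expR c - 1)) - t))%:E.
Proof.
pose phi z := (if rho z < r then expR c else 1)%R.
have mphi : measurable_fun setT phi.
  by apply: measurable_fun_ifT => //; exact: measurable_fun_ltr.
have phi0 z : (0 <= phi z)%R by rewrite /phi; case: ifP => // _; exact: expR_ge0.
have phiE : \int[mu]_z (phi z)%:E = (1 + ball_mass r * (expR c - 1))%:E.
  have mB := measurable_ball r.
  have mi1 : measurable_fun setT
      (fun z => (\1_(~` [set z | (rho z < r)%R]) z : R)%:E).
    exact/measurable_EFinP/measurable_indicP/measurableC.
  have mi2 : measurable_fun setT (fun z => (\1_[set z | (rho z < r)%R] z : R)%:E).
    exact/measurable_EFinP/measurable_indicP.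
  have i0 B z : 0 <= (\1_B z : R)%:E by rewrite lee_fin.
  have e0 : 0 <= (expR c)%:E by rewrite lee_fin expR_ge0.
  have -> : \int[mu]_z (phi z)%:E = \int[mu]_z
      ((\1_(~` [set z | (rho z < r)%R]) z)%:E +
       (expR c)%:E * (\1_[set z | (rho z < r)%R] z)%:E).
    apply: eq_integral => z _; rewrite /phi !indicE in_setC.
    by have [zr|zr] := boolP (z \in _); move: zr; rewrite ?inE ?notin_setE/=;
      [move=> ->|move=> /negP/negbTE ->]; rewrite ?mule1 ?mule0 ?adde0 ?add0e.
  rewrite ge0_integralD//; last exact: measurable_funeM.
  rewrite ge0_integralZl// !integral_indic//; last exact: measurableC.
  rewrite !setIT [X in X + _](_ : _ = 1 - mu [set z | (rho z < r)%R]); last first.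
    exact: probability_setC.
  transitivity (1 - (ball_mass r)%:E + (expR c)%:E * (ball_mass r)%:E).
    by rewrite ball_massE.
  by rewrite -EFinB -EFinM -EFinD; congr EFin; ring.
have prodE s : (\prod_(i < n) phi (tnth s i))%R =
    expR (c * (ball_count (dist rho s) r)%:R).
  rewrite /ball_count -sum1_card natr_sum mulr_sumr expR_sum [RHS]big_mkcond.
  apply: eq_bigr => i _; rewrite /phi inE /dist.
  by case: ifP => _; rewrite ?mulr1.
have mE : measurable [set s : n.-tuple T |
    (t <= c * (ball_count (dist rho s) r)%:R)%R].
  rewrite -[X in measurable X]setTI; apply: measurable_fun_ler => //.
  by apply: measurable_funM => //; exact: measurable_count.
have mprod : measurable_fun setT
    (fun s : n.-tuple T => (\prod_(i < n) phi (tnth s i))%:E).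
  apply/measurable_EFinP; apply: measurable_prod => i _.
  exact: measurableT_comp mphi (@measurable_tnth _ _ _ i).
apply: (@le_trans _ _ (\int[iid_law mu n]_s
    (expR (- t) * \prod_(i < n) phi (tnth s i))%:E)).
  apply: measure_le_integral => //.
  - by apply: measurable_funM; [exact: measurable_cst|exact/measurable_EFinP].
  - by move=> s; rewrite mulr_ge0 ?expR_ge0// prodr_ge0.
  by move=> s /= ts; rewrite prodE -expRD -[leLHS]expR0 ler_expR addrC subr_ge0.
under eq_integral do rewrite EFinM.
rewrite ge0_integralZl//; last by move=> s _; rewrite lee_fin prodr_ge0.
rewrite integral_iid_law_prod// phiE -EFin_expe -EFinM lee_fin.
rewrite (addrC _ (- t)%R) expRD ler_pM2l ?expR_gt0// expRM_natl.
apply: lerXn2r; rewrite ?nnegrE ?expR_ge0//; last exact: expR_ge1Dx.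
by rewrite -lee_fin -phiE; apply: integral_ge0 => z _; rewrite lee_fin.
Qed.

Lemma count_lower_tail n r :
  iid_law mu n [set s | ((ball_count (dist rho s) r)%:R <= n%:R * ball_mass r / 4)%R]
  <= (expR (- (n%:R * ball_mass r / 4)))%:E.
Proof.
have := @chernoff_count n r (-1) (- (n%:R * ball_mass r / 4)).
rewrite (_ : [set s | _] = [set s | ((ball_count (dist rho s) r)%:R <=
    n%:R * ball_mass r / 4)%R]); last first.
  by apply/seteqP; split=> s /=; rewrite mulN1r lerN2.
move=> /le_trans; apply; rewrite lee_fin ler_expR.
(* With [c = -1] the exponent is [M (1 / e - 1) + M / 4], and [1 / e <= 1 / 2] makes it at most
   [- M / 4]. *)
have e2 : (expR (-1) <= 2^-1 :> R)%R.
  rewrite expRN lef_pV2 ?posrE ?expR_gt0//.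
  by have := expR_ge1Dx (1 : R); lra.
have := mulr_ge0 (ler0n R n) (ball_mass_ge0 r) => M0.
rewrite mulrA; set M := (_ * _)%R in M0 *.
nra.
Qed.

Lemma count_upper_tail n r :
  iid_law mu n [set s | (4 * (n%:R * ball_mass r) <= (ball_count (dist rho s) r)%:R)%R]
  <= (expR (- (n%:R * ball_mass r)))%:E.
Proof.
have := @chernoff_count n r 1 (4 * (n%:R * ball_mass r)).
rewrite (_ : [set s | _] = [set s | (4 * (n%:R * ball_mass r) <=
    (ball_count (dist rho s) r)%:R)%R]); last first.
  by apply/seteqP; split=> s /=; rewrite mul1r.
move=> /le_trans; apply; rewrite lee_fin ler_expR.
(* With [c = 1] the exponent is [M (e - 1) - 4 M], and the crude [e <= 4] brings it below [- M]. *)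
have e4 : (expR 1 <= 4 :> R)%R.
  have e2 : (expR (2^-1) <= 2 :> R)%R.
    rewrite -[leLHS]invrK -expRN -[leRHS]invrK lef_pV2 ?posrE ?expR_gt0//.
    by have := expR_ge1Dx (- 2^-1 : R); lra.
  rewrite (_ : 1 = 2^-1 + 2^-1)%R; last by lra.
  rewrite expRD; have := expR_ge0 (2^-1 : R); nra.
have := mulr_ge0 (ler0n R n) (ball_mass_ge0 r) => M0.
rewrite mulrA; set M := (_ * _)%R in M0 *.
nra.
Qed.

End chernoff.

(** * Error of the vote in terms of ball masses *)

Lemma powR_truncnS (R : realType) (y : R) : 0 <= y ->
  y <= ((Num.truncn y).+1)%:R <= y + 1.
Proof.
move=> y0; have /andP[h1 h2] := truncn_itv y0.
by rewrite (ltW h2)/= -natr1 lerD2r.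
Qed.

Definition knn_size (R : realType) (K q : R) (m : nat) : nat :=
  (Num.truncn (K * m%:R `^ q)).+1.

Section vote_error.
Local Open Scope ereal_scope.
Context d (T : measurableType d) (R : realType) (mu : probability T R).
Variables (rho : T -> R) (K q A r : R).
Hypothesis mrho : measurable_fun setT rho.
Hypotheses (rA : (r <= A)%R) (K0 : (0 < K)%R) (q0 : (0 < q)%R).

Let kf := knn_size K q.

Variables (h : T -> R) (theta g : R).
Hypothesis mh : measurable_fun setT h.
Hypothesis h0 : forall z, (0 <= h z)%R.
Hypothesis theta0 : (0 <= theta)%R.
Hypothesis h_open : forall t, (t <= r)%R ->
  \int[mu]_(z in [set z | (rho z < t)%R]) (h z)%:E <=
  theta%:E * mu [set z | (rho z < t)%R].
Hypothesis h_closed : forall t, (t < r)%R ->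
  \int[mu]_(z in [set z | (rho z <= t)%R]) (h z)%:E <=
  theta%:E * mu [set z | (rho z <= t)%R].
Hypothesis g0 : (0 <= g)%R.
Hypothesis theta_g : (theta <= expR (- g))%R.

(** One term per way to fail: a vote weight of at least 1 when the ball of radius [A] holds more
    than [M / 4] points (Markov with [theta ^ k]), then fewer than that, more than [4 M], and too
    few points within [r]. *)
Lemma vote_error n (M := (n%:R * ball_mass mu rho A)%R) :
  (1 <= M)%R ->
  ((K * 4 `^ q + 1) * M `^ q <= n%:R * ball_mass mu rho r / 4)%R ->
  iid_law mu n [set s | ~~ enough rho kf r A s || (1 <= vote_weight rho kf r A (fun=> h) s)%R] <=
  (expR (- (g * (K * (M / 4) `^ q))) + expR (- (M / 4)) + expR (- M) +
   expR (- (n%:R * ball_mass mu rho r / 4)))%:E.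
Proof.
move=> M1 Mr.
have M0 : (0 <= M)%R by lra.
set L := iid_law mu n.
have mcount u : measurable_fun setT
    (fun s : n.-tuple T => (ball_count (dist rho s) u)%:R : R).
  exact: measurable_count.
have mset_le (u v : R) : measurable [set s : n.-tuple T |
    ((ball_count (dist rho s) u)%:R <= v)%R].
  by rewrite -[X in measurable X]setTI; exact: measurable_fun_ler.
have mset_ge (u v : R) : measurable [set s : n.-tuple T |
    (v <= (ball_count (dist rho s) u)%:R)%R].
  by rewrite -[X in measurable X]setTI; exact: measurable_fun_ler.
have mvw : measurable_fun setT (fun s : n.-tuple T => vote_weight rho kf r A (fun=> h) s).
  exact: measurable_vote_weight.
pose E1 := [set s : n.-tuple T | (1 <= vote_weight rho kf r A (fun=> h) s)%R].
pose E2 := [set s : n.-tuple T | ((ball_count (dist rho s) A)%:R <= M / 4)%R].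
pose E3 := [set s : n.-tuple T | (4 * M <= (ball_count (dist rho s) A)%:R)%R].
pose E4 := [set s : n.-tuple T | ((ball_count (dist rho s) r)%:R <=
   n%:R * ball_mass mu rho r / 4)%R].
have mE1 : measurable E1.
  by rewrite -[X in measurable X]setTI; exact: measurable_fun_ler.
have mE2 : measurable E2 by exact: mset_le.
have mE3 : measurable E3 by exact: mset_ge.
have mE4 : measurable E4 by exact: mset_le.
have kfP m : (K * m%:R `^ q <= (kf m)%:R <= K * m%:R `^ q + 1)%R.
  by apply: powR_truncnS; rewrite mulr_ge0 ?powR_ge0// ltW.
have sub : [set s : n.-tuple T | ~~ enough rho kf r A s ||
    (1 <= vote_weight rho kf r A (fun=> h) s)%R] `<=` E1 `|` (E3 `|` E4).
  move=> s /= /orP[ne|]; last by left.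
  (* If [enough] fails with fewer than [4 M] points within [A], the count within [r] is at most [k],
     hence at most [K (4 M) ^ q + 1]; since [1 <= M], the 1 is absorbed into [M ^ q], and [Mr] puts
     the sample in [E4]. *)
  right; have [c3|c3] := leP (4 * M)%R (ball_count (dist rho s) A)%:R; first by left.
  right; apply: le_trans Mr; move: ne; rewrite /enough -leqNgt => ne.
  apply: (@le_trans _ _ (num_voters rho kf A s)%:R%R); first by rewrite ler_nat.
  have /andP[_ /le_trans] := kfP (ball_count (dist rho s) A); apply.
  rewrite mulrDl mul1r lerD//.
    rewrite -mulrA ler_pM2l// -powRM//; apply: ge0_ler_powR.
    - exact: ltW.
    - by rewrite nnegrE.
    - by rewrite nnegrE mulr_ge0.
    - exact: ltW.
  apply: (@le_trans _ _ (1 `^ q)%R); first by rewrite powR1.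
  by apply: ge0_ler_powR; rewrite ?nnegrE//; exact: ltW.
have menough : measurable_fun setT (fun s : n.-tuple T => enough rho kf r A s).
  exact: measurable_enough.
have mE : measurable [set s : n.-tuple T | ~~ enough rho kf r A s ||
    (1 <= vote_weight rho kf r A (fun=> h) s)%R].
  rewrite -[X in measurable X]setTI.
  apply: (@measurable_or _ _ setT (fun s => ~~ enough rho kf r A s)
    (fun s => (1 <= vote_weight rho kf r A (fun=> h) s)%R)) => //.
    exact: measurable_neg.
  exact: measurable_fun_ler.
apply: (@le_trans _ _ (L E1 + (L E3 + L E4))).
  apply: (@le_trans _ _ (L (E1 `|` (E3 `|` E4)))).
    by apply: le_measure; rewrite ?inE//; do ?apply: measurableU.
  apply: (le_trans (measureU2 _ _ _)) => //; first exact: measurableU.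
  by apply: leeD2l; exact: measureU2.
have L3 : L E3 <= (expR (- M))%:E by exact: count_upper_tail.
have L4 : L E4 <= (expR (- (n%:R * ball_mass mu rho r / 4)))%:E.
  exact: count_lower_tail.
have L2 : L E2 <= (expR (- (M / 4)))%:E by exact: count_lower_tail.
have L1 : L E1 <= (expR (- (g * (K * (M / 4) `^ q))))%:E + L E2.
  apply: (le_trans (measure_le_integral L mE1 mvw _ _)) => //.
    by move=> s; exact: vote_weight_ge0.
  apply: (le_trans (vote_weight_le kf mrho rA mh h0 theta0 h_open h_closed n)).
  have -> : (expR (- (g * (K * (M / 4) `^ q))))%:E + L E2 =
      \int[L]_s ((expR (- (g * (K * (M / 4) `^ q))))%:E + (\1_E2 s)%:E).
    have mi2 : measurable_fun setT (fun s : n.-tuple T => (\1_E2 s : R)%:E).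
      exact/measurable_EFinP/measurable_indicP.
    have i0 s : [set: n.-tuple T] s -> 0 <= (\1_E2 s : R)%:E by move=> _; rewrite lee_fin.
    rewrite ge0_integralD//
      integral_cst// integral_indic// setIT.
    by rewrite [X in _ * X](_ : _ = 1) ?mule1//; exact: probability_setT.
  apply: ge0_le_integral => //.
  - by move=> s _; rewrite lee_fin; case: ifP => // _; exact: exprn_ge0.
  - apply/measurable_EFinP; apply: measurable_fun_ifT => //.
    apply: (measurableT_comp (f := fun m : nat => (theta ^+ m)%R)); first by [].
    exact: measurable_num_voters.
  - by apply: emeasurable_funD => //; exact/measurable_EFinP/measurable_indicP.
  move=> s _; rewrite -EFinD lee_fin indicE.
  have [s2|] := boolP (s \in E2).
    apply: (@le_trans _ _ 1%R); last by rewrite lerDr expR_ge0.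
    case: ifP => // _; apply: exprn_ile1 => //; apply: (le_trans theta_g).
    by rewrite -expR0 ler_expR oppr_le0.
  rewrite notin_setE /E2/= => /negP; rewrite -ltNge addr0 => s2.
  case: ifP => _; last exact: expR_ge0.
  apply: (@le_trans _ _ (expR (- g) ^+ num_voters rho kf A s)%R).
    by apply: lerXn2r; rewrite ?nnegrE ?expR_ge0.
  rewrite -expRM_natr ler_expR mulNr lerN2 ler_wpM2l//.
  have /andP[+ _] := kfP (ball_count (dist rho s) A).
  apply: le_trans; rewrite ler_pM2l//; apply: ge0_ler_powR.
  - exact: ltW.
  - by rewrite nnegrE divr_ge0.
  - by rewrite nnegrE.
  - exact: ltW.
rewrite !EFinD -!addeA; apply: (le_trans (leeD L1 (leeD L3 L4))).
by rewrite -!addeA; apply: leeD => //; apply: leeD.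
Qed.

End vote_error.

(** * Norms and the classifier *)

Section norm.
Context {R : realType} {d : nat} (nu : 'rV[R]_d -> R).
Hypothesis nu_norm : is_norm nu.

Lemma is_norm0 : nu 0 = 0.
Proof. by case: nu_norm => _ nuZ _; rewrite -(scale0r 0) nuZ normr0 mul0r. Qed.

Lemma is_normN x : nu (- x) = nu x.
Proof. by case: nu_norm => _ nuZ _; rewrite -scaleN1r nuZ normrN normr1 mul1r. Qed.

Lemma is_norm_ge0 x : 0 <= nu x.
Proof.
case: nu_norm => nuD _ _; have := nuD x (- x).
by rewrite subrr is_norm0 is_normN -mulr2n pmulrn_lge0.
Qed.

(** Coordinates below [r / norm_const] in absolute value force [nu v < r]; the summand 1 makes the
    constant positive and this last inequality strict. *)
Definition norm_const : R := 1 + \sum_(i < d) nu (delta_mx 0 i).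

Lemma norm_const_gt0 : 0 < norm_const.
Proof. by rewrite ltr_pwDl// sumr_ge0// => i _; exact: is_norm_ge0. Qed.

Lemma is_norm_lt_box (v : 'rV[R]_d) (r : R) : 0 < r -> (forall i, `|v ord0 i| < r / norm_const) ->
  nu v < r.
Proof.
case: nu_norm => nuD nuZ _ r0 vr; have c0 := norm_const_gt0.
have nu_sum (F : 'I_d -> 'rV[R]_d) : nu (\sum_i F i) <= \sum_i nu (F i).
  elim/big_rec2 : _ => [|i y x _ h]; first by rewrite is_norm0.
  by apply: (le_trans (nuD _ _)); rewrite lerD2l.
rewrite [v]row_sum_delta; apply: (le_lt_trans (nu_sum _)).
apply: (@le_lt_trans _ _ (\sum_i r / norm_const * nu (delta_mx 0 i))).
  by apply: ler_sum => i _; rewrite nuZ ler_wpM2r ?is_norm_ge0// ltW.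
rewrite -mulr_sumr mulrAC ltr_pdivrMr// ltr_pM2l//.
by rewrite /norm_const ltrDr.
Qed.

(** An open [nu]-ball is a countable union of rational boxes. *)
Lemma measurable_norm_lt (t : R) : measurable [set x | nu x < t].
Proof.
have c0 := norm_const_gt0.
pose B (p : 'rV[rat]_d) m := [set x : 'rV[R]_d |
  forall i, `|x ord0 i - ratr (p ord0 i)| < m.+1%:R^-1].
have mB p m : measurable (B p m).
  rewrite (_ : B p m = \bigcap_(i in [set: 'I_d]) [set x : 'rV[R]_d |
      `|x ord0 i - ratr (p ord0 i)| < m.+1%:R^-1]); last first.
    by apply/seteqP; split=> x /= h i; [move=> _|]; exact: h.
  apply: fin_bigcap_measurable => // i _; rewrite -[X in measurable X]setTI.
  apply: measurable_fun_ltr => //; apply: measurableT_comp => //.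
  by apply: measurable_funB => //; exact: measurable_coord.
pose F k := if unpickle k is Some (p, m) then
  if `[< B p m `<=` [set x | nu x < t] >] then B p m else set0 else set0.
rewrite (_ : [set x | _] = \bigcup_k F k).
  apply: bigcupT_measurable => k; rewrite /F; case: unpickle => // -[p m].
  by case: ifP.
apply/seteqP; split=> [x /= xt|x [k _]]; last first.
  rewrite /F; case: unpickle => // -[p m]; case: ifPn => // /asboolP Bt.
  exact: Bt.
(* Half the half-side of a cube around [x] contained in the ball: one [e] covers the distance from
   [x] to the rational centre, the other the distance from there to [y]. *)
pose e := (t - nu x) / norm_const / 2.
have e0 : 0 < e by rewrite !divr_gt0// subr_gt0.
have [m me] : exists m : nat, m.+1%:R^-1 < e.
  exists (Num.truncn e^-1); rewrite invf_plt ?posrE ?ltr0n//.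
  by rewrite truncnS_gt.
have /choice[p pP] : forall i : 'I_d, exists p : rat, `|x ord0 i - ratr p| < m.+1%:R^-1.
  move=> i; have m0 : 0 < m.+1%:R^-1 :> R by rewrite invr_gt0 ltr0n.
  have [|p] := @rat_in_itvoo _ (x ord0 i) (x ord0 i + m.+1%:R^-1).
    by rewrite ltrDl.
  rewrite in_itv/= => /andP[h1 h2]; exists p; rewrite ltr_distlC h2 andbT.
  by apply: lt_trans h1; rewrite gtrBl.
exists (pickle (\row_i p i, m)) => //; rewrite /F pickleK.
have Bx y : B (\row_i p i) m y -> nu y < t.
  case: nu_norm => nuD _ _ By; rewrite -(subrK x y) addrC.
  apply: (le_lt_trans (nuD _ _)); rewrite -ltrBrDl.
  apply: is_norm_lt_box; first by rewrite subr_gt0.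
  move=> i; rewrite !mxE; have := By i; rewrite mxE => h1.
  have h2 := pP i.
  rewrite (_ : _ / _ = e + e); last by rewrite /e; lra.
  rewrite -(subrK (ratr (p i)) (y ord0 i)) -addrA.
  apply: (le_lt_trans (ler_normD _ _)); apply: ltrD; first exact: lt_trans h1 me.
  by rewrite distrC; exact: lt_trans h2 me.
case: ifPn => [_ i|/asboolP]; first by rewrite mxE; exact: pP.
by case.
Qed.

Lemma measurable_norm : measurable_fun setT nu.
Proof.
apply: (measurability _ (RGenInftyO.measurableE R)) => _ [_ [t ->] <-].
rewrite setTI preimage_itvNyo; exact: measurable_norm_lt.
Qed.

Lemma measurable_norm_sub (x : 'rV[R]_d) :
  measurable_fun setT (fun y : 'rV[R]_d => nu (y - x)).
Proof.
apply: (measurableT_comp measurable_norm).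
apply: measurable_fun_coordP => i; under eq_fun do rewrite !mxE.
by apply: measurable_funB => //; exact: measurable_coord.
Qed.

Lemma measurable_norm_ball (x : 'rV[R]_d) (r : R) : measurable (norm_ball nu x r).
Proof.
rewrite -[X in measurable X]setTI; apply: measurable_fun_ltr => //.
exact: measurable_norm_sub.
Qed.

(** Only the order [r ^ d] of the volume matters later, so an inscribed cube suffices for any
    norm. *)
Lemma lebesgue_norm_ball (x : 'rV[R]_d) (r : R) : 0 < r ->
  (((2 * (r / norm_const)) ^+ d)%:E <= lebesgue_rV d (norm_ball nu x r))%E.
Proof.
move=> r0; have c0 := norm_const_gt0; set e := r / norm_const.
have e0 : 0 < e by exact: divr_gt0.
pose I (i : 'I_d) := `](x ord0 i - e), (x ord0 i + e)[%classic.
have mI i : measurable (I i) by exact: measurable_itv.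
have -> : ((2 * e) ^+ d)%:E =
    lebesgue_rV d [set v : 'rV[R]_d | forall i, I i (v ord0 i)].
  rewrite lebesgue_rV_box// -[in LHS](card_ord d) -prodr_const -prodEFin.
  apply: eq_bigr => i _; rewrite lebesgue_measure_itv/= lte_fin.
  by rewrite ltrD2l gtrN// -EFinB; congr EFin; ring.
apply: le_measure; rewrite ?inE//.
- rewrite (_ : [set v | _] = \bigcap_(i in [set: 'I_d])
    ((fun v : 'rV[R]_d => v ord0 i) @^-1` I i)); last first.
    by apply/seteqP; split=> v /= h i; [move=> _|]; exact: h.
  apply: fin_bigcap_measurable => // i _; rewrite -[X in measurable X]setTI.
  exact: measurable_coord.
- exact: measurable_norm_ball.
move=> v /= h; apply: is_norm_lt_box => // i; rewrite !mxE.
by have := h i; rewrite /I /= in_itv/= -/e => /andP[h1 h2]; rewrite ltr_norml; lra.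
Qed.

End norm.

Section classifier.
Context {R : realType} {d : nat} (nu : 'rV[R]_d -> R).
Hypothesis nu_norm : is_norm nu.
Variables (K A q : R).

Definition rho_at (x : 'rV[R]_d) (u : 'rV[R]_d * R) : R := nu (u.1 - x).

Lemma measurable_rho_at : measurable_fun setT
  (fun p : 'rV[R]_d * ('rV[R]_d * R) => rho_at p.1 p.2).
Proof.
apply: (measurableT_comp (measurable_norm nu_norm)).
apply: measurable_fun_coordP => i; under eq_fun do rewrite !mxE.
apply: measurable_funB.
  apply: (measurableT_comp (measurable_coord i)).
  exact: (measurableT_comp measurable_fst measurable_snd).
exact: (measurableT_comp (measurable_coord i) measurable_fst).
Qed.

Lemma measurable_rho x : measurable_fun setT (rho_at x).
Proof. exact: (measurableT_comp measurable_rho_at (pair1_measurable x)). Qed.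

Lemma ball_count_tuple N (s : N.-tuple ('rV[R]_d * R)) x r :
  count (fun u => nu (u.1 - x) < r) s = ball_count (dist (rho_at x) s) r.
Proof.
rewrite /ball_count -sum1_card -sum1_count big_tuple; exact: eq_bigl.
Qed.

Lemma eta_hatE N (s : N.-tuple ('rV[R]_d * R)) x :
  eta_hat nu K A q s x =
  (num_voters (rho_at x) (knn_size K q) A s)%:R^-1 *
  \sum_(i < N | (rank (dist (rho_at x) s) i <
                 num_voters (rho_at x) (knn_size K q) A s)%N) (tnth s i).2.
Proof.
rewrite /eta_hat; have -> : adaptive_k nu K A q s x =
    num_voters (rho_at x) (knn_size K q) A s.
  by rewrite /adaptive_k ball_count_tuple.
congr (_ * _).
exact: (big_take_sort (GRing.add) (rho_at x) s _ snd).
Qed.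

Lemma measurable_dist_at N (i : 'I_N) : measurable_fun setT
  (fun p : 'rV[R]_d * N.-tuple ('rV[R]_d * R) => dist (rho_at p.1) p.2 i).
Proof.
have mp : measurable_fun setT
    (fun p : 'rV[R]_d * N.-tuple ('rV[R]_d * R) => (p.1, tnth p.2 i)).
  apply: measurable_fun_pair; first exact: measurable_fst.
  exact: (measurableT_comp (measurable_tnth i) measurable_snd).
exact: (measurableT_comp measurable_rho_at mp).
Qed.

Lemma measurable_num_voters_at N : measurable_fun setT
  (fun p : 'rV[R]_d * N.-tuple ('rV[R]_d * R) =>
     num_voters (rho_at p.1) (knn_size K q) A p.2).
Proof.
apply: (measurableT_comp (f := knn_size K q)); first exact: measurable_natfun.
by apply: measurable_ball_count => i; exact: measurable_dist_at.
Qed.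

Lemma measurable_eta_hat N : measurable_fun setT
  (fun p : 'rV[R]_d * N.-tuple ('rV[R]_d * R) => eta_hat nu K A q p.2 p.1).
Proof.
under eq_fun do rewrite eta_hatE.
apply: measurable_funM.
  apply: (measurableT_comp (f := fun m : nat => m%:R^-1 : R)); first by [].
  exact: measurable_num_voters_at.
under eq_fun do rewrite big_mkcond.
apply: measurable_sum => i; apply: measurable_fun_ifT => //.
  apply: measurable_fun_ltn; last exact: measurable_num_voters_at.
  by apply: measurable_rank => j; exact: measurable_dist_at.
apply: (measurableT_comp measurable_snd).
exact: (measurableT_comp (measurable_tnth i) measurable_snd).
Qed.

Lemma measurable_sign_label : measurable_fun setT (@sign_label R).
Proof.
apply: measurable_fun_ifT => //; exact: measurable_fun_ler.
Qed.

Lemma sign_labelP (a : R) : sign_label a = 1 \/ sign_label a = -1.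
Proof. by rewrite /sign_label; case: ifP; [left|right]. Qed.

Lemma measurable_adaptive_knn N : measurable_fun setT
  (fun p : 'rV[R]_d * N.-tuple ('rV[R]_d * R) => adaptive_knn nu K A q p.2 p.1).
Proof. exact: (measurableT_comp measurable_sign_label (@measurable_eta_hat N)). Qed.

(** A wrong prediction means that the label sum has the sign opposite to [e] or vanishes, so the
    product of the [exp(-t e Y)] is at least 1. This holds also for [S = 0], where the prediction is
    1 by convention. *)
Lemma wrong_vote_weight N (s : N.-tuple ('rV[R]_d * R)) x r e t :
  (e = 1 \/ e = -1) -> 0 <= t -> adaptive_knn nu K A q s x <> e ->
  enough (rho_at x) (knn_size K q) r A s ->
  1 <= vote_weight (rho_at x) (knn_size K q) r A
         (fun=> fun u => expR (- t * (e * u.2))) s.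
Proof.
move=> e1 t0 err en; rewrite /vote_weight en.
rewrite -expR_sum -!mulr_sumr; set S := \sum_(i < N | _) _.
suff Se : e * S <= 0 by rewrite -expR0 ler_expR mulNr -mulrN mulr_ge0// oppr_ge0.
move: err; rewrite /adaptive_knn eta_hatE -/S /sign_label.
have v0 : 0 < (num_voters (rho_at x) (knn_size K q) A s)%:R^-1 :> R.
  by rewrite invr_gt0 ltr0n.
rewrite pmulr_rge0//.
case: leP => S0; case: e1 => -> err.
- by case: err.
- by rewrite mulN1r oppr_le0.
- by rewrite mul1r ltW.
- by case: err.
Qed.

End classifier.

(** * The excess risk as an integral of error probabilities *)

Lemma indic_bool (T : Type) (R : realType) (b : T -> bool) (x : T) :
  \1_[set y | b y] x = (b x)%:R :> R.
Proof. by rewrite indicE; congr (nat_of_bool _)%:R; apply/idP/idP; rewrite in_setE. Qed.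

Section excess_risk.
Local Open Scope ereal_scope.
Context {R : realType} {d : nat} {disp : measure_display}
  {Omega : measurableType disp} {P : probability Omega R}.
Variable Z : {RV P >-> ('rV[R]_d * R)%type}.
Hypothesis Z_label : forall w, (Z w).2 = 1%R \/ (Z w).2 = (-1)%R.
Variable eta : 'rV[R]_d -> R.
Hypothesis eta_regression : is_regression Z eta.

Lemma measurable_X : measurable_fun setT (fun w => (Z w).1).
Proof. exact: (measurableT_comp measurable_fst (measurable_funPT Z)). Qed.

Lemma measurable_Y : measurable_fun setT (fun w => (Z w).2).
Proof. exact: (measurableT_comp measurable_snd (measurable_funPT Z)). Qed.

Lemma measurable_preX B : measurable B -> measurable [set w | B (Z w).1].
Proof. by move=> mB; rewrite -[X in measurable X]setTI; exact: measurable_X. Qed.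

Lemma integrable_bounded (g : Omega -> R) (M : R) : measurable_fun setT g ->
  (forall w, `|g w| <= M)%R -> P.-integrable setT (EFin \o g).
Proof.
move=> mg gM; apply: (@le_integrable _ _ _ _ _ _ _ (EFin \o cst M)) => //.
- exact/measurable_EFinP.
- by move=> w _ /=; rewrite lee_fin (le_trans (gM w))// ler_norm.
- exact: finite_measure_integrable_cst.
Qed.

Lemma regression_indic (B : set 'rV[R]_d) : measurable B ->
  \int[P]_w (\1_B (Z w).1 * (Z w).2)%:E = \int[P]_w (\1_B (Z w).1 * eta (Z w).1)%:E.
Proof.
move=> mB; case: eta_regression => _ _ /(_ B mB).
rewrite integral_mkcond [in X in _ = X -> _]integral_mkcond.
move=> H; transitivity (\int[P]_w (((fun w => (Z w).2%:E) \_ [set w | B (Z w).1]) w)).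
  apply: eq_integral => w _; rewrite patchE indicE.
  by rewrite (_ : (w \in _) = ((Z w).1 \in B)) ?in_setE//; case: ifPn => _;
    rewrite ?mul1r ?mul0r.
rewrite H; apply: eq_integral => w _; rewrite patchE indicE.
by rewrite (_ : (w \in _) = ((Z w).1 \in B))//; case: ifPn => _;
  rewrite ?mul1r ?mul0r.
Qed.

(** For labels [1] and [-1], the difference of the two error indicators is [Y] on [B1], [- Y] on
    [B2] and 0 elsewhere. Both sets depend on [X] alone, so [Y] may be replaced by [eta], which
    gives [|eta|]. *)
Lemma bayes_gap (h : 'rV[R]_d -> R) : measurable_fun setT h ->
  (forall x, h x = 1%R \/ h x = (-1)%R) ->
  P [set w | h (Z w).1 != (Z w).2] =
  P [set w | sign_label (eta (Z w).1) != (Z w).2] +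
  \int[P]_w (`|eta (Z w).1| * \1_[set x | h x != sign_label (eta x)] (Z w).1)%:E.
Proof.
move=> mh h1; case: eta_regression => meta ieta _.
pose gs x := sign_label (eta x).
have mgs : measurable_fun setT gs by exact: (measurableT_comp measurable_sign_label).
have gs1 x : gs x = 1%R \/ gs x = (-1)%R by exact: sign_labelP.
pose B1 := [set x | (gs x == 1%R) && (h x != gs x)].
pose B2 := [set x | (gs x == (-1)%R) && (h x != gs x)].
have mneq dT (X : measurableType dT) (u v : X -> R) :
    measurable_fun setT u -> measurable_fun setT v ->
    measurable_fun setT (fun x => u x != v x).
  by move=> mu mv; apply: measurable_neg; exact: measurable_fun_eqr.
have mB1 : measurable B1.
  rewrite -[X in measurable X]setTI.
  by apply: (@measurable_and _ _ setT (fun x => gs x == 1%R) (fun x => h x != gs x)) => //;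
    [exact: measurable_fun_eqr|exact: mneq].
have mB2 : measurable B2.
  rewrite -[X in measurable X]setTI.
  by apply: (@measurable_and _ _ setT (fun x => gs x == (-1)%R) (fun x => h x != gs x)) => //;
    [exact: measurable_fun_eqr|exact: mneq].
have mX := measurable_X; have mY := measurable_Y.
have mset (u : 'rV[R]_d -> R) : measurable_fun setT u ->
    measurable [set w | u (Z w).1 != (Z w).2].
  move=> mu; rewrite -[X in measurable X]setTI; apply: mneq => //.
  exact: (measurableT_comp mu).
have mind (B : set 'rV[R]_d) : measurable B ->
    measurable_fun setT (fun w => \1_B (Z w).1 : R).
  move=> mB; have mi : measurable_fun setT (\1_B : 'rV[R]_d -> R).
    exact/measurable_indicP.
  exact: (measurableT_comp mi mX).
have Y1 w : `|(Z w).2|%R = 1%R by case: (Z_label w) => ->; rewrite ?normrN normr1.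
have i01 (B : set 'rV[R]_d) x : (0 <= (\1_B x : R) <= 1)%R.
  by rewrite indicE; case: (x \in B); rewrite ?lexx ?ler01.
have iY B : measurable B -> P.-integrable setT (EFin \o (fun w => \1_B (Z w).1 * (Z w).2)%R).
  move=> mB; apply: (@integrable_bounded _ 1%R).
    by apply: measurable_funM => //; exact: mind.
  move=> w; rewrite normrM Y1 mulr1; have /andP[b0 b1] := i01 B (Z w).1.
  by rewrite ger0_norm.
have ie B : measurable B -> P.-integrable setT (EFin \o (fun w => \1_B (Z w).1 * eta (Z w).1)%R).
  move=> mB; apply: le_integrable ieta => //.
    apply/measurable_EFinP; apply: measurable_funM; first exact: mind.
    exact: (measurableT_comp meta).
  move=> w _ /=; rewrite lee_fin normrM; have /andP[b0 b1] := i01 B (Z w).1.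
  by rewrite ger0_norm// ler_piMl.
have n11 : (1 == -1 :> R)%R = false by apply/eqP => h2; lra.
have n11' : (-1 == 1 :> R)%R = false by apply/eqP => h2; lra.
have iB1 x : \1_B1 x = ((gs x == 1%R) && (h x != gs x))%:R%R :> R.
  exact: (@indic_bool _ R (fun x => (gs x == 1%R) && (h x != gs x))).
have iB2 x : \1_B2 x = ((gs x == (-1)%R) && (h x != gs x))%:R%R :> R.
  exact: (@indic_bool _ R (fun x => (gs x == (-1)%R) && (h x != gs x))).
have iB0 x : \1_[set x | h x != gs x] x = (h x != gs x)%:R%R :> R.
  exact: (@indic_bool _ R (fun x => h x != gs x)).
have iBY (u : 'rV[R]_d -> R) w : \1_[set w | u (Z w).1 != (Z w).2] w =
    (u (Z w).1 != (Z w).2)%:R%R :> R.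
  exact: (@indic_bool _ R (fun w => u (Z w).1 != (Z w).2)).
have key : \int[P]_w (\1_B1 (Z w).1 * (Z w).2 - \1_B2 (Z w).1 * (Z w).2)%:E =
  \int[P]_w (`|eta (Z w).1| * \1_[set x | h x != gs x] (Z w).1)%:E.
  under eq_integral do rewrite EFinB.
  rewrite integralB_EFin//; [|exact: iY|exact: iY].
  rewrite regression_indic// [X in _ - X]regression_indic//.
  rewrite -integralB_EFin//; [|exact: ie|exact: ie].
  apply: eq_integral => w _; rewrite -EFinB; congr EFin.
  rewrite iB1 iB2 iB0; move: (h _ != _) => b.
  rewrite /gs /sign_label; case: leP => e0; rewrite ?eqxx ?n11 ?n11' /=.
    by rewrite mul0r subr0 ger0_norm// mulrC.
  by rewrite mul0r sub0r ltr0_norm// mulNr mulrC.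
rewrite -key -[X in P X]setIT -integral_indic//; last exact: (mset _ mh).
rewrite -[X in P X + _]setIT -integral_indic//; last exact: (mset _ mgs).
have iind (u : 'rV[R]_d -> R) : measurable_fun setT u -> P.-integrable setT
    (EFin \o (\1_[set w | u (Z w).1 != (Z w).2] : Omega -> R)).
  move=> mu; apply: (@integrable_bounded _ 1%R).
    by apply/measurable_indicP; exact: (mset _ mu).
  by move=> w; rewrite indicE; case: (_ \in _); rewrite ?normr1 ?normr0.
have iD : P.-integrable setT (EFin \o
    (fun w => \1_B1 (Z w).1 * (Z w).2 - \1_B2 (Z w).1 * (Z w).2)%R).
  by apply: (integrableB _ (iY _ mB1) (iY _ mB2)).
rewrite -integralD//; last exact: (iind _ mgs).
apply: eq_integral => w _; rewrite -EFinD; congr EFin.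
rewrite iB1 iB2 iBY [\1_[set w0 | sign_label _ != _] w](iBY gs).
by case: (h1 (Z w).1) => ->; case: (gs1 (Z w).1) => ->; case: (Z_label w) => ->;
  rewrite ?eqxx ?n11 ?n11' /= ?(mul0r, mul1r, addr0, add0r, subr0, subrr, opprK, addNr).
Qed.

Variable Zs : nat -> {RV P >-> ('rV[R]_d * R)%type}.
Hypothesis Z_iid : iid_copies Z Zs.
Let mu : probability ('rV[R]_d * R)%type R := distribution P Z.
Let sample N w : N.-tuple ('rV[R]_d * R) := [tuple Zs i w | i < N].

Lemma joint_law N (D : set (('rV[R]_d * R) * N.-tuple ('rV[R]_d * R))) :
  measurable D -> P [set w | D (Z w, sample N w)] = (mu \x iid_law mu N) D.
Proof.
move=> mD; case: Z_iid => ind eqlaw.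
pose Zo (o : option nat) := if o is Some i then Zs i else Z.
have lawZ o B : measurable B -> P (Zo o @^-1` B) = mu B.
  by case: o => [i|//]; exact: eqlaw.
pose t : N.+1.-tuple (option nat) := [tuple of None :: [tuple Some (val i) | i < N]].
have Ut : uniq t.
  rewrite /= map_inj_uniq ?enum_uniq ?andbT; last by move=> i j [] /val_inj.
  by apply/mapP => -[].
pose B := [set s : N.+1.-tuple ('rV[R]_d * R) | D (tnth s ord0, [tuple of behead s])].
have mf : measurable_fun setT (fun s : N.+1.-tuple ('rV[R]_d * R) =>
    (tnth s ord0, [tuple of behead s])).
  by apply: measurable_fun_pair; [exact: measurable_tnth|exact: measurable_behead].
have mB : measurable B by rewrite -[X in measurable X]setTI; exact: mf.
have consE p : B (cons_pair p) = D p.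
  case: p => z s; rewrite /B /mkset; congr (D (_, _)); exact: val_inj.
have -> : [set w | D (Z w, sample N w)] = [set w | B (map_tuple (fun o => Zo o w) t)].
  have mapE w : map_tuple (fun o => Zo o w) t = cons_pair (Z w, sample N w).
    by apply: val_inj; rewrite /= -map_comp.
  apply/funext => w; rewrite -[LHS]/(D (Z w, sample N w)) -consE -mapE.
  by [].
rewrite (iid_lawE ind lawZ Ut mB).
transitivity ((mu \x iid_law mu N) (@cons_pair _ _ N @^-1` B)); first by [].
by congr (_ _); apply/funext => p; exact: consE.
Qed.

(** For a frozen sample [g s] is a fixed classifier, to which [bayes_gap] applies; Tonelli then lets
    the probability over the samples be taken first, at a fixed test point. *)
Lemma excess_riskE N (g : seq ('rV[R]_d * R) -> 'rV[R]_d -> R) :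
  measurable_fun setT
    (fun p : 'rV[R]_d * N.-tuple ('rV[R]_d * R) => g p.2 p.1) ->
  (forall s x, g s x = 1%R \/ g s x = (-1)%R) ->
  (excess_risk Z Zs eta g N)%:E =
  \int[P]_w (`|eta (Z w).1|%:E *
    iid_law mu N [set s | g s (Z w).1 != sign_label (eta (Z w).1)]).
Proof.
move=> mg g1; case: eta_regression => meta _ _.
pose gs x := sign_label (eta x).
have mgs : measurable_fun setT gs by exact: (measurableT_comp measurable_sign_label).
have mgs' : measurable_fun setT (fun p : 'rV[R]_d * N.-tuple ('rV[R]_d * R) => gs p.1).
  exact: (measurableT_comp mgs measurable_fst).
pose F (p : 'rV[R]_d * N.-tuple ('rV[R]_d * R)) : R := (g p.2 p.1 != gs p.1)%:R.
have mF : measurable_fun setT F.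
  apply: (measurableT_comp (f := fun b : bool => b%:R : R)); first by [].
  by apply: measurable_neg; exact: measurable_fun_eqr.
have mgx (s : N.-tuple ('rV[R]_d * R)) : measurable_fun setT (g s).
  exact: (measurableT_comp mg (pair2_measurable s)).
have mneq dT (X : measurableType dT) (u v : X -> R) : measurable_fun setT u ->
    measurable_fun setT v -> measurable_fun setT (fun x => u x != v x).
  by move=> mu0 mv; apply: measurable_neg; exact: measurable_fun_eqr.
pose D := [set p : ('rV[R]_d * R) * N.-tuple ('rV[R]_d * R) | g p.2 p.1.1 != p.1.2].
have mp : measurable_fun setT
    (fun p : ('rV[R]_d * R) * N.-tuple ('rV[R]_d * R) => (p.1.1, p.2)).
  apply: measurable_fun_pair; last exact: measurable_snd.
  exact: (measurableT_comp measurable_fst measurable_fst).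
have mD : measurable D.
  rewrite -[X in measurable X]setTI; apply: mneq => //.
    exact: (measurableT_comp mg mp).
  exact: (measurableT_comp measurable_snd measurable_fst).
pose G (p : ('rV[R]_d * R) * N.-tuple ('rV[R]_d * R)) : \bar R :=
  (`|eta p.1.1| * F (p.1.1, p.2))%:E.
have mG : measurable_fun setT G.
  apply/measurable_EFinP; apply: measurable_funM; last exact: (measurableT_comp mF mp).
  apply: measurableT_comp => //; apply: (measurableT_comp meta).
  exact: (measurableT_comp measurable_fst measurable_fst).
have G0 p : 0 <= G p by rewrite lee_fin mulr_ge0.
have mskE w : mkseq (fun i => Zs i w) N = sample N w.
  by rewrite /mkseq -val_enum_ord -map_comp.
pose b := P [set w | gs (Z w).1 != (Z w).2].
have riskE : P [set w | g (mkseq (fun i => Zs i w) N) (Z w).1 != (Z w).2] =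
    b + \int[mu]_z \int[iid_law mu N]_s G (z, s).
  have -> : [set w | g (mkseq (fun i => Zs i w) N) (Z w).1 != (Z w).2] =
      [set w | D (Z w, sample N w)].
    by apply/seteqP; split=> w; rewrite /D /= mskE.
  rewrite joint_law//.
  have -> : (mu \x iid_law mu N) D = \int[mu \x iid_law mu N]_p (\1_D p)%:E.
    by rewrite integral_indic// setIT.
  have mD' : measurable_fun setT (fun p => (\1_D p : R)%:E).
    exact/measurable_EFinP/measurable_indicP.
  have D0 p : 0 <= (\1_D p : R)%:E by rewrite lee_fin.
  rewrite (fubini_tonelli2 _ mD' D0) (fubini_tonelli _ mG G0).
  have -> : b = \int[iid_law mu N]_s b.
    by rewrite integral_cst// [X in _ * X](_ : _ = 1) ?mule1//; exact: probability_setT.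
  have mGG : measurable_fun setT (fun s => \int[mu]_z G (z, s)).
    exact: (measurable_fun_fubini_tonelli_G _ mG G0).
  have GG0 s : [set: N.-tuple ('rV[R]_d * R)] s -> 0 <= \int[mu]_z G (z, s).
    by move=> _; exact: integral_ge0.
  have b0 : 0 <= b by exact: measure_ge0.
  rewrite -ge0_integralD//.
  apply: eq_integral => s _; rewrite /fubini_G /=.
  have mDs : measurable [set z : 'rV[R]_d * R | g s z.1 != z.2].
    rewrite -[X in measurable X]setTI; apply: mneq => //.
    exact: (measurableT_comp (mgx s) measurable_fst).
  transitivity (\int[mu]_z (\1_[set z : 'rV[R]_d * R | g s z.1 != z.2] z)%:E).
    by apply: eq_integral => z _; rewrite !indicE; congr ((nat_of_bool _)%:R%:E);
      apply/idP/idP; rewrite !in_setE.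
  rewrite integral_indic// setIT.
  transitivity (P [set w | g s (Z w).1 != (Z w).2]); first by [].
  rewrite (bayes_gap (mgx s) (g1 s)); congr (_ + _).
  rewrite ge0_integral_distribution//=.
    apply: eq_integral => w _; rewrite /G/= /F/= (@indic_bool _ R (fun x => g s x != gs x)).
    by [].
  exact: (measurableT_comp mG (pair2_measurable s)).
rewrite /excess_risk /risk /bayes_risk.
have mgsX : measurable_fun setT (fun w => gs (Z w).1).
  exact: (measurableT_comp mgs measurable_X).
have bfin : b \is a fin_num.
  rewrite fin_num_measure//; rewrite -[X in measurable X]setTI.
  by apply: mneq => //; exact: measurable_Y.
set a := P [set w | _ != _] in riskE *.
have afin : a \is a fin_num.
  rewrite ge0_fin_numE; last exact: measure_ge0.
  rewrite /a (_ : [set w | _] = [set w | D (Z w, sample N w)]); last first.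
    by apply/seteqP; split=> w; rewrite /D /= mskE.
  rewrite joint_law// (le_lt_trans (probability_le1 _ mD))// ltry.
  by [].
rewrite -/gs -/b EFinB !fineK// riskE addeAC subee// add0e.
rewrite ge0_integral_distribution; last 2 first.
- exact: (measurable_fun_fubini_tonelli_F _ mG G0).
- by move=> z; exact: integral_ge0.
apply: eq_integral => w _ /=.
have mE : measurable [set s : N.-tuple ('rV[R]_d * R) | g s (Z w).1 != gs (Z w).1].
  rewrite -[X in measurable X]setTI; apply: mneq => //.
  exact: (measurableT_comp mg (pair1_measurable (Z w).1)).
rewrite -[X in _ = _ * iid_law mu N X]setIT -integral_indic// -ge0_integralZl//.
- apply: eq_integral => s _; rewrite -EFinM; congr EFin.
  by rewrite (@indic_bool _ R (fun s : N.-tuple _ => g s (Z w).1 != gs (Z w).1)).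
- exact/measurable_EFinP/measurable_indicP.
Qed.

End excess_risk.

(** * Tilted label weights on balls *)

Section tilted_ball.
Local Open Scope ereal_scope.
Context {R : realType} {d : nat} {disp : measure_display}
  {Omega : measurableType disp} {P : probability Omega R}.
Variable Z : {RV P >-> ('rV[R]_d * R)%type}.
Hypothesis Z_label : forall w, (Z w).2 = 1%R \/ (Z w).2 = (-1)%R.
Variables (nu : 'rV[R]_d -> R) (x : 'rV[R]_d).
Hypothesis nu_norm : is_norm nu.
Let mu : probability ('rV[R]_d * R)%type R := distribution P Z.
Variables (e m r : R).
Hypothesis e1 : e = 1%R \/ e = (-1)%R.
Hypothesis m01 : (0 < m < 1)%R.
Hypothesis mean_ge : forall t, (0 < t <= r)%R ->
  (m <= e * mean_label Z (norm_ball nu x t))%R.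

Let lab (c : R) (B : set 'rV[R]_d) := [set w | B (Z w).1 /\ (Z w).2 = c].
Let pr (c : R) (B : set 'rV[R]_d) : R := fine (P (lab c B)).

Let mlab c B : measurable B -> measurable (lab c B).
Proof.
move=> mB; rewrite (_ : lab c B = [set w | B (Z w).1] `&` [set w | (Z w).2 == c]).
  apply: measurableI; first exact: measurable_preX.
  rewrite -[X in measurable X]setTI.
  by apply: measurable_fun_eqr => //; exact: measurable_Y.
by apply/seteqP; split=> w [Bw /= /eqP].
Qed.

Let prE c B : measurable B -> (pr c B)%:E = P (lab c B).
Proof. by move=> mB; rewrite fineK// fin_num_measure//; exact: mlab. Qed.

Let pr_ge0 c B : (0 <= pr c B)%R. Proof. by rewrite fine_ge0. Qed.

Let integral_label (B : set 'rV[R]_d) (psi : R -> R) : measurable B ->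
  \int[P]_(w in [set w | B (Z w).1]) (psi (Z w).2)%:E =
  (psi e * pr e B + psi (- e)%R * pr (- e)%R B)%:E.
Proof.
move=> mB.
have E c w : \1_(lab c B) w = (((Z w).1 \in B) && ((Z w).2 == c))%:R%R :> R.
  rewrite indicE; congr (nat_of_bool _)%:R%R; apply/idP/idP.
    by rewrite inE => -[Bw ->]; rewrite mem_set// eqxx.
  by move=> /andP[/set_mem Bw /eqP Yc]; exact: mem_set.
have ii c : P.-integrable setT (EFin \o (\1_(lab c B) : Omega -> R)).
  apply: (@integrable_bounded _ _ _ _ (\1_(lab c B)) 1%R).
    by apply/measurable_indicP; exact: mlab.
  by move=> w; rewrite E; case: (_ && _); rewrite ?normr1 ?normr0.
rewrite integral_mkcond.
transitivity (\int[P]_w ((psi e)%:E * (\1_(lab e B) w)%:E +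
    (psi (- e)%R)%:E * (\1_(lab (- e)%R B) w)%:E)).
  apply: eq_integral => w _; rewrite patchE -!EFinM -EFinD !E.
  rewrite (_ : (w \in _) = ((Z w).1 \in B)); last by apply/idP/idP; rewrite !in_setE.
  case: (_ \in B) => /=; last by rewrite !mulr0 addr0.
  congr EFin.
  have n11 : (1 == -1 :> R)%R = false by apply/eqP; lra.
  have n11' : (-1 == 1 :> R)%R = false by apply/eqP; lra.
  by case: e1 => ->; case: (Z_label w) => ->;
    rewrite ?opprK ?eqxx ?n11 ?n11' ?mulr1 ?mulr0 ?addr0 ?add0r.
have iiZ k c : P.-integrable setT (fun w => k%:E * (\1_(lab c B) w)%:E).
  by apply: integrableZl => //; exact: ii.
rewrite (integralD measurableT (iiZ _ _) (iiZ _ _)).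
have iZ k c : \int[P]_w (k%:E * (\1_(lab c B) w)%:E) = (k * pr c B)%:E.
  rewrite integralZl//; last exact: ii.
  have mc := mlab c mB; rewrite integral_indic// setIT.
  by rewrite EFinM prE.
by rewrite !iZ.
Qed.

Let mball t : measurable (norm_ball nu x t).
Proof. exact: measurable_norm_ball. Qed.

Let massE B : measurable B -> P [set w | B (Z w).1] = (pr e B + pr (- e)%R B)%:E.
Proof.
move=> mB; have := integral_label (fun=> 1%R) mB.
by rewrite integral_cst ?mul1e ?mul1r//; exact: measurable_preX.
Qed.

(** Inequality [E[e Y; X in B] >= m P(X in B)] in terms of the two label masses;
    unlike [mean_label] it passes to the limit from open to closed balls. *)
Let good B := ((1 + m) * pr (- e) B <= (1 - m) * pr e B)%R.

Let good_open t : (t <= r)%R -> good (norm_ball nu x t).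
Proof.
move=> tr; set B := norm_ball nu x t; have mB := mball t.
have [t0|t0] := leP t 0%R.
  have B0 : B = set0.
    apply/seteqP; split=> // y; rewrite /B /norm_ball /= => /lt_le_trans/(_ t0).
    by rewrite ltNge is_norm_ge0.
  have l0 c : lab c B = set0 by rewrite B0; apply/seteqP; split=> // w [].
  by rewrite /good /pr !l0 measure0 /= !mulr0.
have := mean_ge (_ : 0 < t <= r)%R; rewrite t0 tr => /(_ isT).
rewrite /mean_label /mass -/B massE// (integral_label id mB) /=.
have pp := pr_ge0 e B; have pm := pr_ge0 (- e)%R B.
have [s0|s0] := eqVneq (pr e B + pr (- e) B)%R 0%R.
  move=> _; have pm0 : pr (- e) B = 0%R by lra.
  have pp0 : pr e B = 0%R by lra.
  by rewrite /good pm0 pp0 !mulr0.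
have s1 : (0 < pr e B + pr (- e) B)%R by rewrite lt_neqAle eq_sym s0 addr_ge0.
rewrite mulrA ler_pdivlMr// /good.
have ee : (e * e = 1)%R by case: e1 => ->; ring.
have -> : (e * (e * pr e B + - e * pr (- e) B) = (e * e) * (pr e B - pr (- e) B))%R by ring.
rewrite ee mul1r; lra.
Qed.

Let good_closed t : (t < r)%R -> good [set y | (nu (y - x) <= t)%R].
Proof.
move=> tr; set B := [set y | _].
(* The closed ball is the decreasing intersection of these open balls, whose radii do not exceed [r]
   because [t < r]. *)
pose u n := (t + (r - t) / n.+1%:R)%R.
have ut n : (t < u n)%R by rewrite ltrDl divr_gt0// subr_gt0.
have ur n : (u n <= r)%R.
  rewrite /u -lerBrDl ler_pdivrMr//; apply: ler_peMr; last by rewrite ler1n.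
  by rewrite subr_ge0 ltW.
pose F n := lab e (norm_ball nu x (u n)).
have mF n : measurable (F n) by apply: mlab; exact: mball.
have BE : B = \bigcap_n norm_ball nu x (u n).
  apply/seteqP; split=> y /=.
    by move=> yt n _; rewrite /norm_ball /=; exact: le_lt_trans (ut n).
  move=> H; rewrite /B /= leNgt; apply/negP => ty.
  pose k := Num.truncn ((r - t) / (nu (y - x) - t)).
  have := H k I; rewrite /norm_ball/= /u -ltrBlDl ltNge => /negP; apply.
  rewrite ler_pdivrMr// mulrC -ler_pdivrMr ?subr_gt0// ltW//.
  exact: truncnS_gt.
have mB : measurable B by rewrite BE; apply: bigcapT_measurable => n; exact: mball.
have FE : lab e B = \bigcap_n F n.
  apply/seteqP; split=> w; rewrite BE.
    by move=> [Bw Yw] n _; split=> //; exact: Bw.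
  move=> H; split; last by have [] := H 0%N I.
  by move=> n _; have [] := H n I.
have Fcvg : (P \o F) n @[n --> \oo] --> P (lab e B).
  rewrite FE; apply: nonincreasing_cvg_mu => //.
  - by rewrite (le_lt_trans (probability_le1 _ _))// ltry.
  - by rewrite -FE; exact: mlab.
  apply/nonincreasing_seqP => n; apply/subsetPset => w [Bw Yw]; split=> //.
  move: Bw; rewrite /norm_ball/= => /lt_le_trans; apply.
  rewrite /u lerD2l; apply: ler_wpM2l; first by rewrite subr_ge0 ltW.
  by rewrite lef_pV2 ?posrE ?ltr0n// ler_nat.
have m1 : (0 < 1 - m)%R by case/andP: m01; lra.
rewrite /good -ler_pdivrMl// -lee_fin (prE _ mB).
rewrite -(cvg_lim _ Fcvg)//; apply: lime_ge; first by apply/cvg_ex; eexists; exact: Fcvg.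
apply: nearW => n /=; rewrite -(prE _ (mball _)) lee_fin.
have := good_open (ur n); rewrite /good => gn.
(* Only the mass on the larger side of [good] needs a limit; for the other label monotonicity is
   enough. *)
have le : (pr (- e) B <= pr (- e) (norm_ball nu x (u n)))%R.
  rewrite -lee_fin !prE//; apply: le_measure; rewrite ?inE.
  - exact: mlab.
  - by apply: mlab; exact: mball.
  by move=> w [Bw Yw]; split=> //; move: Bw; rewrite BE; exact.
rewrite ler_pdivrMl//; apply: le_trans gn; rewrite ler_pM2l//.
by case/andP: m01; lra.
Qed.

(** For a label of mean at least [m], [exp(-t * label)] has mean at most
    [cosh t - m * sinh t]; taking [exp(-t) = 1 - m] makes it [1 - m^2 / 2]. *)
Definition tilt (u : 'rV[R]_d * R) : R := expR (- (- ln (1 - m)) * (e * u.2)).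

Let tilt_good B : measurable B -> good B ->
  \int[mu]_(z in [set z | B z.1]) (tilt z)%:E <=
  (1 - m ^+ 2 / 2)%:E * mu [set z | B z.1].
Proof.
move=> mB gB; have [m0 m1] := andP m01.
have mtilt : measurable_fun setT (fun z => (tilt z)%:E).
  have my : measurable_fun setT (fun z : 'rV[R]_d * R => e * z.2)%R.
    by apply: measurable_funM.
  apply/measurable_EFinP; apply: (measurableT_comp (@measurable_expR R)).
  by apply: measurable_funM.
have mB' : measurable [set z : 'rV[R]_d * R | B z.1].
  by rewrite -[X in measurable X]setTI; exact: measurable_fst.
rewrite ge0_integral_pushforward//; last 2 first.
- exact: measurable_funTS.
- by move=> z _; rewrite lee_fin expR_ge0.
rewrite [leLHS](_ : _ = (expR (ln (1 - m) * (e * e)) * pr e B +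
    expR (ln (1 - m) * (e * - e)) * pr (- e) B)%:E); last first.
  rewrite -(integral_label (fun y => expR (ln (1 - m) * (e * y))%R) mB).
  by apply: eq_integral => w _ /=; rewrite /tilt opprK.
rewrite (_ : mu _ = P [set w | B (Z w).1])// massE//.
rewrite -EFinM lee_fin.
have ee : (e * e = 1)%R by case: e1 => ->; ring.
have -> : (expR (ln (1 - m) * (e * e)) = 1 - m)%R by rewrite ee mulr1 lnK// posrE subr_gt0.
have -> : (expR (ln (1 - m) * (e * - e)) = (1 - m)^-1)%R.
  by rewrite mulrN ee mulrN1 expRN lnK// posrE subr_gt0.
move: gB; rewrite /good; move: (pr_ge0 e B) (pr_ge0 (- e)%R B).
move: (pr e B) (pr _ B) => p p' p0 p'0 gB.
have a0 : (0 < 1 - m)%R by lra.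
(* Cleared of its denominator [1 - m], the claim is exactly [gB] multiplied by this factor. *)
have c0 : (0 <= m * (1 - m / 2))%R by apply: mulr_ge0; lra.
have := ler_wpM2r c0 gB; rewrite -subr_ge0 => H.
rewrite -(ler_pM2r a0) -subr_ge0; apply: le_trans H _.
rewrite le_eqVlt; apply/orP; left; apply/eqP; field.
by rewrite gt_eqF.
Qed.

Lemma tilt_open t : (t <= r)%R ->
  \int[mu]_(z in [set z | (rho_at nu x z < t)%R]) (tilt z)%:E <=
  (1 - m ^+ 2 / 2)%:E * mu [set z | (rho_at nu x z < t)%R].
Proof. by move=> tr; exact: (tilt_good (mball t) (good_open tr)). Qed.

Lemma tilt_closed t : (t < r)%R ->
  \int[mu]_(z in [set z | (rho_at nu x z <= t)%R]) (tilt z)%:E <=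
  (1 - m ^+ 2 / 2)%:E * mu [set z | (rho_at nu x z <= t)%R].
Proof.
move=> tr; apply: (tilt_good _ (good_closed tr)).
rewrite -[X in measurable X]setTI; apply: measurable_fun_ler => //.
exact: measurable_norm_sub.
Qed.

End tilted_ball.

(** * Error probability at a fixed test point *)

Section knn_error.
Local Open Scope ereal_scope.
Context {R : realType} {d : nat} {disp : measure_display}
  {Omega : measurableType disp} {P : probability Omega R}.
Variable Z : {RV P >-> ('rV[R]_d * R)%type}.
Hypothesis Z_label : forall w, (Z w).2 = 1%R \/ (Z w).2 = (-1)%R.
Variables (nu : 'rV[R]_d -> R) (eta : 'rV[R]_d -> R) (K A q : R).
Hypothesis nu_norm : is_norm nu.
Hypotheses (K0 : (0 < K)%R) (q0 : (0 < q)%R).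
Let mu : probability ('rV[R]_d * R)%type R := distribution P Z.

Definition error_prob N (x : 'rV[R]_d) := iid_law mu N
  [set s : N.-tuple ('rV[R]_d * R) | adaptive_knn nu K A q s x != sign_label (eta x)].

Lemma measurable_error N x : measurable
  [set s : N.-tuple ('rV[R]_d * R) | adaptive_knn nu K A q s x != sign_label (eta x)].
Proof.
rewrite -[X in measurable X]setTI.
apply: (measurable_neg (f := fun s : N.-tuple ('rV[R]_d * R) =>
  adaptive_knn nu K A q s x == sign_label (eta x))) => //.
apply: measurable_fun_eqr => //.
exact: (measurableT_comp (@measurable_adaptive_knn _ _ _ nu_norm K A q N) (pair1_measurable x)).
Qed.

Lemma error_prob_le N x (C r : R) (M := (N%:R * mass Z (norm_ball nu x A))%R) :
  (0 < r <= A)%R -> (0 < `|eta x| <= 1)%R ->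
  (forall t, 0 < t -> `|mean_label Z (norm_ball nu x t) - eta x| <= C * t ^+ 2)%R ->
  (0 <= C)%R -> (C * r ^+ 2 <= `|eta x| / 2)%R ->
  (1 <= M)%R ->
  ((K * 4 `^ q + 1) * M `^ q <= N%:R * mass Z (norm_ball nu x r) / 4)%R ->
  error_prob N x <=
  (expR (- (`|eta x| ^+ 2 / 8 * (K * (M / 4) `^ q))) + expR (- (M / 4)) + expR (- M) +
   expR (- (N%:R * mass Z (norm_ball nu x r) / 4)))%:E.
Proof.
move=> /andP[r0 rA] /andP[eta0 eta1] smooth C0 Cr M1 Mr.
set e := sign_label (eta x).
have e1 : e = 1%R \/ e = (-1)%R by exact: sign_labelP.
have ee : (e * eta x = `|eta x|)%R.
  rewrite /e /sign_label; case: leP => h; first by rewrite mul1r ger0_norm.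
  by rewrite mulN1r ltr0_norm.
(* The bias [C r ^ 2] takes at most half of [|eta x|], so the other half is a lower bound for the
   signed mean label on every ball up to [r]. Then [|eta x| <= 1] keeps [m] below 1, and
   [g = m ^ 2 / 2] is [eta ^ 2 / 8]. *)
set m := (`|eta x| / 2)%R.
have m01 : (0 < m < 1)%R by rewrite /m; apply/andP; split; lra.
have mean_ge t : (0 < t <= r)%R -> (m <= e * mean_label Z (norm_ball nu x t))%R.
  move=> /andP[t0 tr]; have := smooth t t0.
  have : (C * t ^+ 2 <= C * r ^+ 2)%R.
    by apply: ler_wpM2l => //; apply: lerXn2r; rewrite ?nnegrE// ltW.
  move=> h1 h2; have := le_trans h2 (le_trans h1 Cr); rewrite ler_norml => /andP[h3 h4].
  have mE : (`|eta x| = m + m)%R by rewrite /m; lra.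
  move: ee h3 h4; rewrite mE -/m; case: e1 => ->; rewrite ?mul1r ?mulN1r; lra.
have [mo mc] := (tilt_open Z_label nu_norm e1 m01 mean_ge,
                 tilt_closed Z_label nu_norm e1 m01 mean_ge).
have mtilt : measurable_fun setT (tilt e m : 'rV[R]_d * R -> R).
  have my : measurable_fun setT (fun z : 'rV[R]_d * R => e * z.2)%R.
    by apply: measurable_funM.
  apply: (measurableT_comp (@measurable_expR R)).
  by apply: measurable_funM.
have t0 (u : 'rV[R]_d * R) : (0 <= tilt e m u)%R by exact: expR_ge0.
have th0 : (0 <= 1 - m ^+ 2 / 2)%R by case/andP: m01 => *; nra.
have thg : (1 - m ^+ 2 / 2 <= expR (- (m ^+ 2 / 2)))%R by exact: expR_ge1Dx.
have g0 : (0 <= m ^+ 2 / 2)%R by rewrite divr_ge0// sqr_ge0.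
have := @vote_error _ _ R mu (rho_at nu x) K q A r (measurable_rho nu_norm x) rA K0 q0
  (tilt e m) _ _ mtilt t0 th0 mo mc g0 thg N M1 Mr.
rewrite (_ : m ^+ 2 / 2 = `|eta x| ^+ 2 / 8)%R; last by rewrite /m; field.
apply: le_trans; apply: le_measure; rewrite ?inE.
- exact: measurable_error.
- rewrite -[X in measurable X]setTI.
  apply: (@measurable_or _ _ setT
    (fun s => ~~ enough (rho_at nu x) (knn_size K q) r A s)
    (fun s => (1 <= vote_weight (rho_at nu x) (knn_size K q) r A (fun=> tilt e m) s)%R)) => //.
    by apply: measurable_neg; apply: measurable_enough; exact: measurable_rho.
  apply: measurable_fun_ler => //.
  by apply: measurable_vote_weight => //; exact: measurable_rho.
move=> s /= /eqP err; have [en/=|//] := boolP (enough _ _ _ _ s).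
have tge : (0 <= - ln (1 - m))%R.
  by rewrite oppr_ge0 ln_le0// gerBl ltW//; case/andP: m01.
exact: (wrong_vote_weight e1 tge err en).
Qed.

End knn_error.

(** * Choice of the radius and of the local scale *)

Lemma expRN_le_pow (R : realType) (y : R) (j : nat) : 0 < y -> (0 < j)%N ->
  expR (- y) <= (j%:R / y) ^+ j.
Proof.
move=> y0 j0; have j0' : 0 < j%:R :> R by rewrite ltr0n.
have h : y / j%:R <= expR (y / j%:R).
  by apply: le_trans (expR_ge1Dx _); rewrite lerDr.
rewrite (_ : y = j%:R * (y / j%:R)); last by field; rewrite gt_eqF.
rewrite -mulrN expRM_natl; apply: lerXn2r; rewrite ?nnegrE ?expR_ge0//.
  by rewrite divr_ge0// ltW// mulr_gt0// divr_gt0.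
rewrite expRN -[leRHS]invrK lef_pV2 ?posrE ?expR_gt0 ?invr_gt0 ?divr_gt0 ?mulr_gt0 ?invr_gt0//.
by apply: le_trans h; rewrite invf_div mulrAC divff ?gt_eqF// mul1r.
Qed.

Section scale.
Context {R : realType}.
Variables (d : nat) (q : R).
Hypotheses (d0 : (0 < d)%N) (q01 : 0 < q < 1).

Lemma knn_lambda_gt0 : 0 < knn_lambda d q.
Proof.
have /andP[q0 q1] := q01; rewrite /knn_lambda lt_min; apply/andP; split.
  by rewrite mulr_gt0// invr_gt0.
by rewrite mulr_gt0 ?subr_gt0// divr_gt0// ltr0n.
Qed.

(** The second argument of [min] is the quantity whose tail is controlled by
    [adaptive_tail_condition]. *)
Definition scale (F p : R) : R := Num.min F ((F / p `^ q) `^ (1 - q)^-1).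

(** The radius must be large enough to hold more than [k] points and small enough for the bias. It
    is the smallest one allowed by the count: [r ^ d = kap (n p) ^ q / (n F)], which equals
    [kap (n t) ^ (- (1 - q))] for the second argument [t] of [scale]. *)
Lemma scale_radius (K k1 r0 : R) : 0 < K -> 0 < k1 -> 0 < r0 ->
  exists C L : R, [/\ 0 < C, 1 <= L & forall n F p : R,
    1 <= n -> 0 < F -> 0 < p -> k1 * F * r0 ^+ d <= p -> L <= n * scale F p ->
    exists r : R, [/\ 0 < r <= r0, r ^+ 2 <= C * (n * scale F p) `^ (- knn_lambda d q),
      (K * 4 `^ q + 1) * (n * p) `^ q <= n * (k1 * F * r ^+ d) / 4,
      1 <= n * p & k1 * r0 ^+ d * (n * scale F p) <= n * p]].
Proof.
move=> K0 k10 r00; have /andP[q0 q1] := q01.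
have dR : 0 < d%:R :> R by rewrite ltr0n.
have q1' : 0 < 1 - q by rewrite subr_gt0.
(* Chosen so that the mass requirement on [r] holds with equality. *)
pose kap := 4 * (K * 4 `^ q + 1) / k1.
have kap0 : 0 < kap.
  by rewrite divr_gt0// mulr_gt0// ltr_wpDl// mulr_ge0 ?powR_ge0// ltW.
pose c1 := k1 * r0 ^+ d.
have c10 : 0 < c1 by rewrite mulr_gt0// exprn_gt0.
(* The three thresholds give in turn [U >= 1], for comparing powers of [U]; [n p >= 1]; and
   [r <= r0]. *)
pose L := Num.max 1 (Num.max c1^-1 ((kap / r0 ^+ d) `^ (1 - q)^-1)).
exists (kap `^ (2 / d%:R)), L; split; first exact: powR_gt0.
  by rewrite le_max lexx.
move=> n F p n1 F0 p0 Fp; set u := scale F p; set U := n * u => LU.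
have n0 : 0 < n by lra.
have [L1 L2 L3] : [/\ 1 <= U, c1^-1 <= U & (kap / r0 ^+ d) `^ (1 - q)^-1 <= U].
  by split; apply: le_trans LU; rewrite !le_max lexx ?orbT.
set t := (F / p `^ q) `^ (1 - q)^-1.
have pq0 : 0 < p `^ q by exact: powR_gt0.
have t0 : 0 < t by rewrite powR_gt0// divr_gt0.
have tq : t `^ (1 - q) = F / p `^ q.
  by rewrite -powRrM mulVf ?gt_eqF// powRr1// ltW// divr_gt0.
have uF : u <= F by rewrite ge_min lexx.
have ut : u <= t by rewrite ge_min lexx orbT.
have Unt : U <= n * t by rewrite ler_pM2l.
have UF : U <= n * F by rewrite ler_pM2l.
have nt0 : 0 < n * t by rewrite mulr_gt0.
pose y := kap * (n * t) `^ (- (1 - q)).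
have y0 : 0 < y by rewrite mulr_gt0// powR_gt0.
pose r := y `^ d%:R^-1.
have rd : r ^+ d = y.
  by rewrite -powR_mulrn ?powR_ge0// -powRrM mulVf ?gt_eqF// powRr1// ltW.
have r0' : 0 < r by exact: powR_gt0.
have ntq : (n * t) `^ (- (1 - q)) = (n `^ (1 - q) * (F / p `^ q))^-1.
  by rewrite powRN powRM ?tq// ltW.
have c1p : c1 * U <= n * p.
  apply: (@le_trans _ _ (n * (k1 * F * r0 ^+ d))); last by rewrite ler_pM2l.
  rewrite (_ : n * _ = c1 * (n * F)); last by rewrite /c1; ring.
  by rewrite ler_pM2l.
exists r; split => //.
- rewrite r0'/= -(@ler_pXn2r _ d) ?nnegrE ?(ltW r0') ?(ltW r00)// rd /y powRN.
  have ntq0 : 0 < (n * t) `^ (1 - q) by exact: powR_gt0.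
  have r0d : 0 < r0 ^+ d by exact: exprn_gt0.
  rewrite (ler_pdivrMr _ _ ntq0) mulrC -(ler_pdivrMr _ _ r0d).
  apply: (@le_trans _ _ (((kap / r0 ^+ d) `^ (1 - q)^-1) `^ (1 - q))).
    by rewrite -powRrM mulVf ?gt_eqF// powRr1// divr_ge0 ?exprn_ge0// ltW.
  apply: ge0_ler_powR; rewrite ?nnegrE ?powR_ge0 ?(ltW q1') ?(ltW nt0)//.
  exact: le_trans Unt.
- rewrite -powR_mulrn ?(ltW r0')// /r -powRrM /y.
  rewrite (mulrC d%:R^-1) powRM ?powR_ge0 ?(ltW kap0)// ler_pM2l ?powR_gt0//.
  rewrite -powRrM; set a := _ * (2 / d%:R).
  have aE : a = - (2 / d%:R * (1 - q)) by rewrite /a; ring.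
  have U0 : 0 < U by lra.
  have Ub0 : 0 < U `^ knn_lambda d q by exact: powR_gt0.
  have ntb0 : 0 < (n * t) `^ (2 / d%:R * (1 - q)) by exact: powR_gt0.
  rewrite aE !powRN lef_pV2 ?posrE; [|exact: ntb0|exact: Ub0].
  apply: (@le_trans _ _ (U `^ (2 / d%:R * (1 - q)))).
    by apply: ler_powR => //; rewrite /knn_lambda ge_min lexx orbT.
  apply: ge0_ler_powR; rewrite ?nnegrE//; first by rewrite mulr_ge0 ?divr_ge0// ltW.
  + by lra.
  + exact: ltW.
- rewrite rd /y ntq.
  have nq : n = n `^ q * n `^ (1 - q).
    rewrite -powRD; last by rewrite (gt_eqF n0) implybT.
    by rewrite addrC subrK powRr1// ltW.
  have n1q0 : 0 < n `^ (1 - q) by exact: powR_gt0.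
  rewrite powRM ?(ltW n0) ?(ltW p0)// {2}nq le_eqVlt; apply/orP; left; apply/eqP.
  by rewrite /kap; field; rewrite !gt_eqF.
- apply: le_trans c1p; have := L2; rewrite -(@ler_pM2l _ c1)// divff ?gt_eqF//.
Qed.

End scale.

(** * Pointwise decay of the error probability *)

(** Polynomial decay capped at 1, the trivial bound on a probability when the scale is small; [k] is
    later taken larger than [beta], to be integrable against the tail of [U]. *)
Definition inv_pow {R : realType} (k : nat) (y : R) : R := Num.min 1 (y ^- k).

Lemma inv_pow_gt0 (R : realType) k (y : R) : 0 < y -> 0 < inv_pow k y.
Proof. by move=> y0; rewrite lt_min ltr01 invr_gt0 exprn_gt0. Qed.

Section decay.
Context {R : realType} {d : nat} {disp : measure_display}
  {Omega : measurableType disp} {P : probability Omega R}.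
Variable Z : {RV P >-> ('rV[R]_d * R)%type}.
Hypothesis Z_label : forall w, (Z w).2 = 1 \/ (Z w).2 = -1.
Variables (nu : 'rV[R]_d -> R) (f eta : 'rV[R]_d -> R) (K A q : R).
Hypothesis d0 : (0 < d)%N.
Hypothesis nu_norm : is_norm nu.
Hypotheses (K0 : 0 < K) (A0 : 0 < A) (q01 : 0 < q < 1).
Hypothesis cond_c : smooth_condition nu Z f eta.
Hypothesis cond_d : min_mass_condition nu Z f.

Let lambda := knn_lambda d q.

Definition local_scale x := scale q (f x) (mass Z (norm_ball nu x A)).

Definition scaled (N : nat) x : R := N%:R * local_scale x.

Lemma massK (B : set 'rV[R]_d) : measurable B ->
  (mass Z B)%:E = P [set w | B (Z w).1].
Proof. by move=> mB; rewrite fineK// fin_num_measure//; exact: measurable_preX. Qed.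

Lemma mass_ball_mono x s t : s <= t ->
  mass Z (norm_ball nu x s) <= mass Z (norm_ball nu x t).
Proof.
move=> st; have ms := measurable_norm_ball nu_norm x s; have mt := measurable_norm_ball nu_norm x t.
rewrite -lee_fin !massK//; apply: le_measure; rewrite ?inE.
- exact: measurable_preX.
- exact: measurable_preX.
by move=> w /= /lt_le_trans; apply.
Qed.

Lemma mass_lower : exists k D : R, [/\ 0 < k, 0 < D & forall x r, 0 < f x ->
  0 < r <= D -> k * f x * r ^+ d <= mass Z (norm_ball nu x r)].
Proof.
have [C [D [C0 D0 H]]] := cond_d; have c0 := norm_const_gt0 nu_norm.
(* The volume of the inscribed cube enters the constant; halving [D] turns the strict bound on the
   radius into a weak one. *)
exists (C * (2 / norm_const nu) ^+ d), (D / 2); split => [||x r fx /andP[r0 rD]].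
- by rewrite mulr_gt0// exprn_gt0// divr_gt0.
- by rewrite divr_gt0.
have mB := measurable_norm_ball nu_norm x r.
have rD' : 0 < r < D by rewrite r0/=; lra.
rewrite -lee_fin massK//; apply: le_trans (H x r rD').
apply: (@le_trans _ _ ((C * f x)%:E * ((2 * (r / norm_const nu)) ^+ d)%:E)%E).
  rewrite -EFinM lee_fin le_eqVlt; apply/orP; left; apply/eqP.
  by rewrite !exprMn; ring.
apply: lee_wpmul2l; first by rewrite lee_fin mulr_ge0// ltW.
exact: lebesgue_norm_ball.
Qed.

Lemma scaled_gt0 (N : nat) x : (0 < N)%N -> 0 < f x -> 0 < scaled N x.
Proof.
move=> N0 fx; have [k1 [D [k10 D0 mlow]]] := mass_lower.
have r00 : 0 < Num.min A D by rewrite lt_min A0.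
have rA : Num.min A D <= A by rewrite ge_min lexx.
have rD : Num.min A D <= D by rewrite ge_min lexx orbT.
have p0 : 0 < mass Z (norm_ball nu x A).
  apply: lt_le_trans (mass_ball_mono x rA).
  apply: lt_le_trans (mlow x _ fx _); last by rewrite r00.
  by rewrite !mulr_gt0// exprn_gt0.
by rewrite mulr_gt0 ?ltr0n// lt_min fx powR_gt0// divr_gt0// powR_gt0.
Qed.

(** The trivial bound 1 covers two regimes: for [U < L] the term [inv_pow] is bounded below, and for
    [|eta|] below [c3 U ^ (- lambda)] the exponential is. In the remaining one the radius of
    [scale_radius] has bias at most [|eta| / 2]. *)
Lemma error_prob_decay (k : nat) : exists c C : R, [/\ 0 < c, 0 < C &
  forall (N : nat) x, (0 < N)%N -> 0 < f x -> 0 < `|eta x| <= 1 ->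
    (error_prob Z nu eta K A q N x <=
    (C * (expR (- (c * (`|eta x| * scaled N x `^ lambda) ^+ 2)) *
            (1 <= scaled N x)%R%:R + inv_pow k (scaled N x)))%:E)%E].
Proof.
have /andP[q0 q1] := q01.
have [k1 [D [k10 D0 mlow]]] := mass_lower.
have [Cs smooth] := cond_c.
pose r0 := Num.min A D.
have r00 : 0 < r0 by rewrite lt_min A0.
have [C1 [L [C10 L1 HL]]] := scale_radius d0 q01 K0 k10 r00.
pose C2 := `|Cs|.
have C20 : 0 <= C2 by rewrite /C2 normr_ge0.
(* [C2 r ^ 2 <= C2 C1 U ^ (- lambda)] is to be at most [|eta| / 2]. *)
pose c3 := 2 * C2 * C1.
have c30 : 0 <= c3 by rewrite !mulr_ge0 ?normr_ge0 ?(ltW C10).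
pose c1 := k1 * r0 ^+ d.
have c10 : 0 < c1 by rewrite mulr_gt0// exprn_gt0.
pose c := K * (c1 / 4) `^ q / 8.
have c0 : 0 < c by rewrite divr_gt0// mulr_gt0// powR_gt0// divr_gt0.
pose c4 := c1 `^ q / 4.
have c40 : 0 < c4 by rewrite divr_gt0// powR_gt0.
(* The three count tails have exponents of at least [c4 U ^ q]; bounding [exp (- y)] by a power of
   order [j] then gives [U ^ (- q j)], at most [U ^ (- k)]. *)
have [j [j0 jk]] : exists j : nat, (0 < j)%N /\ k%:R <= q * j%:R.
  exists (Num.truncn (k%:R / q)).+1; split=> //.
  by rewrite mulrC -ler_pdivrMr// ltW// truncnS_gt.
pose C5 := (j%:R / c4) ^+ j.
have C50 : 0 <= C5 by rewrite exprn_ge0// divr_ge0// ltW.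
pose C := expR (c * c3 ^+ 2) + 1 + 3 * C5 + L ^+ k.
have L0 : 0 < L by lra.
have Lk0 : 0 < L ^+ k by rewrite exprn_gt0.
have e0 : 0 < expR (c * c3 ^+ 2) by exact: expR_gt0.
have C0 : 0 < C by rewrite /C; lra.
exists c, C; split; [exact: c0|exact: C0|move=> N x N0 fx /andP[eta0 eta1]].
set U := scaled N x.
have n1 : 1 <= N%:R :> R by rewrite ler1n.
have n0 : 0 < N%:R :> R by rewrite ltr0n.
have r0A : r0 <= A by rewrite ge_min lexx.
have r0D : r0 <= D by rewrite ge_min lexx orbT.
set p := mass Z (norm_ball nu x A).
have Fp : k1 * f x * r0 ^+ d <= p.
  by apply: le_trans (mlow x r0 fx _) (mass_ball_mono x r0A); rewrite r00.
have p0 : 0 < p by apply: lt_le_trans Fp; rewrite !mulr_gt0// exprn_gt0.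
have U0 : 0 < U by exact: scaled_gt0.
have err1 : (error_prob Z nu eta K A q N x <= 1)%E.
  by apply: probability_le1; exact: measurable_error.
have psi0 := inv_pow_gt0 k U0.
have [UL|LU] := ltP U L.
  apply: (le_trans err1); rewrite lee_fin.
  have h1 : 1 <= L ^+ k * inv_pow k U.
    rewrite /inv_pow minr_pMr ?(ltW Lk0)// mulr1 le_min exprn_ege1//=.
    by rewrite ler_pdivlMr ?exprn_gt0// mul1r lerXn2r ?nnegrE ?(ltW U0) ?(ltW L0) ?(ltW UL).
  have h2 : 0 <= expR (- (c * (`|eta x| * U `^ lambda) ^+ 2)) * (1 <= U)%R%:R.
    by rewrite mulr_ge0// expR_ge0.
  have h3 : L ^+ k <= C by rewrite /C; lra.
  apply: (le_trans h1); apply: ler_pM => //; [exact: ltW|exact: ltW|].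
  by rewrite lerDr.
have U1 : 1 <= U by exact: le_trans LU.
have psiE : inv_pow k U = U ^- k.
  by rewrite /inv_pow; apply/min_idPr; rewrite invf_le1 ?exprn_gt0// exprn_ege1.
have Ul0 : 0 < U `^ lambda by exact: powR_gt0.
have [r [/andP[r0' rr0] rC rm M1 c1U]] := HL N%:R (f x) p n1 fx p0 Fp LU.
rewrite U1 mulr1.
have [small|big] := ltP (`|eta x|) (c3 * U `^ (- lambda)).
  apply: (le_trans err1); rewrite lee_fin.
  have h : expR (c * c3 ^+ 2) * expR (- (c * (`|eta x| * U `^ lambda) ^+ 2)) >= 1.
    rewrite -expRD -[leLHS]expR0 ler_expR -mulrBr mulr_ge0 ?(ltW c0)// subr_ge0.
    apply: lerXn2r; [by rewrite nnegrE mulr_ge0// powR_ge0|by []|].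
    by move: small; rewrite powRN ltr_pdivlMr// => /ltW.
  apply: (le_trans h); rewrite mulrDr -[leLHS]addr0 lerD ?mulr_ge0 ?(ltW C0) ?(ltW psi0)//.
  by rewrite ler_pM2r ?expR_gt0// /C; lra.
set M := N%:R * p in M1 c1U rm.
have r2 : C2 * r ^+ 2 <= `|eta x| / 2.
  apply: (@le_trans _ _ (C2 * (C1 * U `^ (- lambda)))); first by rewrite ler_wpM2l.
  rewrite ler_pdivlMr//; apply: le_trans big.
  by rewrite /c3 le_eqVlt; apply/orP; left; apply/eqP; ring.
have smooth' t : 0 < t -> `|mean_label Z (norm_ball nu x t) - eta x| <= C2 * t ^+ 2.
  move=> t0; apply: le_trans (smooth t x t0 _) _.
    by apply: subset_closure => /=; rewrite gt_eqF.
  by rewrite ler_wpM2r ?sqr_ge0// ler_norm.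
have mr : k1 * f x * r ^+ d <= mass Z (norm_ball nu x r).
  by apply: mlow; rewrite // r0' (le_trans rr0).
have nmr : (K * 4 `^ q + 1) * M `^ q <= N%:R * mass Z (norm_ball nu x r) / 4.
  by apply: le_trans rm _; rewrite ler_pM2r ?invr_gt0// ler_pM2l.
have rA : 0 < r <= A by rewrite r0' (le_trans rr0).
have eta01 : 0 < `|eta x| <= 1 by rewrite eta0.
apply: (le_trans (error_prob_le Z_label nu_norm K0 q0 rA eta01 smooth' (normr_ge0 _) r2 M1 nmr)).
rewrite lee_fin -/M.
have Mq : c1 `^ q * U `^ q <= M `^ q.
  rewrite -powRM ?(ltW c10) ?(ltW U0)//.
  apply: ge0_ler_powR; rewrite ?nnegrE ?(ltW q0)//; last by lra.
  by rewrite mulr_ge0// ltW.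
have Mq' : M `^ q <= M by apply: ler1_powR => //; exact: ltW.
have e1 : expR (- (`|eta x| ^+ 2 / 8 * (K * (M / 4) `^ q))) <=
    expR (- (c * (`|eta x| * U `^ lambda) ^+ 2)).
  rewrite ler_expR lerN2 exprMn /c.
  (* Here the bound [lambda <= q / 2] enters; the other bound on [lambda] was spent on the
     radius. *)
  have h1 : (U `^ lambda) ^+ 2 <= U `^ q.
    rewrite -powR_mulrn ?powR_ge0// -powRrM; apply: ler_powR => //.
    rewrite -ler_pdivlMr// mulrC /lambda /knn_lambda ge_min lexx//.
  have h2 : (c1 / 4) `^ q * U `^ q <= (M / 4) `^ q.
    rewrite -powRM ?(ltW U0) ?divr_ge0 ?(ltW c10)//.
    apply: ge0_ler_powR; rewrite ?nnegrE ?(ltW q0)//.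
    + by rewrite mulr_ge0 ?divr_ge0 ?(ltW c10) ?(ltW U0).
    + by rewrite divr_ge0//; lra.
    + by rewrite mulrAC ler_pM2r ?invr_gt0.
  rewrite [leRHS](_ : _ = K / 8 * `|eta x| ^+ 2 * (M / 4) `^ q); last by ring.
  rewrite [leLHS](_ : _ = K / 8 * `|eta x| ^+ 2 *
    ((c1 / 4) `^ q * (U `^ lambda) ^+ 2)); last by ring.
  apply: ler_wpM2l; first by rewrite mulr_ge0 ?divr_ge0 ?sqr_ge0// ltW.
  by apply: le_trans h2; rewrite ler_wpM2l// powR_ge0.
have e2 y : c4 * U `^ q <= y -> expR (- y) <= C5 * U ^- k.
  move=> cy; apply: (@le_trans _ _ (expR (- (c4 * U `^ q)))).
    by rewrite ler_expR lerN2.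
  have cU0 : 0 < c4 * U `^ q by rewrite mulr_gt0// powR_gt0.
  apply: (le_trans (expRN_le_pow cU0 j0)).
  rewrite invfM mulrA exprMn -/C5 ler_wpM2l// exprVn lef_pV2 ?posrE ?exprn_gt0 ?powR_gt0//.
  rewrite -powR_mulrn ?(ltW U0)// -powR_mulrn ?powR_ge0// -powRrM.
  exact: ler_powR.
have f1 : expR (- (M / 4)) <= C5 * U ^- k.
  by apply: e2; rewrite /c4; lra.
have f2 : expR (- M) <= C5 * U ^- k.
  by apply: e2; rewrite /c4; lra.
have f3 : expR (- (N%:R * mass Z (norm_ball nu x r) / 4)) <= C5 * U ^- k.
  apply: e2; apply: le_trans nmr; rewrite /c4 mulrDl mul1r.
  have : 0 <= K * 4 `^ q * M `^ q by rewrite !mulr_ge0 ?powR_ge0// ltW.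
  have : 0 <= M `^ q by exact: powR_ge0.
  lra.
rewrite psiE; set E := expR (- (c * _)) in e1 *.
have E0 : 0 <= E by exact: expR_ge0.
have Uk0 : 0 <= U ^- k by rewrite invr_ge0 exprn_ge0// ltW.
have g1 : E <= C * E by rewrite ler_peMl// /C; lra.
have g2 : 3 * C5 * U ^- k <= C * U ^- k by rewrite ler_wpM2r// /C; lra.
lra.
Qed.

End decay.

(** * Dyadic integration *)

(** At [t = h U ^ lambda] it says that loss times error bound is at most of order [U ^ (- lambda)],
    whatever the loss [h]. *)
Lemma gauss_le_inv_pow (R : realType) (c : R) (k : nat) : 0 < c ->
  exists2 C : R, 0 < C &
    forall t, 0 < t -> t * expR (- (c * t ^+ 2)) <= C * inv_pow k t.
Proof.
move=> c0; pose j := k.+1; pose C := 1 + (j%:R / c) ^+ j.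
have j0 : 0 < (j%:R / c) ^+ j by rewrite exprn_gt0// divr_gt0// ltr0n.
exists C => [|t t0]; first by rewrite /C; lra.
have C1 : 1 <= C by rewrite /C; lra.
have tk0 : 0 < t ^- k by rewrite invr_gt0 exprn_gt0.
have [t1|t1] := leP t 1.
  rewrite /inv_pow (min_idPl _); last by rewrite invf_ge1 ?exprn_gt0// exprn_ile1// ltW.
  rewrite mulr1; apply: le_trans C1; rewrite -[leRHS]mulr1.
  apply: ler_pM; [exact: ltW|exact: expR_ge0|exact: t1|].
  by rewrite -expR0 ler_expR oppr_le0 mulr_ge0 ?sqr_ge0// ltW.
have t1' := ltW t1.
rewrite /inv_pow (min_idPr _); last by rewrite invf_le1 ?exprn_gt0// exprn_ege1.
have ct0 : 0 < c * t ^+ 2 by rewrite mulr_gt0// exprn_gt0.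
have := expRN_le_pow ct0 (ltn0Sn k); rewrite -/j => h.
apply: (@le_trans _ _ (t * (j%:R / (c * t ^+ 2)) ^+ j)); first by rewrite ler_pM2l.
rewrite invfM mulrA exprMn mulrCA.
apply: (@le_trans _ _ ((j%:R / c) ^+ j * t ^- k)); last first.
  by rewrite ler_pM2r// /C; lra.
rewrite ler_pM2l// exprVn -exprM ler_pdivrMr ?exprn_gt0//.
rewrite mulrC -ler_pdivrMr ?invr_gt0 ?exprn_gt0// invrK -exprS.
by apply: ler_weXn2l => //; rewrite /j mul2n -addnn leq_addr.
Qed.

Section dyadic.
Context {R : realType} d (Omega : measurableType d) (P : probability Omega R).

Lemma integral_le_steps (g : Omega -> R) (n : nat) (E : 'I_n -> set Omega)
    (c b : 'I_n -> R) (c0 : R) : measurable_fun setT g -> (forall w, 0 <= g w) ->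
  (forall i, measurable (E i)) -> (forall i, 0 <= c i) -> 0 <= c0 ->
  (forall i, P (E i) <= (b i)%:E)%E ->
  (forall w, g w <= c0 + \sum_(i < n) c i * \1_(E i) w) ->
  (\int[P]_w (g w)%:E <= (c0 + \sum_(i < n) c i * b i)%:E)%E.
Proof.
move=> mg g0 mE cge0 c00 Eb gle.
have mi i : measurable_fun setT (\1_(E i) : Omega -> R) by exact/measurable_indicP.
have mci i : measurable_fun setT (fun w => (c i * \1_(E i) w)%:E).
  by apply/measurable_EFinP; apply: measurable_funM.
have s0 w : 0 <= \sum_(i < n) c i * (\1_(E i) w : R).
  by apply: sumr_ge0 => i _; rewrite mulr_ge0.
apply: (@le_trans _ _ (\int[P]_w (c0 + \sum_(i < n) c i * \1_(E i) w)%:E)%E).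
  have mh : measurable_fun setT (fun w => (c0 + \sum_(i < n) c i * \1_(E i) w)%:E).
    apply/measurable_EFinP; apply: measurable_funD => //.
    by apply: measurable_sum => i; apply: measurable_funM.
  apply: ge0_le_integral => //.
  - by move=> w _; rewrite lee_fin.
  - exact/measurable_EFinP.
  - by move=> w _; rewrite lee_fin.
under eq_integral do rewrite EFinD -sumEFin.
have ms : measurable_fun setT (fun w => (\sum_(i < n) (c i * \1_(E i) w)%:E)%E).
  by apply: emeasurable_sum => i.
have es0 w : [set: Omega] w -> (0 <= \sum_(i < n) (c i * \1_(E i) w)%:E)%E.
  by move=> _; rewrite sumEFin lee_fin.
rewrite ge0_integralD//.
rewrite integral_cst// [X in (_ * X)%E](_ : _ = 1%E); last exact: probability_setT.
rewrite mule1 EFinD; apply: leeD2l.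
rewrite ge0_integral_sum//; last by move=> i w _; rewrite lee_fin mulr_ge0.
rewrite -sumEFin; apply: lee_sum => i _.
under eq_integral do rewrite EFinM.
have mii : measurable_fun setT (fun w => (\1_(E i) w : R)%:E) by exact/measurable_EFinP.
have ii0 w : [set: Omega] w -> (0 <= (\1_(E i) w : R)%:E)%E by move=> _; rewrite lee_fin.
have ci0 : (0 <= (c i)%:E)%E by rewrite lee_fin.
rewrite ge0_integralZl//.
rewrite integral_indic// setIT EFinM.
by apply: lee_wpmul2l => //; exact: Eb.
Qed.

Lemma sum_half_le (n : nat) : \sum_(i < n) (2^-1 : R) ^+ i <= 2.
Proof.
have H : \sum_(i < n) (2^-1 : R) ^+ i = 2 - 2 * 2^-1 ^+ n.
  elim: n => [|n IHn]; first by rewrite big_ord0 expr0; lra.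
  by rewrite big_ord_recr/= IHn exprS; lra.
by rewrite H gerBl mulr_ge0// exprn_ge0.
Qed.

(** On the shell between [2 ^ i] and [2 ^ (i + 1)] the function is at most its value at the left
    end. Stopping at [n], with a remainder for larger [y], keeps the sum finite. *)
Lemma inv_pow_dyadic (k n : nat) (y : R) : 0 < y ->
  inv_pow k y <= (y <= 1)%R%:R +
    \sum_(i < n) (2 ^+ i) ^- k * (y <= 2 ^+ i.+1)%R%:R + (2 ^+ n) ^- k.
Proof.
move=> y0.
have p2 m : 0 < 2 ^+ m :> R by exact: exprn_gt0.
have p2k m : 0 <= (2 ^+ m) ^- k :> R by rewrite invr_ge0 exprn_ge0// ltW.
elim: n => [|n IHn].
  rewrite big_ord0 addr0 expr0 expr1n invr1.
  by apply: (@le_trans _ _ 1); [rewrite ge_min lexx|rewrite lerDr].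
rewrite big_ord_recr/=; have [yn|yn] := leP y (2 ^+ n.+1).
  by apply: le_trans IHn _; rewrite mulr1 addrA lerDl.
apply: (@le_trans _ _ ((2 ^+ n.+1) ^- k)).
  rewrite /inv_pow ge_min; apply/orP; right.
  rewrite lef_pV2 ?posrE ?exprn_gt0//; apply: lerXn2r; rewrite ?nnegrE ?ltW//.
by rewrite mulr0 addr0 lerDr addr_ge0// sumr_ge0// => i _; rewrite mulr_ge0.
Qed.

Lemma measurable_inv_pow (V : Omega -> R) k : measurable_fun setT V ->
  measurable_fun setT (fun w => inv_pow k (V w) * (0 < V w)%R%:R).
Proof.
move=> mV.
rewrite (_ : (fun w => _) =
    fun w => if 0 < V w then Num.min 1 (V w `^ (- k%:R)) else 0).
  apply: measurable_fun_ifT => //; first exact: measurable_fun_ltr.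
  apply: measurable_minr => //.
  have mp := measurableT_comp (@measurable_powR R (- k%:R)) mV.
  exact: mp.
apply/funext => w; rewrite /inv_pow; case: ltP => [v0|_]; rewrite ?mulr0//.
by rewrite mulr1 powR_invn// ltW.
Qed.

Lemma inv_pow_ind_ge0 k (y : R) : 0 <= inv_pow k y * (0 < y)%R%:R.
Proof.
case: ltP => [y0|_]; last by rewrite mulr0.
by rewrite mulr1 ltW// inv_pow_gt0.
Qed.

(** A shell contributes at most [2 ^ (- i k) B 2 ^ ((i + 1) a)], and [a + 1 <= k] makes this
    [B 2 ^ a 2 ^ (- i)] at most. The remaining 2 in the bound counts the region below 1 and the
    remainder. *)
Lemma integral_inv_pow (V : Omega -> R) (B a : R) (k : nat) :
  measurable_fun setT V -> 0 < B -> 0 < a -> a + 1 <= k%:R ->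
  (forall t : R, (0 < t)%R -> P [set w | (0 < V w <= t)%R] <= (B * t `^ a)%:E)%E ->
  (\int[P]_w (inv_pow k (V w) * (0 < V w)%R%:R)%:E <=
   (B * (2 + 2 * 2 `^ a))%:E)%E.
Proof.
move=> mV B0 a0 ak HV.
pose g w := inv_pow k (V w) * (0 < V w)%R%:R.
have k0 : (0 < k)%N by rewrite -(ltr0n R); lra.
have mset (t : R) : measurable [set w | (0 < V w <= t)%R].
  rewrite -[X in measurable X]setTI.
  apply: (@measurable_and _ _ setT (fun w => 0 < V w) (fun w => V w <= t)) => //.
    exact: measurable_fun_ltr.
  exact: measurable_fun_ler.
have mg : measurable_fun setT g by exact: measurable_inv_pow.
have g0 w : 0 <= g w by exact: inv_pow_ind_ge0.
pose E (t : R) := [set w | (0 < V w <= t)%R].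
have p2 m : 0 < 2 ^+ m :> R by exact: exprn_gt0.
(* The remainder of the dyadic majorant is made no larger than [B], so that the whole bound is
   linear in [B]. *)
have [n nB] : exists n : nat, (2 ^+ n) ^- k <= B.
  pose n := (Num.truncn B^-1).+1; exists n.
  rewrite -[leRHS]invrK lef_pV2 ?posrE ?exprn_gt0 ?invr_gt0//.
  apply: (@le_trans _ _ n%:R); first exact/ltW/truncnS_gt.
  apply: (@le_trans _ _ (2 ^+ n)); first by rewrite -natrX ler_nat ltnW// ltn_expl.
  rewrite -exprM; apply: ler_weXn2l; first by lra.
  by rewrite leq_pmulr.
pose F (i : 'I_n.+1) := if val i is i'.+1 then E (2 ^+ i'.+1) else E 1.
pose c (i : 'I_n.+1) : R := if val i is i'.+1 then (2 ^+ i') ^- k else 1.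
pose b (i : 'I_n.+1) : R := if val i is i'.+1 then B * (2 ^+ i'.+1) `^ a else B.
have main : (\int[P]_w (g w)%:E <= ((2 ^+ n) ^- k + \sum_(i < n.+1) c i * b i)%:E)%E.
  apply: (@integral_le_steps g n.+1 F) => //.
  - by case=> -[|i] hi; exact: mset.
  - by case=> -[|i] hi; rewrite /c//= invr_ge0 exprn_ge0// ltW.
  - case=> -[|i] hi; rewrite /F /b/=; last exact: HV.
    by apply: (le_trans (HV 1 ltr01)); rewrite powR1 mulr1.
  move=> w; rewrite big_ord_recl /F /c /= mul1r.
  have iE t : \1_(E t) w = (0 < V w <= t)%R%:R :> R.
    exact: (@indic_bool _ R (fun w => (0 < V w <= t)%R)).
  rewrite /g; case: ltP => [v0|v0].
    rewrite mulr1; apply: (le_trans (inv_pow_dyadic k n v0)).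
    rewrite addrC lerD2l iE v0/= lerD2l; apply: ler_sum => i _.
    by rewrite add0n iE v0.
  by rewrite mulr0 addr_ge0 ?addr_ge0 ?sumr_ge0.
apply: (le_trans main); rewrite lee_fin big_ord_recl /c /b/= mul1r.
have bound i : (2 ^+ i) ^- k * (B * (2 ^+ i.+1) `^ a) <= B * 2 `^ a * 2^-1 ^+ i.
  have x1 : 1 <= 2 ^+ i :> R by rewrite exprn_ege1// ler1n.
  have kE : k = k.-1.+1 by rewrite prednK.
  have h : (2 ^+ i) `^ a <= (2 ^+ i) ^+ k.-1 :> R.
    rewrite -[leRHS]powR_mulrn; last by rewrite exprn_ge0.
    by apply: ler_powR => //; rewrite -lerBDr in ak; apply: le_trans ak _;
      rewrite {1}kE -natr1 addrK.
  rewrite exprS powRM ?exprn_ge0// exprVn.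
  rewrite (_ : (2 ^+ i) ^- k * _ = B * 2 `^ a * ((2 ^+ i) ^- k * (2 ^+ i) `^ a)); last by ring.
  apply: ler_wpM2l; first by rewrite mulr_ge0 ?powR_ge0// ltW.
  rewrite mulrC ler_pdivrMr ?exprn_gt0//; apply: (le_trans h).
  rewrite {2}kE exprS mulrA mulVf ?mul1r// gt_eqF//.
apply: (@le_trans _ _ (B + (B + \sum_(i < n) B * 2 `^ a * 2^-1 ^+ i))).
  by rewrite lerD// lerD2l; apply: ler_sum => i _; rewrite add0n; exact: bound.
rewrite -mulr_sumr; have := sum_half_le n.
have Ba0 : 0 <= B * 2 `^ a by rewrite mulr_ge0 ?powR_ge0// ltW.
move=> /(ler_wpM2l Ba0); lra.
Qed.

End dyadic.

Section margin_integral.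
Context {R : realType} d (Omega : measurableType d) (P : probability Omega R).

Lemma integral_le_add (g h : Omega -> R) (a b : R) :
  measurable_fun setT g -> measurable_fun setT h ->
  (forall w, 0 <= g w) -> (forall w, 0 <= h w) ->
  (\int[P]_w (g w)%:E <= a%:E)%E -> (\int[P]_w (h w)%:E <= b%:E)%E ->
  (\int[P]_w (g w + h w)%:E <= (a + b)%:E)%E.
Proof.
move=> mg mh g0 h0 ga hb; under eq_integral do rewrite EFinD.
have mg' : measurable_fun setT (fun w => (g w)%:E) by exact/measurable_EFinP.
have mh' : measurable_fun setT (fun w => (h w)%:E) by exact/measurable_EFinP.
have g0' w : [set: Omega] w -> (0 <= (g w)%:E)%E by rewrite lee_fin.
have h0' w : [set: Omega] w -> (0 <= (h w)%:E)%E by rewrite lee_fin.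
by rewrite ge0_integralD// EFinD leeD.
Qed.

Lemma integral_le_scale (g : Omega -> R) (k a : R) :
  measurable_fun setT g -> (forall w, 0 <= g w) -> 0 <= k ->
  (\int[P]_w (g w)%:E <= a%:E)%E -> (\int[P]_w (k * g w)%:E <= (k * a)%:E)%E.
Proof.
move=> mg g0 k0 ga; under eq_integral do rewrite EFinM.
have mg' : measurable_fun setT (fun w => (g w)%:E) by exact/measurable_EFinP.
have g0' w : [set: Omega] w -> (0 <= (g w)%:E)%E by rewrite lee_fin.
by rewrite ge0_integralZl ?lee_fin// EFinM lee_wpmul2l.
Qed.

Lemma measurable_margin_integrand (c lambda : R) (k : nat) (h U : Omega -> R) :
  measurable_fun setT h -> measurable_fun setT U ->
  measurable_fun setT (fun w =>
    h w * (expR (- (c * (h w * U w `^ lambda) ^+ 2)) * (1 <= U w)%R%:R)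
    + inv_pow k (U w) * (0 < U w)%R%:R).
Proof.
move=> mh mU; have mUl : measurable_fun setT (fun w => U w `^ lambda).
  have mp := measurableT_comp (@measurable_powR R lambda) mU.
  exact: mp.
have mexp : measurable_fun setT (fun w => expR (- (c * (h w * U w `^ lambda) ^+ 2))).
  have mX : measurable_fun setT (fun w => (h w * U w `^ lambda) ^+ 2).
    by apply: measurable_funX; exact: measurable_funM.
  apply: (measurableT_comp (@measurable_expR R)); apply: measurableT_comp => //.
  exact: measurable_funM.
have m1U : measurable_fun setT (fun w => (1 <= U w)%R%:R : R).
  apply: (measurableT_comp (f := fun b : bool => b%:R : R)); first by [].
  exact: measurable_fun_ler.
apply: measurable_funD; last exact: measurable_inv_pow.
by apply: measurable_funM => //; exact: measurable_funM.
Qed.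

Lemma dyadic_split (n : nat) (y : R) : 1 <= y ->
  2 ^+ n <= y \/ exists i : 'I_n, 2 ^+ i <= y < 2 ^+ i.+1.
Proof.
move=> y1; elim: n => [|n IHn]; first by left.
case: IHn => [ny|[i iy]]; last by right; exists (widen_ord (leqnSn n) i).
have [|yn] := leP (2 ^+ n.+1) y; first by left.
by right; exists ord_max; rewrite /= ny.
Qed.

(** Where [U < 2 ^ n] the integrand is at most a multiple of [U ^ (- lambda)], summed
    over dyadic shells of [U]; elsewhere [U] may be replaced by [2 ^ n] and the
    condition on [h] is used. *)
Lemma margin_integral (c lambda alpha beta Ca : R) (k : nat) :
  0 < c -> 0 < lambda -> 0 < alpha -> 0 < beta -> 0 < Ca -> beta + 1 <= k%:R ->
  exists2 C : R, 0 < C & forall (B : R) (h U : Omega -> R) (n : nat),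
    0 < B -> measurable_fun setT h -> measurable_fun setT U ->
    (forall w, 0 <= h w) ->
    (forall t : R, 0 < t -> (P [set w | (0 < h w <= t)%R] <= (Ca * t `^ alpha)%:E)%E) ->
    (forall t : R, 0 < t -> (P [set w | (0 < U w <= t)%R] <= (B * t `^ beta)%:E)%E) ->
    (\int[P]_w (h w * (expR (- (c * (h w * U w `^ lambda) ^+ 2)) * (1 <= U w)%R%:R)
       + inv_pow k (U w) * (0 < U w)%R%:R)%:E <=
     (C * (B * (1 + \sum_(i < n) (2 ^+ i) `^ (beta - lambda)) +
           (2 ^+ n) `^ (- (lambda * (alpha + 1)))))%:E)%E.
Proof.
move=> c0 l0 a0 b0 Ca0 bk.
pose k' := (Num.truncn (alpha + 1)).+1.
have ak' : alpha + 1 <= k'%:R by exact/ltW/truncnS_gt.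
have [C1 C10 gauss] := gauss_le_inv_pow k' c0.
pose C2 := 2 + 2 * 2 `^ beta : R.
pose C3 := C1 * (Ca * (2 + 2 * 2 `^ alpha)).
have pb0 : 0 < 2 `^ beta :> R by exact: powR_gt0.
have pa0 : 0 < 2 `^ alpha :> R by exact: powR_gt0.
have C20 : 0 < C2 by rewrite /C2; lra.
have C30 : 0 < C3 by rewrite !mulr_gt0//; lra.
pose C := C2 + C1 * 2 `^ beta + C3.
have C1b : 0 < C1 * 2 `^ beta by rewrite mulr_gt0.
have C0 : 0 < C by rewrite /C; lra.
exists C => // B h U n B0 mh mU h0 Hh HU.
have p2 m : 0 < 2 ^+ m :> R by exact: exprn_gt0.
(* The order of magnitude of the loss at which the Gaussian factor becomes effective when
   [U = 2 ^ n]. *)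
pose tau := (2 ^+ n) `^ (- lambda) : R.
have tau0 : 0 < tau by exact: powR_gt0.
pose E (i : 'I_n) := [set w | (0 < U w <= 2 ^+ i.+1)%R].
have mE i : measurable (E i).
  rewrite -[X in measurable X]setTI.
  apply: (@measurable_and _ _ setT (fun w => 0 < U w) (fun w => U w <= 2 ^+ i.+1)) => //.
    exact: measurable_fun_ltr.
  exact: measurable_fun_ler.
pose ci (i : 'I_n) := C1 * (2 ^+ i) `^ (- lambda) : R.
have ci0 i : 0 <= ci i by rewrite mulr_ge0 ?powR_ge0// ltW.
pose s w := \sum_(i < n) ci i * \1_(E i) w : R.
have s0 w : 0 <= s w by apply: sumr_ge0 => i _; rewrite mulr_ge0.
have ms : measurable_fun setT s.
  have mi i : measurable_fun setT (\1_(E i) : Omega -> R) by exact/measurable_indicP.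
  by apply: measurable_sum => i; apply: measurable_funM.
have ints : (\int[P]_w (s w)%:E <= (0 + \sum_(i < n) ci i * (B * (2 ^+ i.+1) `^ beta))%:E)%E.
  apply: (@integral_le_steps _ _ _ P s n E ci) => //.
  - by move=> i; apply: HU.
  - by move=> w; rewrite add0r.
(* With [U] lowered to [2 ^ n] the integrand depends on [h / tau] alone. By the margin condition [v]
   integrates to order [tau ^ alpha], and the loss contributes one more [tau], hence the exponent
   [lambda (alpha + 1)]. *)
pose v w := inv_pow k' (h w / tau) * (0 < h w / tau)%R%:R.
have mhv : measurable_fun setT (fun w => h w / tau) by apply: measurable_funM.
have mv : measurable_fun setT v by exact: measurable_inv_pow.
have v0 w : 0 <= v w by exact: inv_pow_ind_ge0.
have intv : (\int[P]_w (v w)%:E <= ((Ca * tau `^ alpha) * (2 + 2 * 2 `^ alpha))%:E)%E.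
  apply: integral_inv_pow => //; first by rewrite mulr_gt0// powR_gt0.
  move=> t t0; rewrite -mulrA -powRM ?(ltW tau0) ?(ltW t0)//.
  apply: le_trans (Hh (tau * t) _); last by rewrite mulr_gt0.
  rewrite le_eqVlt; apply/orP; left; apply/eqP; congr (P _).
  apply/seteqP; split=> w /=;
    by rewrite pmulr_lgt0 ?invr_gt0// ler_pdivrMr// (mulrC t).
pose z w := inv_pow k (U w) * (0 < U w)%R%:R.
have mz : measurable_fun setT z by exact: measurable_inv_pow.
have z0 w : 0 <= z w by exact: inv_pow_ind_ge0.
have intz : (\int[P]_w (z w)%:E <= (B * C2)%:E)%E by exact: integral_inv_pow.
have ct0 : 0 <= C1 * tau by rewrite mulr_ge0 ?(ltW C10) ?(ltW tau0).
pose g w := h w * (expR (- (c * (h w * U w `^ lambda) ^+ 2)) * (1 <= U w)%R%:R).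
have g0 w : 0 <= g w by rewrite mulr_ge0// mulr_ge0// expR_ge0.
have gle w : g w <= s w + C1 * tau * v w.
  rewrite /g; case: (leP 1 (U w)) => U1; last first.
    by rewrite !mulr0 addr_ge0// mulr_ge0.
  have U0 : 0 < U w by lra.
  rewrite mulr1; have := h0 w; rewrite le_eqVlt => /orP[/eqP <-|hw].
    by rewrite mul0r addr_ge0// mulr_ge0.
  have Ul : 0 < U w `^ lambda by exact: powR_gt0.
  have [Un|[i /andP[iU Ui]]] := dyadic_split n U1.
    apply: (@le_trans _ _ (C1 * tau * v w)); last by rewrite lerDr.
    rewrite /v divr_gt0// mulr1.
    have ht : 0 < h w / tau by rewrite divr_gt0.
    have := gauss _ ht; rewrite -(ler_pM2l tau0) => hg.
    rewrite (mulrC C1) -mulrA; apply: le_trans hg.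
    rewrite [leRHS]mulrA (mulrC tau) divfK ?gt_eqF//; apply: ler_wpM2l => //.
    rewrite ler_expR lerN2 ler_wpM2l ?(ltW c0)//.
    apply: lerXn2r; rewrite ?nnegrE ?(ltW ht) ?mulr_ge0 ?(ltW Ul)//.
    rewrite ler_wpM2l// /tau powRN invrK.
    by apply: ge0_ler_powR; rewrite ?nnegrE ?(ltW l0) ?(ltW U0) ?(ltW (p2 n)).
  apply: (@le_trans _ _ (s w)); last by rewrite lerDl mulr_ge0.
  apply: (@le_trans _ _ (ci i * \1_(E i) w)); last first.
    by rewrite /s (bigD1 i)//= lerDl; apply: sumr_ge0 => j _; rewrite mulr_ge0.
  rewrite indicE mem_set ?mulr1; last by rewrite /E/= U0 ltW.
  have hU0 : 0 < h w * U w `^ lambda by rewrite mulr_gt0.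
  have := gauss _ hU0 => hg.
  have : h w * U w `^ lambda * expR (- (c * (h w * U w `^ lambda) ^+ 2)) <= C1.
    by apply: (le_trans hg); rewrite ler_piMr ?(ltW C10)// ge_min lexx.
  rewrite mulrAC -ler_pdivlMr// => /le_trans; apply.
  rewrite /ci ler_pM2l// powRN lef_pV2 ?posrE ?powR_gt0//.
  by apply: ge0_ler_powR; rewrite ?nnegrE ?(ltW l0) ?(ltW U0) ?(ltW (p2 i)).
have msv : measurable_fun setT (fun w => s w + C1 * tau * v w).
  by apply: measurable_funD => //; apply: measurable_funM.
have total : (\int[P]_w (s w + C1 * tau * v w + z w)%:E <=
  ((0 + \sum_(i < n) ci i * (B * (2 ^+ i.+1) `^ beta)) +
   (C1 * tau * ((Ca * tau `^ alpha) * (2 + 2 * 2 `^ alpha))) + B * C2)%:E)%E.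
  apply: integral_le_add => //.
  - by move=> w; rewrite addr_ge0// mulr_ge0.
  apply: integral_le_add => //.
  - by apply: measurable_funM.
  - by move=> w; rewrite mulr_ge0.
  exact: integral_le_scale.
have mgz : measurable_fun setT (fun w => g w + z w).
  exact: measurable_margin_integrand.
apply: (@le_trans _ _ (\int[P]_w (s w + C1 * tau * v w + z w)%:E)%E).
  apply: ge0_le_integral => //.
  - by move=> w _; rewrite lee_fin; apply: addr_ge0; [exact: g0|exact: z0].
  - exact/measurable_EFinP.
  - by apply/measurable_EFinP; exact: measurable_funD.
  by move=> w _; rewrite lee_fin lerD2r; exact: gle.
apply: (le_trans total); rewrite lee_fin add0r.
have sumE : \sum_(i < n) ci i * (B * (2 ^+ i.+1) `^ beta) =
    C1 * 2 `^ beta * (B * \sum_(i < n) (2 ^+ i) `^ (beta - lambda)).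
  rewrite !mulr_sumr; apply: eq_bigr => i _.
  rewrite /ci exprS powRM ?exprn_ge0// addrC powRD; last by rewrite (gt_eqF (p2 i)) implybT.
  by ring.
have tauE : tau * tau `^ alpha = (2 ^+ n) `^ (- (lambda * (alpha + 1))).
  rewrite -{1}(powRr1 (ltW tau0)) -powRD; last by rewrite (gt_eqF tau0) implybT.
  by rewrite /tau -powRrM; congr (_ `^ _); ring.
rewrite sumE.
rewrite (_ : C1 * tau * _ = C3 * (tau * tau `^ alpha)); last by rewrite /C3; ring.
rewrite tauE; set S := \sum_(i < n) _; set W := (2 ^+ n) `^ _.
have S0 : 0 <= S by apply: sumr_ge0 => i _; exact: powR_ge0.
have W0 : 0 <= W by exact: powR_ge0.
have BS0 : 0 <= B * S by rewrite mulr_ge0// ltW.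
rewrite [leRHS](_ : _ = C * B + C * (B * S) + C * W); last by ring.
have h1 : B * C2 <= C * B by rewrite mulrC ler_wpM2r ?(ltW B0)// /C; lra.
have h2 : C1 * 2 `^ beta * (B * S) <= C * (B * S) by rewrite ler_wpM2r// /C; lra.
have h3 : C3 * W <= C * W by rewrite ler_wpM2r// /C; lra.
lra.
Qed.

End margin_integral.

(** * From the pointwise bound to the excess risk *)

Section excess_bound.
Context {R : realType} {d : nat} {disp : measure_display}
  {Omega : measurableType disp} {P : probability Omega R}.
Variable Z : {RV P >-> ('rV[R]_d * R)%type}.
Variable Zs : nat -> {RV P >-> ('rV[R]_d * R)%type}.
Hypothesis Z_label : forall w, (Z w).2 = 1 \/ (Z w).2 = -1.
Hypothesis Z_iid : iid_copies Z Zs.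
Variables (nu : 'rV[R]_d -> R) (f eta : 'rV[R]_d -> R) (K A q alpha beta : R).
Hypothesis d0 : (0 < d)%N.
Hypothesis nu_norm : is_norm nu.
Hypothesis f_density : is_density Z f.
Hypothesis eta_regression : is_regression Z eta.
Hypotheses (K0 : 0 < K) (A0 : 0 < A) (q01 : 0 < q < 1).
Hypotheses (alpha0 : 0 < alpha) (beta0 : 0 < beta).
Hypothesis cond_a : margin_condition Z eta alpha.
Hypothesis cond_b : tail_condition Z f beta.
Hypothesis cond_c : smooth_condition nu Z f eta.
Hypothesis cond_d : min_mass_condition nu Z f.
Hypothesis cond_T : adaptive_tail_condition nu Z f A q beta.

Lemma mean_label_le1 (B : set 'rV[R]_d) : measurable B -> `|mean_label Z B| <= 1.
Proof.
move=> mB; have mS := measurable_preX Z mB.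
rewrite /mean_label; have [->|m0] := eqVneq (mass Z B) 0.
  by rewrite invr0 mulr0 normr0.
have mp : 0 < mass Z B by rewrite lt_neqAle eq_sym m0 fine_ge0.
rewrite normrM normfV (gtr0_norm mp) ler_pdivrMr// mul1r.
have mY : measurable_fun [set w | B (Z w).1] (fun w => (Z w).2%:E).
  by apply/measurable_EFinP; apply: measurable_funTS; exact: measurable_Y.
have le : (`|\int[P]_(w in [set w | B (Z w).1]) (Z w).2%:E| <= (mass Z B)%:E)%E.
  apply: (le_trans (le_abse_integral _ _ _)) => //.
  rewrite massK// -[leRHS]mul1e -integral_cst//.
  apply: ge0_le_integral => //; first exact: measurableT_comp.
  by move=> w _; rewrite /= lee_fin; case: (Z_label w) => ->; rewrite ?normrN normr1.
rewrite -lee_fin -abse_EFin fineK//.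
by rewrite fin_num_abs (le_lt_trans le)// ltry.
Qed.

(** A version of the regression function need not be bounded by 1 everywhere, but mean labels are,
    and by (c) they converge to [eta x] as the ball around a point of the support shrinks. *)
Lemma eta_le1 x : 0 < f x -> `|eta x| <= 1.
Proof.
move=> fx; have [C H] := cond_c.
have Sx : density_support f x by apply: subset_closure => /=; rewrite gt_eqF.
rewrite leNgt; apply/negP => eta1.
pose del := `|eta x| - 1; have del0 : 0 < del by rewrite subr_gt0.
pose r := Num.min 1 (del / (2 * (`|C| + 1))).
have C0 := normr_ge0 C.
have r0 : 0 < r by rewrite lt_min ltr01 divr_gt0//; lra.
have r1 : r <= 1 by rewrite ge_min lexx.
have Cr : C * r ^+ 2 <= del / 2.
  apply: (@le_trans _ _ ((`|C| + 1) * r)).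
    have h1 : r ^+ 2 <= r by rewrite expr2 ger_pMr.
    have h2 : C <= `|C| by exact: ler_norm.
    have h3 : 0 <= r ^+ 2 by exact: sqr_ge0.
    nra.
  rewrite -ler_pdivlMl; last by lra.
  apply: (@le_trans _ _ (del / (2 * (`|C| + 1)))); first by rewrite ge_min lexx orbT.
  by rewrite le_eqVlt; apply/orP; left; apply/eqP; field; rewrite gt_eqF//; lra.
have h := le_trans (H r x r0 Sx) Cr.
have h1 := mean_label_le1 (measurable_norm_ball nu_norm x r).
have := ler_normD (mean_label Z (norm_ball nu x r)) (eta x - mean_label Z (norm_ball nu x r)).
rewrite addrC subrK (distrC (eta x)) => h2; have : `|eta x| = del + 1 by rewrite /del; ring.
lra.
Qed.

Lemma density_pos_ae : {ae P, forall w, 0 < f (Z w).1}.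
Proof.
have [mf f0 Hf] := f_density.
have mB : measurable [set x | f x <= 0].
  by rewrite -[X in measurable X]setTI; exact: measurable_fun_ler.
exists [set w | f (Z w).1 <= 0]; split.
- exact: (measurable_preX Z mB).
- rewrite (Hf _ mB); apply: integral0_eq => x /= fx.
  by congr EFin; apply/eqP; rewrite eq_le fx f0.
- by move=> w /=; rewrite leNgt => /negP.
Qed.

Lemma measurable_mass : measurable_fun setT (fun x => mass Z (norm_ball nu x A)).
Proof.
pose D := [set p : 'rV[R]_d * ('rV[R]_d * R) | rho_at nu p.1 p.2 < A].
have mD : measurable D.
  rewrite -[X in measurable X]setTI; apply: measurable_fun_ltr => //.
  exact: measurable_rho_at.
have := measurable_fun_xsection (distribution P Z) mD.
move=> /(measurableT_comp (@fine_measurable R setT measurableT)).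
rewrite (_ : _ \o _ = fun x => mass Z (norm_ball nu x A))//.
apply/funext => x /=; rewrite /mass; congr fine.
rewrite /distribution /pushforward; congr (P _).
by apply/seteqP; split=> w; rewrite /preimage /xsection /= in_setE.
Qed.

Lemma measurable_local_scale : measurable_fun setT (local_scale Z nu f A q).
Proof.
have [mf _ _] := f_density.
have mpow (g : 'rV[R]_d -> R) b : measurable_fun setT g ->
    measurable_fun setT (fun x => g x `^ b).
  move=> mg; have mp := measurableT_comp (@measurable_powR R b) mg.
  exact: mp.
rewrite /local_scale /scale; apply: measurable_minr => //; apply: (mpow _).
rewrite (_ : (fun x => _) = fun x => f x * mass Z (norm_ball nu x A) `^ (- q)).
  by apply: measurable_funM => //; apply: mpow; exact: measurable_mass.
by apply/funext => x; rewrite powRN.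
Qed.

Lemma scaled_tail : exists2 C : R, 0 < C & forall (N : nat) (t : R), (0 < N)%N -> 0 < t ->
  (P [set w | (0 < scaled Z nu f A q N (Z w).1 <= t)%R] <=
   (C * N%:R `^ (- beta) * t `^ beta)%:E)%E.
Proof.
have [mf f0 _] := f_density; have /andP[q0 q1] := q01.
have q1' : 0 < 1 - q by rewrite subr_gt0.
have [Cb Hb] := cond_b; have [Ct Ht] := cond_T.
pose C := `|Cb| + `|Ct| * 2 `^ beta + 1.
have Cb0 := normr_ge0 Cb.
have Ct0 : 0 <= `|Ct| * 2 `^ beta by rewrite mulr_ge0// powR_ge0.
exists C => [|N t N0 t0]; first by rewrite /C; lra.
have n0 : 0 < N%:R :> R by rewrite ltr0n.
pose s := t / N%:R; have s0 : 0 < s by exact: divr_gt0.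
have sE : s `^ beta = N%:R `^ (- beta) * t `^ beta.
  by rewrite /s powRM ?invr_ge0 ?(ltW t0)// powRN mulrC -powR_inv1// -powRrM mulN1r powRN.
have mX := measurable_X Z.
have mfX : measurable_fun setT (fun w => f (Z w).1) by exact: (measurableT_comp mf).
have mmX : measurable_fun setT (fun w => mass Z (norm_ball nu (Z w).1 A)).
  exact: (measurableT_comp measurable_mass).
pose E1 := [set w | (f (Z w).1 <= s)%R].
(* (T) concerns a strict inequality while [U <= t] gives a weak one at level [s]; doubling [s] makes
   room and costs a factor [2 ^ beta]. *)
pose E2 := [set w | (f (Z w).1 / mass Z (norm_ball nu (Z w).1 A) `^ q < (2 * s) `^ (1 - q))%R].
have mE1 : measurable E1.
  by rewrite -[X in measurable X]setTI; exact: measurable_fun_ler.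
have mE2 : measurable E2.
  rewrite -[X in measurable X]setTI; apply: measurable_fun_ltr => //.
  rewrite (_ : (fun w => _) =
    fun w => f (Z w).1 * mass Z (norm_ball nu (Z w).1 A) `^ (- q)).
    apply: measurable_funM => //.
    have mp := measurableT_comp (@measurable_powR R (- q)) mmX.
    exact: mp.
  by apply/funext => w; rewrite powRN.
have mU : measurable_fun setT (fun w => scaled Z nu f A q N (Z w).1).
  apply: measurable_funM => //; exact: (measurableT_comp measurable_local_scale).
apply: (@le_trans _ _ (P (E1 `|` E2))).
  apply: le_measure; rewrite ?inE; [|exact: measurableU|].
    rewrite -[X in measurable X]setTI.
    apply: (@measurable_and _ _ setT (fun w => 0 < scaled Z nu f A q N (Z w).1)
      (fun w => scaled Z nu f A q N (Z w).1 <= t)) => //.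
      exact: measurable_fun_ltr.
    exact: measurable_fun_ler.
  move=> w /= /andP[_]; rewrite /scaled mulrC -ler_pdivlMr// -/s.
  rewrite /local_scale /scale ge_min => /orP[fs|ts]; [by left|right].
  rewrite /E2/=; set y := f (Z w).1 / _ in ts *.
  have y0 : 0 <= y by rewrite divr_ge0// powR_ge0.
  apply: (@le_lt_trans _ _ (s `^ (1 - q))).
    have yE : y = (y `^ (1 - q)^-1) `^ (1 - q).
      by rewrite -powRrM mulVf ?powRr1// lt0r_neq0.
    rewrite [leLHS]yE.
    by apply: ge0_ler_powR; rewrite ?nnegrE ?powR_ge0 ?(ltW q1') ?(ltW s0).
  by apply: gt0_ltr_powR; rewrite ?nnegrE ?mulr_ge0 ?(ltW s0)//; lra.
apply: (le_trans (measureU2 _ _ _)) => //.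
have h1 := Hb s s0; have h2 := Ht (2 * s) (mulr_gt0 (ltr0Sn _ _) s0).
apply: (le_trans (leeD h1 h2)); rewrite -EFinD lee_fin.
rewrite powRM ?(ltW s0)// -mulrA -sE.
have sb0 : 0 <= s `^ beta by exact: powR_ge0.
have h3 : Cb * s `^ beta <= `|Cb| * s `^ beta by rewrite ler_wpM2r// ler_norm.
have h4 : Ct * (2 `^ beta * s `^ beta) <= `|Ct| * 2 `^ beta * s `^ beta.
  by rewrite mulrA ler_wpM2r// ler_wpM2r ?powR_ge0// ler_norm.
rewrite /C !mulrDl mul1r; lra.
Qed.

Lemma measurable_error_prob N : measurable_fun setT (error_prob Z nu eta K A q N).
Proof.
have [meta _ _] := eta_regression.
pose D := [set p : 'rV[R]_d * N.-tuple ('rV[R]_d * R) |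
  adaptive_knn nu K A q p.2 p.1 != sign_label (eta p.1)].
have mD : measurable D.
  rewrite -[X in measurable X]setTI.
  apply: (measurable_neg (f := fun p : 'rV[R]_d * N.-tuple ('rV[R]_d * R) =>
    adaptive_knn nu K A q p.2 p.1 == sign_label (eta p.1))) => //.
  apply: measurable_fun_eqr; first exact: measurable_adaptive_knn.
  apply: (measurableT_comp (@measurable_sign_label R)).
  exact: (measurableT_comp meta measurable_fst).
have := measurable_fun_xsection (iid_law (distribution P Z) N) mD.
rewrite (_ : _ \o _ = error_prob Z nu eta K A q N)//.
apply/funext => x /=; rewrite /error_prob; congr (iid_law _ _ _).
by apply/seteqP; split=> s; rewrite /xsection /= in_setE.
Qed.

(** The cut-off [n] is left free; it is tuned to [N] only in [dyadic_rate]. *)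
Lemma excess_le : exists2 C : R, 0 < C & forall n N : nat, (0 < N)%N ->
  `|excess_risk Z Zs eta (adaptive_knn nu K A q) N| <=
  C * (N%:R `^ (- beta) * (1 + \sum_(i < n) (2 ^+ i) `^ (beta - knn_lambda d q)) +
       (2 ^+ n) `^ (- (knn_lambda d q * (alpha + 1)))).
Proof.
have [mf f0 _] := f_density; have [meta ieta _] := eta_regression.
pose lambda := knn_lambda d q.
pose k := (Num.truncn (beta + 1)).+1.
have bk : beta + 1 <= k%:R by exact/ltW/truncnS_gt.
have [c [C1 [c0 C10 Herr]]] :=
  error_prob_decay Z_label d0 nu_norm K0 A0 q01 cond_c cond_d k.
have [Ca0 Ha0] := cond_a.
pose Ca := `|Ca0| + 1.
have CaP : 0 < Ca by rewrite ltr_wpDl.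
have [Cu Cu0 HU] := scaled_tail.
have l0 : 0 < lambda by exact: knn_lambda_gt0.
have [C2 C20 Hint] := @margin_integral _ _ _ P c lambda alpha beta Ca k c0 l0 alpha0 beta0 CaP bk.
pose C := C1 * C2 * (Cu + 1).
have CC : 0 < C1 * C2 by exact: mulr_gt0.
exists C => [|n N N0]; first by rewrite mulr_gt0//; lra.
have n0 : 0 < N%:R :> R by rewrite ltr0n.
have mX := measurable_X Z.
pose h w := `|eta (Z w).1|; pose U w := scaled Z nu f A q N (Z w).1.
have mh : measurable_fun setT h.
  by apply: measurableT_comp => //; exact: (measurableT_comp meta).
have mU : measurable_fun setT U.
  by apply: measurable_funM => //; exact: (measurableT_comp measurable_local_scale).
pose B := Cu * N%:R `^ (- beta).
have B0 : 0 < B by rewrite mulr_gt0// powR_gt0.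
have h0 w : 0 <= h w by exact: normr_ge0.
have Hh t : 0 < t -> (P [set w | (0 < h w <= t)%R] <= (Ca * t `^ alpha)%:E)%E.
  move=> t0; apply: (le_trans (Ha0 t t0)); rewrite lee_fin ler_wpM2r ?powR_ge0//.
  by apply: (le_trans (ler_norm _)); rewrite lerDl.
have HU' t : 0 < t -> (P [set w | (0 < U w <= t)%R] <= (B * t `^ beta)%:E)%E.
  exact: HU.
pose g w := h w * (expR (- (c * (h w * U w `^ lambda) ^+ 2)) * (1 <= U w)%R%:R)
  + inv_pow k (U w) * (0 < U w)%R%:R.
have Hg := Hint B h U n B0 mh mU h0 Hh HU'.
have mg : measurable_fun setT g by exact: measurable_margin_integrand.
have g0 w : 0 <= g w.
  rewrite /g addr_ge0// ?inv_pow_ind_ge0// mulr_ge0// mulr_ge0// expR_ge0//.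
have merr : measurable_fun setT (fun w => (`|eta (Z w).1|%:E *
    error_prob Z nu eta K A q N (Z w).1)%E).
  apply: emeasurable_funM; first exact/measurable_EFinP.
  exact: (measurableT_comp (measurable_error_prob N)).
have Hex : ((excess_risk Z Zs eta (adaptive_knn nu K A q) N)%:E =
    \int[P]_w (`|eta (Z w).1|%:E * error_prob Z nu eta K A q N (Z w).1))%E.
  apply: excess_riskE => //; first exact: measurable_adaptive_knn.
  by move=> s x; exact: sign_labelP.
have ex0 : 0 <= excess_risk Z Zs eta (adaptive_knn nu K A q) N.
  by rewrite -lee_fin Hex; apply: integral_ge0 => w _; rewrite mule_ge0 ?lee_fin.
rewrite ger0_norm// -lee_fin Hex.
apply: (@le_trans _ _ (\int[P]_w (C1 * g w)%:E)%E).
  apply: ae_ge0_le_integral => //.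
  - by move=> w _; rewrite mule_ge0 ?lee_fin.
  - by move=> w _; rewrite lee_fin mulr_ge0// ltW.
  - by apply/measurable_EFinP; exact: measurable_funM.
  apply: filterS density_pos_ae => w fw _.
  have eta1 := eta_le1 fw.
  have [e0|e0] := eqVneq (eta (Z w).1) 0.
    by rewrite e0 normr0 mul0e lee_fin mulr_ge0// ltW.
  have eta0 : 0 < `|eta (Z w).1| <= 1 by rewrite normr_gt0 e0.
  have := Herr N (Z w).1 N0 fw eta0; rewrite -/(U w) -/(h w) => He.
  apply: (le_trans (lee_wpmul2l _ He)); first by rewrite lee_fin.
  rewrite -EFinM lee_fin mulrCA ler_pM2l// /g mulrDr lerD2l.
  have U0 : 0 < U w by exact: scaled_gt0.
  by rewrite U0 mulr1 ler_piMl// ltW// inv_pow_gt0.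
apply: (le_trans (integral_le_scale mg g0 (ltW C10) Hg)).
rewrite lee_fin mulrA /C -[leRHS]mulrA ler_pM2l//.
set S := 1 + _; set W := _ `^ _; set V := N%:R `^ _.
have S0 : 0 <= S by rewrite addr_ge0// sumr_ge0// => i _; exact: powR_ge0.
have W0 : 0 <= W by exact: powR_ge0.
have VS0 : 0 <= V * S by rewrite mulr_ge0// powR_ge0.
by rewrite /B -/V -mulrA; nra.
Qed.

End excess_bound.

(** * Rates *)

Section rate.
Context {R : realType}.
Variables (alpha beta : R).
Hypotheses (alpha0 : 0 < alpha) (beta0 : 0 < beta).

Definition rate_exponent (lambda : R) : R :=
  lambda * beta * (alpha + 1) / (lambda * alpha + beta).

Lemma exists_dyadic (T : R) : 1 <= T -> exists n, T <= 2 ^+ n < 2 * T.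
Proof.
move=> T1; have [n0 hn0] : exists n, T <= 2 ^+ n.
  exists (Num.truncn T).+1; apply: (@le_trans _ _ (Num.truncn T).+1%:R).
    exact/ltW/truncnS_gt.
  by rewrite -natrX ler_nat ltnW// ltn_expl.
case: (ex_minnP (ex_intro (fun n => T <= 2 ^+ n) n0 hn0)) => n Tn nmin.
exists n; rewrite Tn/=; case: n => [|n] in Tn nmin *; first by rewrite expr0; lra.
rewrite exprS ltr_pM2l// ltNge; apply/negP => /nmin; rewrite ltnn.
by [].
Qed.

Lemma powR_exprn (x y : R) (n : nat) : 0 <= x -> (x ^+ n) `^ y = (x `^ y) ^+ n.
Proof. by move=> x0; rewrite -(powR_mulrn _ x0) powRAC powR_mulrn// powR_ge0. Qed.

Lemma pow2_gt1 (x : R) : 0 < x -> 1 < 2 `^ x.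
Proof.
move=> x0; apply: (@le_lt_trans _ _ (1 `^ x)); first by rewrite powR1.
by apply: gt0_ltr_powR; rewrite ?nnegrE// ltr1n.
Qed.

Lemma geometric_sum (w : R) (n : nat) : w != 1 ->
  \sum_(i < n) w ^+ i = (w ^+ n - 1) / (w - 1).
Proof.
move=> w1; have w10 : w - 1 != 0 by rewrite subr_eq0.
by rewrite subrX1 mulrAC divff// mul1r.
Qed.

Lemma powRN_le (N : nat) (a b : R) : (0 < N)%N -> b <= a ->
  N%:R `^ (- a) <= N%:R `^ (- b) :> R.
Proof. by move=> N0 ba; apply: ler_powR; rewrite ?ler1n// lerN2. Qed.

(** [n] is chosen with [2 ^ n] of order [N ^ (beta / (lambda * alpha + beta))], which
    balances the two terms when [beta > lambda]. *)
Lemma dyadic_rate (lambda : R) : 0 < lambda -> exists2 C : R, 0 < C &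
  forall N : nat, (1 < N)%N -> exists n : nat,
    N%:R `^ (- beta) * (1 + \sum_(i < n) (2 ^+ i) `^ (beta - lambda)) +
      (2 ^+ n) `^ (- (lambda * (alpha + 1))) <= C * knn_rate alpha beta lambda N.
Proof.
move=> l0.
have D0 : 0 < lambda * alpha + beta by rewrite addr_gt0// mulr_gt0.
have la0 : 0 < lambda * (alpha + 1) by rewrite mulr_gt0// addr_gt0.
pose e := rate_exponent lambda.
(* Ratio of the shell sum. Below 1 the sum is bounded, above 1 its last terms dominate, and at 1
   every shell contributes equally. *)
pose w : R := 2 `^ (beta - lambda).
have w0 : 0 < w by exact: powR_gt0.
have sumE n : \sum_(i < n) (2 ^+ i) `^ (beta - lambda) = \sum_(i < n) w ^+ i :> R.
  by apply: eq_bigr => i _; rewrite powR_exprn.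
have dy (N : nat) : (1 < N)%N -> exists n : nat,
    [/\ N%:R `^ (beta / (lambda * alpha + beta)) <= 2 ^+ n :> R,
        2 ^+ n < 2 * N%:R `^ (beta / (lambda * alpha + beta)) :> R &
        (2 ^+ n) `^ (- (lambda * (alpha + 1))) <= N%:R `^ (- e) :> R].
  move=> N1; have N0 : (0 < N)%N by exact: ltnW.
  have n1 : 1 <= N%:R :> R by rewrite ler1n.
  have n0 : 0 < N%:R :> R by rewrite ltr0n.
  set T := N%:R `^ _.
  have T1 : 1 <= T.
    rewrite -[leLHS](powRr0 N%:R); apply: ler_powR => //.
    by rewrite divr_ge0 ?ltW.
  have [n /andP[Tn nT]] := exists_dyadic T1; exists n; split => //.
  have -> : N%:R `^ (- e) = T `^ (- (lambda * (alpha + 1))).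
    by rewrite /T -powRrM; congr (_ `^ _); rewrite /e /rate_exponent; field; rewrite gt_eqF.
  have T0 : 0 < T by lra.
  rewrite !powRN lef_pV2 ?posrE ?powR_gt0 ?exprn_gt0//.
  by apply: ge0_ler_powR; rewrite ?nnegrE ?(ltW la0) ?(ltW T0) ?exprn_ge0.
have [bl|lb|bl] := ltgtP beta lambda.
- have w1 : w < 1.
    rewrite /w -[beta - lambda]opprB powRN invf_lt1 ?powR_gt0//.
    by apply: pow2_gt1; rewrite subr_gt0.
  have eb : beta <= e.
    rewrite /e /rate_exponent ler_pdivlMr//.
    have : 0 <= beta * (lambda - beta) by apply: mulr_ge0; [exact: ltW|rewrite subr_ge0 ltW].
    lra.
  exists (2 + (1 - w)^-1) => [|N N1].
    by apply: ltr_wpDr => //; rewrite invr_ge0 subr_ge0 ltW.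
  have [n [_ _ nE]] := dy N N1; exists n; have N0 : (0 < N)%N by exact: ltnW.
  rewrite /knn_rate (lt_eqF bl) -/(rate_exponent lambda) -/e (min_idPr eb) sumE.
  have S1 : \sum_(i < n) w ^+ i <= (1 - w)^-1.
    rewrite geometric_sum ?lt_eqF// -mulrNN -invrN !opprB.
    by rewrite -[leRHS]mul1r ler_wpM2r ?invr_ge0 ?subr_ge0 ?(ltW w1)// gerBl exprn_ge0// ltW.
  have Nb : N%:R `^ (- e) <= N%:R `^ (- beta) :> R by exact: powRN_le.
  set V := N%:R `^ (- beta) in Nb *.
  have V0 : 0 <= V by exact: powR_ge0.
  have := ler_wpM2l V0 S1; lra.
- have w1 : 1 < w.
    by apply: pow2_gt1; rewrite subr_gt0.
  have eb : e <= beta.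
    rewrite /e /rate_exponent ler_pdivrMr//.
    have : 0 <= beta * (beta - lambda) by apply: mulr_ge0; [exact: ltW|rewrite subr_ge0 ltW].
    lra.
  have w10 : 0 < w - 1 by rewrite subr_gt0.
  exists (2 + w / (w - 1)) => [|N N1].
    by apply: ltr_wpDr => //; rewrite divr_ge0// ltW.
  have [n [nT Tn nE]] := dy N N1; exists n; have N0 : (0 < N)%N by exact: ltnW.
  have n0 : 0 < N%:R :> R by rewrite ltr0n.
  rewrite /knn_rate (gt_eqF lb) -/(rate_exponent lambda) -/e (min_idPl eb) sumE.
  set T := N%:R `^ (beta / _) in nT Tn.
  have T0 : 0 < T by exact: powR_gt0.
  have S1 : \sum_(i < n) w ^+ i <= w / (w - 1) * T `^ (beta - lambda).
    rewrite geometric_sum ?gt_eqF// mulrAC ler_wpM2r ?invr_ge0 ?(ltW w10)//.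
    apply: (@le_trans _ _ (w ^+ n)); first by rewrite gerBl.
    rewrite /w -powR_exprn// -powRM ?(ltW T0)//.
    by apply: ge0_ler_powR; rewrite ?nnegrE ?exprn_ge0 ?mulr_ge0 ?(ltW T0) ?(ltW Tn)// subr_ge0 ltW.
  have Nb : N%:R `^ (- beta) <= N%:R `^ (- e) :> R by exact: powRN_le.
  (* The balance behind the choice of [T]: the top shell and the tail term have the same order. *)
  have NT : N%:R `^ (- beta) * T `^ (beta - lambda) = N%:R `^ (- e).
    rewrite /T -powRrM -powRD; last by rewrite (gt_eqF n0) implybT.
    by congr (_ `^ _); rewrite /e /rate_exponent; field; rewrite gt_eqF.
  set V := N%:R `^ (- beta) in Nb NT *.
  have V0 : 0 <= V by exact: powR_ge0.
  have := ler_wpM2l V0 S1; rewrite mulrCA NT; lra.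
- have ln2 : 0 < ln 2 :> R by rewrite ln_gt0//; lra.
  exists (4 / ln 2) => [|N N1]; first by rewrite divr_gt0.
  have [n [nT Tn nE]] := dy N N1; exists n; have N0 : (0 < N)%N by exact: ltnW.
  have n0 : 0 < N%:R :> R by rewrite ltr0n.
  rewrite /knn_rate bl eqxx.
  have Db : beta * alpha + beta != 0 by rewrite gt_eqF// addr_gt0// mulr_gt0.
  have eb : e = beta by rewrite /e /rate_exponent -bl; field.
  rewrite eb bl in nE.
  have -> : \sum_(i < n) (2 ^+ i) `^ (lambda - lambda) = n%:R :> R.
    under eq_bigr do rewrite subrr powRr0.
    by rewrite sumr_const card_ord.
  have ln2N : ln 2 <= ln N%:R :> R by rewrite ler_ln ?posrE// ler_nat.
  (* The number of shells is logarithmic in [N]; the bound [ln 2 <= ln N] absorbs the additive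
     constants, here and in the final [4 / ln 2]. *)
  have nN : n%:R * ln 2 <= 2 * ln N%:R :> R.
    have T0 : 0 < N%:R `^ (beta / (lambda * alpha + beta)) :> R by exact: powR_gt0.
    have := ltW Tn; rewrite -ler_ln ?posrE ?exprn_gt0 ?mulr_gt0//.
    rewrite lnXn// lnM ?posrE// ln_powR -[ln 2 *+ n]mulr_natl => h.
    have h1 : beta / (lambda * alpha + beta) <= 1.
      by rewrite ler_pdivrMr// mul1r lerDr mulr_ge0 ?ltW.
    have h2 : beta / (lambda * alpha + beta) * ln N%:R <= ln N%:R.
      by rewrite ler_piMl// (le_trans (ltW ln2)).
    lra.
  set V := N%:R `^ (- lambda) in nE *.
  have V0 : 0 <= V by exact: powR_ge0.
  apply: (@le_trans _ _ (V * (2 + n%:R))).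
    by rewrite (_ : V * (2 + _) = V * (1 + n%:R) + V) ?lerD2l//; ring.
  rewrite mulrCA; apply: ler_wpM2l => //.
  rewrite mulrAC ler_pdivlMr//; lra.
Qed.

Lemma rate_exponent_mono (l1 l2 : R) : 0 < l1 -> l1 <= l2 ->
  rate_exponent l1 <= rate_exponent l2.
Proof.
move=> l10 l12; have l20 := lt_le_trans l10 l12.
have D1 : 0 < l1 * alpha + beta by rewrite addr_gt0// mulr_gt0.
have D2 : 0 < l2 * alpha + beta by rewrite addr_gt0// mulr_gt0.
rewrite /rate_exponent ler_pdivrMr// [leRHS]mulrAC ler_pdivlMr// -subr_ge0.
rewrite (_ : _ - _ = beta ^+ 2 * (alpha + 1) * (l2 - l1)); last by ring.
by rewrite mulr_ge0 ?subr_ge0// mulr_ge0 ?sqr_ge0 ?addr_ge0 ?ltW.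
Qed.

(** The minimum in the rate therefore switches exactly at the exceptional value [beta = lambda]. *)
Lemma rate_exponent_lt_beta (l : R) : 0 < l -> (rate_exponent l < beta) = (l < beta).
Proof.
move=> l0; have D : 0 < l * alpha + beta by rewrite addr_gt0// mulr_gt0.
rewrite /rate_exponent ltr_pdivrMr// -subr_gt0.
rewrite (_ : _ - _ = beta * (beta - l)); last by ring.
by rewrite pmulr_rgt0// subr_gt0.
Qed.

End rate.

Lemma eqO_ge (R : realType) (u v : nat -> R) (C : R) (N0 : nat) : 0 < C ->
  (forall N, (N0 <= N)%N -> `|u N| <= C * v N) -> u =O_\oo v.
Proof.
move=> C0 H; apply/eqO_exP; exists C => //; exists N0 => // N /= hN.
apply: (le_trans (H N hN)); rewrite ler_wpM2l ?(ltW C0)//; exact: ler_norm.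
Qed.

(** * Optimality of [q = 4 / (d + 4)] *)

(** At this [q] the two arguments of the minimum coincide: it solves [q / 2 = 2 (1 - q) / d]. *)
Lemma knn_lambda_opt (R : realType) (d : nat) : (0 < d)%N ->
  knn_lambda d (4 / (d%:R + 4) : R) = 2 / (d%:R + 4).
Proof.
move=> d0; have dR : 0 < d%:R :> R by rewrite ltr0n.
have d4 : d%:R + 4 != 0 :> R by rewrite gt_eqF// addr_gt0.
rewrite /knn_lambda; have -> : 2 / d%:R * (1 - 4 / (d%:R + 4)) = 2 / (d%:R + 4) :> R.
  by field; rewrite d4 gt_eqF.
have -> : 2^-1 * (4 / (d%:R + 4)) = 2 / (d%:R + 4) :> R by field.
by rewrite minxx.
Qed.

(** One argument of the minimum increases with [q] and the other decreases, so on either side of the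
    crossing one of them is below the common value. *)
Lemma knn_lambda_le_opt (R : realType) (d : nat) (q : R) : (0 < d)%N ->
  knn_lambda d q <= 2 / (d%:R + 4).
Proof.
move=> d0; have dR : 0 < d%:R :> R by rewrite ltr0n.
have d4 : 0 < d%:R + 4 :> R by rewrite addr_gt0.
have q4 : 4 / (d%:R + 4) * (d%:R + 4) = 4 :> R by rewrite divfK// gt_eqF.
rewrite /knn_lambda ge_min; apply/orP.
have [qq|qq] := leP q (4 / (d%:R + 4)); [left|right].
  apply: (@le_trans _ _ (2^-1 * (4 / (d%:R + 4)))); first by rewrite ler_pM2l.
  by rewrite le_eqVlt; apply/orP; left; apply/eqP; field; rewrite gt_eqF.
apply: (@le_trans _ _ (2 / d%:R * (1 - 4 / (d%:R + 4)))).
  by rewrite ler_pM2l ?divr_gt0// lerD2l lerN2 ltW.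
by rewrite le_eqVlt; apply/orP; left; apply/eqP; field; rewrite !gt_eqF.
Qed.

(** The exponent grows with [lambda]; care is needed only where a logarithm appears. At [beta = l2]
    it multiplies the smaller rate, but then the exponents differ strictly. *)
Lemma knn_rate_antitone (R : realType) (alpha beta l1 l2 : R) :
  0 < alpha -> 0 < beta -> 0 < l1 -> l1 <= l2 ->
  knn_rate alpha beta l2 =O_\oo knn_rate alpha beta l1.
Proof.
move=> a0 b0 l10 l12; have l20 := lt_le_trans l10 l12.
pose e := rate_exponent alpha beta.
have e12 : e l1 <= e l2 by exact: rate_exponent_mono.
have [->|l12'] := eqVneq l1 l2.
  apply/eqO_exP; exists 1 => //; exists 0%N => // N _.
  by rewrite mul1r.
have ll : l1 < l2 by rewrite lt_neqAle l12'.
have [bl2|bl2] := eqVneq beta l2.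
  have eb : e l1 < beta by rewrite rate_exponent_lt_beta// bl2.
  (* The gap between the exponents pays for the logarithm: [del ln N <= N ^ del]. *)
  pose del := beta - e l1; have del0 : 0 < del by rewrite subr_gt0.
  apply: (@eqO_ge _ _ _ del^-1 1%N) => [|N N1]; first by rewrite invr_gt0.
  have n1 : 1 <= N%:R :> R by rewrite ler1n.
  have n0 : 0 < N%:R :> R by rewrite ltr0n.
  have lnN0 : 0 <= ln N%:R :> R by exact: ln_ge0.
  rewrite /knn_rate bl2 eqxx (gt_eqF ll) -bl2 -/(rate_exponent alpha beta l1) -/(e l1).
  rewrite (min_idPl (ltW eb)) ger0_norm; last by rewrite mulr_ge0 ?powR_ge0.
  have -> : N%:R `^ (- e l1) = N%:R `^ (- beta) * N%:R `^ del :> R.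
    rewrite -powRD; last by rewrite (gt_eqF n0) implybT.
    by congr (_ `^ _); rewrite /del; ring.
  rewrite mulrCA; apply: ler_wpM2l; first exact: powR_ge0.
  rewrite mulrC ler_pdivlMr// mulrC -ln_powR.
  have p0 : 0 < N%:R `^ del :> R by exact: powR_gt0.
  have := expR_ge1Dx (ln (N%:R `^ del) : R); rewrite lnK ?posrE//.
  by move=> h; apply: le_trans h; rewrite lerDr.
have [bl1|bl1] := eqVneq beta l1.
  have eb : beta <= e l2.
    by rewrite leNgt rate_exponent_lt_beta// -leNgt bl1.
  (* Here the logarithm multiplies the larger rate and only has to stay away from 0, which it does
     from [N = 2] on. *)
  have ln2 : 0 < ln 2 :> R by rewrite ln_gt0// ltr1n.
  apply: (@eqO_ge _ _ _ (ln 2)^-1 2%N) => [|N N1]; first by rewrite invr_gt0.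
  have n0 : 0 < N%:R :> R by rewrite ltr0n ltnW.
  rewrite /knn_rate (negbTE bl2) -bl1 eqxx -/(rate_exponent alpha beta l2) -/(e l2).
  rewrite (min_idPr eb) ger0_norm ?powR_ge0// mulrCA -[leLHS]mulr1.
  apply: ler_wpM2l; first exact: powR_ge0.
  rewrite mulrC ler_pdivlMr// mul1r ler_ln ?posrE//.
  by rewrite ler_nat.
apply: (@eqO_ge _ _ _ 1 1%N) => // N N1.
rewrite /knn_rate (negbTE bl2) (negbTE bl1) mul1r ger0_norm ?powR_ge0//.
rewrite -/(rate_exponent alpha beta l1) -/(rate_exponent alpha beta l2) -/(e l1) -/(e l2).
apply: powRN_le => //; rewrite le_min !ge_min e12 lexx !orbT.
by [].
Qed.

Theorem theorem3 (R : realType) (d : nat) (d_gt0 : (0 < d)%N)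
  (nu : 'rV[R]_d -> R) (nu_norm : is_norm nu)
  (disp : measure_display) (Omega : measurableType disp)
  (P : probability Omega R)
  (Z : {RV P >-> ('rV[R]_d * R)%type})
  (Zs : nat -> {RV P >-> ('rV[R]_d * R)%type})
  (Z_label : forall w, (Z w).2 = 1 \/ (Z w).2 = -1)
  (Zs_label : forall i w, (Zs i w).2 = 1 \/ (Zs i w).2 = -1)
  (Z_iid : iid_copies Z Zs)
  (f eta : 'rV[R]_d -> R)
  (f_density : is_density Z f) (eta_regression : is_regression Z eta)
  (alpha beta : R) (alpha_gt0 : 0 < alpha) (beta_gt0 : 0 < beta)
  (cond_a : margin_condition Z eta alpha)
  (cond_b : tail_condition Z f beta)
  (cond_c : smooth_condition nu Z f eta)
  (cond_d : min_mass_condition nu Z f) :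
  let excess K A q := excess_risk Z Zs eta (adaptive_knn nu K A q) in
  let qopt : R := 4 / (d%:R + 4) in
  [/\ forall K A q : R, 0 < K -> 0 < A -> 0 < q < 1 ->
        adaptive_tail_condition nu Z f A q beta ->
        excess K A q =O_\oo knn_rate alpha beta (knn_lambda d q),
      0 < qopt < 1 /\
      (forall q : R, 0 < q < 1 ->
        knn_rate alpha beta (knn_lambda d qopt) =O_\oo
        knn_rate alpha beta (knn_lambda d q)) &
      forall K A : R, 0 < K -> 0 < A ->
        adaptive_tail_condition nu Z f A qopt beta ->
        excess K A qopt =O_\oo
        (fun N : nat =>
           if beta == 2 / (d%:R + 4) then N%:R `^ (- beta) * ln N%:R
           else N%:R `^ (- Num.min (2 * beta * (alpha + 1) /
                          (beta * d%:R + 2 * (alpha + 2 * beta))) beta))].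
Proof.
move=> excess qopt.
have dR : 0 < d%:R :> R by rewrite ltr0n.
have part1 (K A q : R) : 0 < K -> 0 < A -> 0 < q < 1 ->
    adaptive_tail_condition nu Z f A q beta ->
    excess K A q =O_\oo knn_rate alpha beta (knn_lambda d q).
  move=> K0 A0 q01 cond_T.
  have l0 := knn_lambda_gt0 d_gt0 q01.
  have [C C0 HC] := excess_le Z_label Z_iid d_gt0 nu_norm f_density eta_regression
    K0 A0 q01 alpha_gt0 beta_gt0 cond_a cond_b cond_c cond_d cond_T.
  have [C' C'0 HC'] := dyadic_rate alpha_gt0 beta_gt0 l0.
  (* Starting at 2 avoids [N = 1], where the rate with a logarithm vanishes. *)
  apply: (@eqO_ge _ _ _ (C * C') 2%N) => [|N N1]; first exact: mulr_gt0.
  have [n Hn] := HC' N N1.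
  apply: (le_trans (HC n N (ltnW N1))).
  by rewrite -mulrA ler_pM2l.
have qopt01 : 0 < qopt < 1.
  rewrite /qopt divr_gt0 ?addr_gt0//= ltr_pdivrMr ?addr_gt0// mul1r.
  by rewrite ltrDr.
split.
- exact: part1.
- split=> // q q01; apply: knn_rate_antitone => //; first exact: knn_lambda_gt0.
  by rewrite knn_lambda_opt// knn_lambda_le_opt.
move=> K A K0 A0 cond_T.
have := part1 K A qopt K0 A0 qopt01 cond_T.
rewrite knn_lambda_opt//; congr (_ =O_\oo _).
apply/funext => N; rewrite /knn_rate; case: eqP => // _; congr (_ `^ _).
congr (- Num.min _ _); field.
by rewrite !gt_eqF ?addr_gt0 ?mulr_gt0 ?addr_gt0 ?mulr_gt0.
Qed.
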